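(* If $\Omega$ is starlike with respect to $1$, then for every $f \in \mathcal{C}(\Omega)$ and every $r \in (0,1)$, \[ L_r(f) \leq L_r(k_\Omega), \] with equality if and only if $f(z) = \overline{\varepsilon}\, k_\Omega(\varepsilon z)$ for some $\varepsilon \in \partial\mathbb{D}$.
   Context: Let $\mathbb{D} = \{ z \in \mathbb{C} : |z|<1\}$ be the unit disk and $\partial\mathbb{D}$ the unit circle. Let $\mathcal{A}_0$ be the class of analytic functions $f$ in $\mathbb{D}$ with $f(0) = f'(0)-1 = 0$. Let $\Omega$ be a simply connected domain in $\mathbb{C}$ with $1 \in \Omega \neq \mathbb{C}$, and let $\phi_\Omega$ be the unique conformal mapping of $\mathbb{D}$ onto $\Omega$ with $\phi_\Omega(0)=1$ and $\phi_\Omega'(0)>0$. Define \[ \mathcal{C}(\Omega) = \left\{ f \in \mathcal{A}_0 : 1 + \frac{z f''(z)}{f'(z)} \in \Omega \text{ for all } z \in \mathbb{D} \right\}, \] and \[ k_\Omega(z) = \int_0^z \exp\left( \int_0^t \frac{\phi_\Omega(\zeta)-1}{\zeta}\, d\zeta \right) dt, \quad z \in \mathbb{D}, \] so that $k_\Omega \in \mathcal{C}(\Omega)$. For an analytic function $f$ in $\mathbb{D}$ and $0<r<1$, let \[ L_r(f) = \int_{-\pi}^{\pi} r\,|f'(re^{i\theta})|\, d\theta \] denote the arclength of the image of the circle $\{ z : |z| = r\}$ under $f$. *)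

(* Defs.v *)
From Stdlib Require Import Reals ClassicalEpsilon.
From Coquelicot Require Import Coquelicot.
Open Scope R_scope.

Notation CC := Complex.C.

Definition inD (z : CC) : Prop := Cmod z < 1.

Definition holo_D (f : CC -> CC) : Prop := forall z : CC, inD z -> ex_derive (K := C_AbsRing) (V := C_NormedModule) f z.

(* Complex derivative (the unique l with is_derive f z l, when it exists). *)
Definition Cderiv (f : CC -> CC) (z : CC) : CC :=
  epsilon (inhabits (RtoC 0)) (fun l : CC => is_derive (K := C_AbsRing) (V := C_NormedModule) f z l).

Definition A0 (f : CC -> CC) : Prop :=
  holo_D f /\ f (RtoC 0) = RtoC 0 /\ Cderiv f (RtoC 0) = RtoC 1.

Definition normalized_riemann_map (Omega : CC -> Prop) (phi : CC -> CC) : Prop :=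
  holo_D phi /\
  (forall z w : CC, inD z -> inD w -> phi z = phi w -> z = w) /\
  (forall w : CC, Omega w <-> exists z : CC, inD z /\ phi z = w) /\
  phi (RtoC 0) = RtoC 1 /\
  Im (Cderiv phi (RtoC 0)) = 0 /\ 0 < Re (Cderiv phi (RtoC 0)).

Definition starlike_wrt_1 (Omega : CC -> Prop) : Prop :=
  forall w : CC, Omega w -> forall t : R, 0 <= t <= 1 ->
    Omega (Cplus (RtoC 1) (Cmult (RtoC t) (Cminus w (RtoC 1)))).

(* The class C(Omega); f'(z) <> 0 is required for 1 + z f''/f' to be defined. *)
Definition classC (Omega : CC -> Prop) (f : CC -> CC) : Prop :=
  A0 f /\
  forall z : CC, inD z ->
    Cderiv f z <> RtoC 0 /\
    Omega (Cplus (RtoC 1)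
                 (Cdiv (Cmult z (Cderiv (Cderiv f) z)) (Cderiv f z))).

Definition cis (theta : R) : CC := (cos theta, sin theta).

Definition Cexp (z : CC) : CC := Cmult (RtoC (exp (Re z))) (cis (Im z)).

Definition seg_int (h : CC -> CC) (z : CC) : CC :=
  RInt (V := C_R_CompleteNormedModule) (fun s : R => Cmult (h (Cmult (RtoC s) z)) z) 0 1.

(* (phi(zeta) - 1)/zeta, with its removable singularity at 0 filled in by phi'(0). *)
Definition qphi (phi : CC -> CC) (zeta : CC) : CC :=
  if Req_EM_T (Cmod zeta) 0 then Cderiv phi (RtoC 0)
  else Cdiv (Cminus (phi zeta) (RtoC 1)) zeta.

Definition kOmega (phi : CC -> CC) (z : CC) : CC :=
  seg_int (fun t : CC => Cexp (seg_int (qphi phi) t)) z.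


(* Length of the image of |z| = r. *)
Definition Lr (r : R) (f : CC -> CC) : R :=
  RInt (fun theta : R => r * Cmod (Cderiv f (Cmult (RtoC r) (cis theta)))) (- PI) PI.

(* Main.v *)
Require Import Defs.
From Stdlib Require Import Reals Lra Lia ClassicalEpsilon Classical FunctionalExtensionality.
From Coquelicot Require Import Coquelicot.
Open Scope R_scope.

(* Put [g = phi - 1], [K = log k'] and [F = log f'], so that [z K' = g] and [z F' = g o omega]
   with [omega] a Schwarz function.  Since [g] is starlike, [K] is convex and injective: the
   direction of the outward normal [g] determines the point on each circle.  Comparing support
   functions radius by radius gives [F(D) <= K(D)], hence [F = K o w] with [w] a Schwarz
   function.  Now [|f'| = |h o w|^2] and [|k'| = |h|^2] for [h = exp (K / 2)], and Littlewood's
   inequality for square means, proved by iterating [h |-> (h - h(0)) / z], concludes; equality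
   forces [|w(z)| = |z|] somewhere, so that [w] is a rotation. *)

(** Let [H_K(rho)] be the maximum of [Re (c K)] over [|z| <= rho]. At a maximum point the tangential
    derivative vanishes, so [c g] is real and nonnegative there and [H_K] grows at the rate
    [Re (c g) / rho]; for [F] the rate is [Re (c g(omega)) / rho], with [c g(omega)] real too. As
    [g] maps concentric disks onto sets starlike about 0 and [|omega(z)| <= |z|], the value
    [g(omega)] cannot lie farther out on the common ray. The maximum point moves with [rho], which
    makes differentiating [H_K] delicate; finite increments avoid it. A value of [F] missed by [K]
    is excluded through the nearest point of the image under [K] of a closed disk: the normal there
    is a direction [c] violating the comparison.

    The backward shift [f |-> (f - f(0)) / z] replaces power series throughout: its iterates at 0
    are the Taylor coefficients, Cauchy's formula shows that it preserves holomorphy, and a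
    geometric bound on the iterates replaces convergence. In Littlewood's argument each shift leaves
    a nonnegative defect with the factor [r^2 - |w|^2]; in the case of equality already the first
    defect vanishes. *)

(** * Derivatives and continuity along an embedded domain *)

(* [i] embeds the domain in the plane: the identity gives complex derivatives and [RtoC]
   derivatives of curves. *)
Definition der {T : Type} (i f : T -> CC) (x : T) (l : CC) : Prop :=
  forall eps, 0 < eps -> exists delta, 0 < delta /\
    forall y, Cmod (i y - i x)%C < delta ->
      Cmod (f y - f x - l * (i y - i x))%C <= eps * Cmod (i y - i x)%C.

Definition cont {T : Type} (i f : T -> CC) (x : T) : Prop :=
  forall eps, 0 < eps -> exists delta, 0 < delta /\
    forall y, Cmod (i y - i x)%C < delta -> Cmod (f y - f x)%C < eps.

Notation idC := (fun z : CC => z).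
Notation cder := (der idC).
Notation rder := (der RtoC).
Notation ccont := (cont idC).
Notation rcont := (cont RtoC).

Lemma Cmod_minus_sym (a b : CC) : Cmod (a - b)%C = Cmod (b - a)%C.
Proof. rewrite <- Cmod_opp. f_equal. ring. Qed.

Lemma Cmod_triangle_sub (a b : CC) : Cmod (a - b)%C <= Cmod a + Cmod b.
Proof.
  unfold Cminus. eapply Rle_trans; [apply Cmod_triangle|]. rewrite Cmod_opp. lra.
Qed.

Lemma Cmod_ge_sub (a b : CC) : Cmod a - Cmod b <= Cmod (a - b)%C.
Proof.
  assert (H := Cmod_triangle (a - b)%C b).
  replace (a - b + b)%C with a in H by ring. lra.
Qed.

Lemma Cmod_neq0 (z : CC) : 0 < Cmod z -> z <> RtoC 0.
Proof. intros H E. rewrite E, Cmod_0 in H. lra. Qed.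

Lemma der_cont {T} (i f : T -> CC) x l : der i f x l -> cont i f x.
Proof.
  intros H eps He. destruct (H 1 Rlt_0_1) as [d [Hd H1]].
  assert (P := Cmod_ge_0 l).
  exists (Rmin d (eps / (Cmod l + 2))). split.
  - apply Rmin_glb_lt; auto. apply Rdiv_lt_0_compat; lra.
  - intros y Hy. assert (H2 := Rlt_le_trans _ _ _ Hy (Rmin_l _ _)).
    assert (H3 := Rlt_le_trans _ _ _ Hy (Rmin_r _ _)).
    specialize (H1 y H2).
    replace (f y - f x)%C with ((f y - f x - l * (i y - i x)) + l * (i y - i x))%C by ring.
    eapply Rle_lt_trans; [apply Cmod_triangle|]. rewrite Cmod_mult.
    apply Rle_lt_trans with ((Cmod l + 1) * Cmod (i y - i x)%C); [lra|].
    assert (P2 := Cmod_ge_0 (i y - i x)%C).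
    apply Rle_lt_trans with ((Cmod l + 2) * Cmod (i y - i x)%C); [nra|].
    apply (Rmult_lt_reg_r (/ (Cmod l + 2))); [apply Rinv_0_lt_compat; lra|].
    replace ((Cmod l + 2) * Cmod (i y - i x) * / (Cmod l + 2)) with (Cmod (i y - i x)%C)
      by (field; lra). exact H3.
Qed.

Lemma der_const {T} (i : T -> CC) (c : CC) x : der i (fun _ => c) x (RtoC 0).
Proof.
  intros eps He. exists 1. split; [lra|]. intros y _.
  replace (c - c - 0 * (i y - i x))%C with (RtoC 0) by ring. rewrite Cmod_0.
  apply Rmult_le_pos; [lra|apply Cmod_ge_0].
Qed.

Lemma der_id {T} (i : T -> CC) x : der i i x (RtoC 1).
Proof.
  intros eps He. exists 1. split; [lra|]. intros y _.
  replace (i y - i x - 1 * (i y - i x))%C with (RtoC 0) by ring. rewrite Cmod_0.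
  apply Rmult_le_pos; [lra|apply Cmod_ge_0].
Qed.

Lemma der_plus {T} (i f g : T -> CC) x l m :
  der i f x l -> der i g x m -> der i (fun y => f y + g y)%C x (l + m)%C.
Proof.
  intros Hf Hg eps He.
  destruct (Hf (eps / 2)) as [d1 [Hd1 H1]]; [lra|].
  destruct (Hg (eps / 2)) as [d2 [Hd2 H2]]; [lra|].
  exists (Rmin d1 d2). split; [apply Rmin_glb_lt; auto|].
  intros y Hy. specialize (H1 y (Rlt_le_trans _ _ _ Hy (Rmin_l _ _))).
  specialize (H2 y (Rlt_le_trans _ _ _ Hy (Rmin_r _ _))).
  replace (f y + g y - (f x + g x) - (l + m) * (i y - i x))%C
    with ((f y - f x - l * (i y - i x)) + (g y - g x - m * (i y - i x)))%C by ring.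
  eapply Rle_trans; [apply Cmod_triangle|]. lra.
Qed.

Lemma cont_comp {T} (i g : T -> CC) (f : CC -> CC) x :
  cont i g x -> ccont f (g x) -> cont i (fun y => f (g y)) x.
Proof.
  intros Hg Hf eps He. destruct (Hf eps He) as [d [Hd H]].
  destruct (Hg d Hd) as [d' [Hd' H']]. exists d'. split; auto.
Qed.

Lemma der_comp {T} (i g : T -> CC) (f : CC -> CC) x l m :
  der i g x l -> cder f (g x) m -> der i (fun y => f (g y)) x (m * l)%C.
Proof.
  intros Hg Hf eps He.
  assert (Pl := Cmod_ge_0 l). assert (Pm := Cmod_ge_0 m).
  destruct (Hf (eps / (2 * (Cmod l + 1)))) as [d1 [Hd1 H1]].
  { apply Rdiv_lt_0_compat; lra. }
  destruct (der_cont _ _ _ _ Hg d1 Hd1) as [d2 [Hd2 H2]].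
  destruct (Hg 1 Rlt_0_1) as [d3 [Hd3 H3]].
  destruct (Hg (eps / (2 * (Cmod m + 1)))) as [d4 [Hd4 H4]].
  { apply Rdiv_lt_0_compat; lra. }
  exists (Rmin d2 (Rmin d3 d4)). split.
  { repeat apply Rmin_glb_lt; auto. }
  intros y Hy.
  assert (Y2 := Rlt_le_trans _ _ _ Hy (Rmin_l _ _)).
  assert (Y := Rlt_le_trans _ _ _ Hy (Rmin_r _ _)).
  assert (Y3 := Rlt_le_trans _ _ _ Y (Rmin_l _ _)).
  assert (Y4 := Rlt_le_trans _ _ _ Y (Rmin_r _ _)).
  specialize (H2 y Y2). specialize (H1 (g y) H2). specialize (H3 y Y3). specialize (H4 y Y4).
  cbv beta in H1.
  set (h := (i y - i x)%C) in *. assert (Ph := Cmod_ge_0 h).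
  replace (f (g y) - f (g x) - m * l * h)%C
    with ((f (g y) - f (g x) - m * (g y - g x)) + m * (g y - g x - l * h))%C by ring.
  eapply Rle_trans; [apply Cmod_triangle|]. rewrite Cmod_mult.
  assert (G : Cmod (g y - g x)%C <= (Cmod l + 1) * Cmod h).
  { replace (g y - g x)%C with ((g y - g x - l * h) + l * h)%C by ring.
    eapply Rle_trans; [apply Cmod_triangle|]. rewrite Cmod_mult. lra. }
  assert (A : eps / (2 * (Cmod l + 1)) * Cmod (g y - g x)%C <= eps / 2 * Cmod h).
  { replace (eps / 2 * Cmod h) with (eps / (2 * (Cmod l + 1)) * ((Cmod l + 1) * Cmod h))
      by (field; lra).
    apply Rmult_le_compat_l; auto. left. apply Rdiv_lt_0_compat; lra. }
  assert (B : Cmod m * Cmod (g y - g x - l * h)%C <= eps / 2 * Cmod h).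
  { replace (eps / 2 * Cmod h) with ((Cmod m + 1) * (eps / (2 * (Cmod m + 1)) * Cmod h))
      by (field; lra).
    assert (Q := Cmod_ge_0 (g y - g x - l * h)%C). nra. }
  lra.
Qed.

Lemma der_ext {T} (i f g : T -> CC) x l :
  (forall y, f y = g y) -> der i f x l -> der i g x l.
Proof. intros E H. replace g with f; auto. apply functional_extensionality; auto. Qed.

Lemma der_eq {T} (i f : T -> CC) x l m : der i f x l -> l = m -> der i f x m.
Proof. intros H E. now rewrite <- E. Qed.

Lemma der_scal {T} (i f : T -> CC) c x l :
  der i f x l -> der i (fun y => c * f y)%C x (c * l)%C.
Proof.
  intros H. apply (der_comp i f (fun z => c * z)%C); auto.
  intros eps He. exists 1. split; [lra|]. intros y _. cbv beta.
  replace (c * y - c * f x - c * (y - f x))%C with (RtoC 0) by ring. rewrite Cmod_0.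
  apply Rmult_le_pos; [lra|apply Cmod_ge_0].
Qed.

Lemma cder_sqr (z : CC) : cder (fun y => y * y)%C z (2 * z)%C.
Proof.
  intros eps He. exists eps. split; [lra|]. intros y Hy. cbv beta in *.
  replace (y * y - z * z - 2 * z * (y - z))%C with ((y - z) * (y - z))%C by ring.
  rewrite Cmod_mult. apply Rmult_le_compat_r; [apply Cmod_ge_0|lra].
Qed.

(* Polarization reduces products to squares and the chain rule. *)
Lemma der_mult {T} (i f g : T -> CC) x l m :
  der i f x l -> der i g x m -> der i (fun y => f y * g y)%C x (l * g x + f x * m)%C.
Proof.
  intros Hf Hg.
  assert (A := der_comp _ _ _ _ _ _ (der_plus _ _ _ _ _ _ Hf Hg) (cder_sqr _)).
  assert (B := der_comp _ _ _ _ _ _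
    (der_plus _ _ _ _ _ _ Hf (der_scal _ _ (-1)%C _ _ Hg)) (cder_sqr _)).
  assert (H := der_plus _ _ _ _ _ _ (der_scal _ _ (1/4)%C _ _ A) (der_scal _ _ (-1/4)%C _ _ B)).
  cbv beta in H. eapply der_eq; [eapply der_ext; [|exact H]|].
  - intros y. cbv beta. field.
  - cbv beta. field.
Qed.

Lemma cder_inv (z : CC) : z <> RtoC 0 -> cder Cinv z (- / (z * z))%C.
Proof.
  intros Hz eps He. assert (P : 0 < Cmod z) by (apply Cmod_gt_0; auto).
  set (M := Cmod z) in *.
  (* The remainder is [(y - z)^2 / (z^2 y)], and [|y| > M / 2] bounds it by [2 |y - z|^2 / M^3]. *)
  exists (Rmin (M / 2) (eps * (M * M * M / 2))). split.
  { apply Rmin_glb_lt; [lra|]. apply Rmult_lt_0_compat; auto.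
    assert (0 < M * M) by nra. nra. }
  intros y Hy. cbv beta in *.
  assert (Y2 := Rlt_le_trans _ _ _ Hy (Rmin_l _ _)).
  assert (Y3 := Rlt_le_trans _ _ _ Hy (Rmin_r _ _)).
  assert (Py : M / 2 < Cmod y).
  { assert (H := Cmod_ge_sub z (z - y)%C). replace (z - (z - y))%C with y in H by ring.
    rewrite (Cmod_minus_sym z y) in H. fold M in H. lra. }
  assert (y <> RtoC 0) by (apply Cmod_neq0; lra).
  replace (/ y - / z - - / (z * z) * (y - z))%C
    with ((y - z) * (y - z) * / (z * z * y))%C by (field; auto).
  assert (z * z * y <> 0)%C by (repeat apply Cmult_neq_0; auto).
  rewrite !Cmod_mult, Cmod_inv, !Cmod_mult; auto. fold M.
  set (h := Cmod (y - z)%C) in *. assert (0 <= h) by apply Cmod_ge_0.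
  replace (h * h * / (M * M * Cmod y)) with (h * / (M * M * Cmod y) * h) by ring.
  apply Rmult_le_compat_r; auto.
  assert (Q : M * M * M / 2 <= M * M * Cmod y) by nra.
  assert (0 < M * M * M / 2) by (assert (0 < M * M) by nra; nra).
  apply (Rmult_le_reg_r (M * M * Cmod y)); [lra|].
  replace (h * / (M * M * Cmod y) * (M * M * Cmod y)) with h by (field; lra).
  apply Rle_trans with (eps * (M * M * M / 2)); [lra|].
  apply Rmult_le_compat_l; lra.
Qed.

Lemma der_inv {T} (i f : T -> CC) x l :
  f x <> RtoC 0 -> der i f x l -> der i (fun y => / f y)%C x (- l / (f x * f x))%C.
Proof.
  intros Hf H. eapply der_eq; [apply (der_comp i f Cinv); [exact H|apply cder_inv; auto]|].
  field. auto.
Qed.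

Lemma der_div {T} (i f g : T -> CC) x l m :
  g x <> RtoC 0 -> der i f x l -> der i g x m ->
  der i (fun y => f y / g y)%C x ((l * g x - f x * m) / (g x * g x))%C.
Proof.
  intros Hg Hf H. unfold Cdiv at 1.
  eapply der_eq; [apply der_mult; [exact Hf|apply der_inv; eauto]|].
  cbv beta. field. auto.
Qed.

Lemma der_minus {T} (i f g : T -> CC) x l m :
  der i f x l -> der i g x m -> der i (fun y => f y - g y)%C x (l - m)%C.
Proof.
  intros Hf Hg. eapply der_eq.
  eapply der_ext; [|apply (der_plus i f (fun y => (-1) * g y)%C); [exact Hf|apply der_scal; exact Hg]].
  - intros y. cbv beta. ring.
  - ring.
Qed.

Lemma der_pow {T} (i f : T -> CC) x l n :
  der i f x l -> exists m, der i (fun y => f y ^ n)%C x m.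
Proof.
  intros H. induction n as [|n [m IH]]; simpl.
  - eexists. apply der_const.
  - eexists. apply der_mult; eauto.
Qed.

Lemma der_local {T} (i f g : T -> CC) x l d :
  0 < d -> (forall y, Cmod (i y - i x)%C < d -> f y = g y) -> der i f x l -> der i g x l.
Proof.
  intros Hd E H eps He. destruct (H eps He) as [d' [Hd' H']].
  exists (Rmin d d'). split; [apply Rmin_glb_lt; auto|].
  intros y Hy. assert (Y2 := Rlt_le_trans _ _ _ Hy (Rmin_l _ _)).
  assert (Y3 := Rlt_le_trans _ _ _ Hy (Rmin_r _ _)).
  rewrite <- (E y Y2), <- (E x). { auto. }
  replace (i x - i x)%C with (RtoC 0) by ring. rewrite Cmod_0. lra.
Qed.

Lemma cont_const {T} (i : T -> CC) c x : cont i (fun _ => c) x.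
Proof. eapply der_cont, der_const. Qed.

Lemma cont_id {T} (i : T -> CC) x : cont i i x.
Proof. eapply der_cont, der_id. Qed.

Lemma cont_plus {T} (i f g : T -> CC) x :
  cont i f x -> cont i g x -> cont i (fun y => f y + g y)%C x.
Proof.
  intros Hf Hg eps He.
  destruct (Hf (eps / 2)) as [d1 [Hd1 H1]]; [lra|].
  destruct (Hg (eps / 2)) as [d2 [Hd2 H2]]; [lra|].
  exists (Rmin d1 d2). split; [apply Rmin_glb_lt; auto|].
  intros y Hy. specialize (H1 y (Rlt_le_trans _ _ _ Hy (Rmin_l _ _))).
  specialize (H2 y (Rlt_le_trans _ _ _ Hy (Rmin_r _ _))).
  replace (f y + g y - (f x + g x))%C with ((f y - f x) + (g y - g x))%C by ring.
  eapply Rle_lt_trans; [apply Cmod_triangle|]. lra.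
Qed.

Lemma cont_ext {T} (i f g : T -> CC) x :
  (forall y, f y = g y) -> cont i f x -> cont i g x.
Proof. intros E H. replace g with f; auto. apply functional_extensionality; auto. Qed.

Lemma cont_comp_der {T} (i g : T -> CC) (f : CC -> CC) x l :
  cont i g x -> cder f (g x) l -> cont i (fun y => f (g y)) x.
Proof. intros Hg Hf. apply cont_comp; auto. eapply der_cont; eauto. Qed.

Lemma cont_scal {T} (i f : T -> CC) c x : cont i f x -> cont i (fun y => c * f y)%C x.
Proof.
  intros H. apply (cont_comp_der i f (fun z => c * z)%C x (c * 1)); auto.
  apply der_scal, der_id.
Qed.

Lemma cont_minus {T} (i f g : T -> CC) x :
  cont i f x -> cont i g x -> cont i (fun y => f y - g y)%C x.
Proof.
  intros Hf Hg. eapply cont_ext; [|apply (cont_plus i f (fun y => (-1) * g y)%C); [exact Hf|apply cont_scal; exact Hg]].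
  intros y. cbv beta. ring.
Qed.

Lemma cont_mult {T} (i f g : T -> CC) x :
  cont i f x -> cont i g x -> cont i (fun y => f y * g y)%C x.
Proof.
  intros Hf Hg.
  assert (A := cont_comp_der _ _ _ _ _ (cont_plus _ _ _ _ Hf Hg) (cder_sqr _)).
  assert (B := cont_comp_der _ _ _ _ _ (cont_minus _ _ _ _ Hf Hg) (cder_sqr _)).
  eapply cont_ext; [|exact (cont_scal _ _ (1/4)%C _ (cont_minus _ _ _ _ A B))].
  intros y. cbv beta. field.
Qed.

Lemma cont_inv {T} (i f : T -> CC) x :
  f x <> RtoC 0 -> cont i f x -> cont i (fun y => / f y)%C x.
Proof. intros Hf H. apply (cont_comp_der i f Cinv x _ H (cder_inv _ Hf)). Qed.

Lemma cont_div {T} (i f g : T -> CC) x :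
  g x <> RtoC 0 -> cont i f x -> cont i g x -> cont i (fun y => f y / g y)%C x.
Proof. intros Hg Hf H. unfold Cdiv. apply cont_mult; auto. apply cont_inv; auto. Qed.

Lemma cont_Cmod {T} (i f : T -> CC) x : cont i f x -> cont i (fun y => RtoC (Cmod (f y))) x.
Proof.
  intros H eps He. destruct (H eps He) as [d [Hd Hx]]. exists d. split; auto.
  intros y Hy. specialize (Hx y Hy). rewrite <- RtoC_minus, Cmod_R.
  assert (A := Cmod_ge_sub (f y) (f x)). assert (B := Cmod_ge_sub (f x) (f y)).
  rewrite (Cmod_minus_sym (f x)) in B. apply Rabs_def1; lra.
Qed.

Lemma cont_Re {T} (i f : T -> CC) x : cont i f x -> cont i (fun y => RtoC (Re (f y))) x.
Proof.
  intros H eps He. destruct (H eps He) as [d [Hd Hx]]. exists d. split; auto.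
  intros y Hy. specialize (Hx y Hy). rewrite <- RtoC_minus, Cmod_R.
  eapply Rle_lt_trans; [|exact Hx].
  replace (Re (f y) - Re (f x)) with (Re (f y - f x)%C) by (destruct (f y), (f x); simpl; ring).
  apply re_le_Cmod.
Qed.

(** The bridge to the derivative used in the statement; computations stay with [cder], whose
    epsilon-delta form is shared with curves. *)
Lemma cder_is_derive (f : CC -> CC) z l :
  cder f z l <-> is_derive (K := C_AbsRing) (V := C_NormedModule) f z l.
Proof.
  split.
  - intros H. split; [apply is_linear_scal_l|].
    intros x Hx.
    apply (is_filter_lim_locally_unique (V := AbsRing_NormedModule C_AbsRing)) in Hx. subst x.
    intros [eps He]. destruct (H eps He) as [d [Hd H1]].
    exists (mkposreal d Hd). intros y Hy.
    specialize (H1 y Hy). simpl in *.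
    change (Cmod (f y - f z - (y - z) * l)%C <= eps * Cmod (y - z)%C).
    replace (f y - f z - (y - z) * l)%C with (f y - f z - l * (y - z))%C by ring. exact H1.
  - intros [_ H] eps He.
    specialize (H z (fun P HP => HP)). specialize (H (mkposreal eps He)).
    destruct H as [[d Hd] H]. exists d. split; auto.
    intros y Hy. specialize (H y Hy).
    change (Cmod (f y - f z - (y - z) * l)%C <= eps * Cmod (y - z)%C) in H.
    replace (f y - f z - l * (y - z))%C with (f y - f z - (y - z) * l)%C by ring. exact H.
Qed.

Lemma cder_unique (f : CC -> CC) z l m : cder f z l -> cder f z m -> l = m.
Proof.
  intros Hl Hm. apply cder_is_derive, is_C_derive_unique in Hl.
  apply cder_is_derive, is_C_derive_unique in Hm. congruence.
Qed.

(** [Cderiv] is a choice, so its value is reached only through uniqueness of the derivative. *)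
Lemma Cderiv_unique (f : CC -> CC) z l : cder f z l -> Cderiv f z = l.
Proof.
  intros H. unfold Cderiv. apply (cder_unique f z); auto. apply cder_is_derive.
  apply epsilon_spec. exists l. apply cder_is_derive; auto.
Qed.

Lemma rder_is_derive (f : R -> CC) t l :
  rder f t l -> is_derive (K := R_AbsRing) (V := C_R_NormedModule) f t l.
Proof.
  intros H. split; [apply is_linear_scal_l|].
  intros x Hx.
  apply (is_filter_lim_locally_unique (V := AbsRing_NormedModule R_AbsRing)) in Hx. subst x.
  intros [eps He]. destruct (H eps He) as [d [Hd H1]].
  exists (mkposreal d Hd). intros y Hy.
  assert (E : Cmod (y - t)%C = Rabs (y - t)) by (rewrite <- RtoC_minus; apply Cmod_R).
  specialize (H1 y). rewrite E in H1. specialize (H1 Hy).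
  replace (f y - f t - l * (y - t))%C with
    (f y - f t - scal (V := C_R_ModuleSpace) (y - t)%R l)%C in H1
    by (rewrite scal_R_Cmult, RtoC_minus; ring).
  rewrite Cmod_norm in H1. exact H1.
Qed.

Lemma rcont_continuous (f : R -> CC) t :
  rcont f t -> continuous (U := C_R_NormedModule) f t.
Proof.
  intros H P [[eps He] HP]. destruct (H eps He) as [d [Hd H1]].
  exists (mkposreal d Hd). intros y Hy. apply HP.
  apply (C_NormedModule_mixin_compat1 (f t) (f y) eps). simpl in *. apply H1.
  rewrite <- RtoC_minus, Cmod_R. exact Hy.
Qed.

Lemma rcont_real (u : R -> R) t : rcont (fun t => RtoC (u t)) t <-> continuous u t.
Proof.
  split.
  - intros H P [[eps He] HP]. destruct (H eps He) as [d [Hd H1]].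
    exists (mkposreal d Hd). intros y Hy. apply HP.
    change (Rabs (u y - u t) < eps).
    rewrite <- Cmod_R, RtoC_minus. apply H1.
    rewrite <- RtoC_minus, Cmod_R. exact Hy.
  - intros H eps He. destruct (H (fun z => Rabs (z - u t) < eps)) as [[d Hd] H1].
    { exists (mkposreal eps He). intros y Hy. exact Hy. }
    exists d. split; auto. intros y Hy. rewrite <- RtoC_minus, Cmod_R in *. apply H1. exact Hy.
Qed.

Lemma rder_of_is_derive (u : R -> R) (t l : R) : is_derive u t l -> rder (fun t => RtoC (u t)) t (RtoC l).
Proof.
  intros [_ H] eps He. specialize (H t (fun P HP => HP) (mkposreal eps He)).
  destruct H as [[d Hd] H]. exists d. split; auto.
  intros y Hy. rewrite <- RtoC_minus, Cmod_R in *. specialize (H y Hy).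
  change (Rabs (u y - u t - (y - t) * l) <= eps * Rabs (y - t)) in H.
  rewrite <- RtoC_minus, <- RtoC_mult, <- RtoC_minus, !Cmod_R.
  replace (u y - u t - l * (y - t)) with (u y - u t - (y - t) * l) by ring. exact H.
Qed.

Lemma rder_Re (f : R -> CC) t l : rder f t l -> is_derive (fun t => Re (f t)) t (Re l).
Proof.
  intros H. split; [apply is_linear_scal_l|].
  intros x Hx.
  apply (is_filter_lim_locally_unique (V := AbsRing_NormedModule R_AbsRing)) in Hx. subst x.
  intros [eps He]. destruct (H eps He) as [d [Hd H1]].
  exists (mkposreal d Hd). intros y Hy.
  assert (E : Cmod (y - t)%C = Rabs (y - t)) by (rewrite <- RtoC_minus; apply Cmod_R).
  specialize (H1 y). rewrite E in H1. specialize (H1 Hy).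
  change (Rabs (Re (f y) - Re (f t) - (y - t) * Re l) <= eps * Rabs (y - t)).
  eapply Rle_trans; [|exact H1].
  replace (Re (f y) - Re (f t) - (y - t) * Re l) with (Re (f y - f t - l * (y - t))%C).
  - apply re_le_Cmod.
  - destruct (f y), (f t), l; simpl; ring.
Qed.

(** * Complex integrals and the exponential *)

Notation CI := (RInt (V := C_R_CompleteNormedModule)).
Notation exI := (ex_RInt (V := C_R_NormedModule)).

(* Integrals live in [C_R_CompleteNormedModule]; [ring] needs the equality at type [C]. *)
Ltac C_eq := match goal with |- @eq _ ?x ?y => change (@eq CC x y) end.

Lemma exI_rcont (f : R -> CC) a b :
  a <= b -> (forall t, a <= t <= b -> rcont f t) -> exI f a b.
Proof.
  intros Hab H. apply (ex_RInt_continuous (V := C_R_CompleteNormedModule)).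
  rewrite Rmin_left, Rmax_right; auto. intros t Ht. apply rcont_continuous. auto.
Qed.

Lemma ex_RInt_rcont (u : R -> R) a b :
  a <= b -> (forall t, a <= t <= b -> rcont (fun t => RtoC (u t)) t) -> ex_RInt u a b.
Proof.
  intros Hab H. apply (ex_RInt_continuous (V := R_CompleteNormedModule)).
  rewrite Rmin_left, Rmax_right; auto. intros t Ht. apply rcont_real. auto.
Qed.

Lemma CI_correct (f : R -> CC) a b : exI f a b -> is_RInt (V := C_R_NormedModule) f a b (CI f a b).
Proof. intros H. apply (RInt_correct (V := C_R_CompleteNormedModule)); auto. Qed.

Lemma CI_unique (f : R -> CC) a b l : is_RInt (V := C_R_NormedModule) f a b l -> CI f a b = l.
Proof. intros H. apply (is_RInt_unique (V := C_R_CompleteNormedModule)); auto. Qed.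

Lemma CI_ext (f g : R -> CC) a b :
  a <= b -> (forall t, a <= t <= b -> f t = g t) -> CI f a b = CI g a b.
Proof.
  intros Hab H. apply (RInt_ext (V := C_R_CompleteNormedModule)).
  rewrite Rmin_left, Rmax_right; auto. intros; apply H; lra.
Qed.

Lemma CI_plus (f g : R -> CC) a b :
  exI f a b -> exI g a b -> CI (fun t => f t + g t)%C a b = (CI f a b + CI g a b)%C.
Proof.
  intros Hf Hg. apply CI_unique.
  apply (is_RInt_plus (V := C_R_NormedModule)); apply CI_correct; auto.
Qed.

(** The module behind [CI] has real scalars, so a complex factor has to be handled componentwise. *)
Lemma is_CI_scal (f : R -> CC) (c : CC) a b l :
  is_RInt (V := C_R_NormedModule) f a b l ->
  is_RInt (V := C_R_NormedModule) (fun t => c * f t)%C a b (c * l)%C.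
Proof.
  intros H.
  assert (H1 := is_RInt_fct_extend_fst (U := R_NormedModule) (V := R_NormedModule) f a b l H).
  assert (H2 := is_RInt_fct_extend_snd (U := R_NormedModule) (V := R_NormedModule) f a b l H).
  apply (is_RInt_fct_extend_pair (U := R_NormedModule) (V := R_NormedModule)).
  - apply (is_RInt_minus (V := R_NormedModule));
      apply (is_RInt_scal (V := R_NormedModule)); auto.
  - apply (is_RInt_plus (V := R_NormedModule));
      apply (is_RInt_scal (V := R_NormedModule)); auto.
Qed.

Lemma exI_scal (f : R -> CC) (c : CC) a b : exI f a b -> exI (fun t => c * f t)%C a b.
Proof. intros [l H]. eexists. apply is_CI_scal. exact H. Qed.

Lemma CI_scal (f : R -> CC) (c : CC) a b :
  exI f a b -> CI (fun t => c * f t)%C a b = (c * CI f a b)%C.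
Proof. intros H. apply CI_unique, is_CI_scal, CI_correct; auto. Qed.

Lemma exI_minus (f g : R -> CC) a b : exI f a b -> exI g a b -> exI (fun t => f t - g t)%C a b.
Proof. intros Hf Hg. apply (ex_RInt_minus (V := C_R_NormedModule)); auto. Qed.

Lemma exI_plus (f g : R -> CC) a b : exI f a b -> exI g a b -> exI (fun t => f t + g t)%C a b.
Proof. intros Hf Hg. apply (ex_RInt_plus (V := C_R_NormedModule)); auto. Qed.

Lemma CI_minus (f g : R -> CC) a b :
  exI f a b -> exI g a b -> CI (fun t => f t - g t)%C a b = (CI f a b - CI g a b)%C.
Proof.
  intros Hf Hg. apply CI_unique.
  apply (is_RInt_minus (V := C_R_NormedModule)); apply CI_correct; auto.
Qed.

Lemma CI_const (c : CC) a b : CI (fun _ => c) a b = ((b - a) * c)%C.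
Proof.
  apply CI_unique. rewrite <- RtoC_minus, <- scal_R_Cmult.
  apply (is_RInt_const (V := C_R_NormedModule)).
Qed.

Lemma CI_Chasles (f : R -> CC) a b c :
  exI f a b -> exI f b c -> (CI f a b + CI f b c)%C = CI f a c.
Proof. intros H1 H2. apply (RInt_Chasles (V := C_R_CompleteNormedModule)); auto. Qed.

Lemma CI_norm_le (f : R -> CC) (g : R -> R) a b :
  a <= b -> (forall t, a <= t <= b -> Cmod (f t) <= g t) -> exI f a b -> ex_RInt g a b ->
  Cmod (CI f a b) <= RInt g a b.
Proof.
  intros Hab H Hf Hg. rewrite Cmod_norm.
  apply (norm_RInt_le (V := C_R_NormedModule) f g a b); auto.
  - intros t Ht. change (norm (f t)) with (norm (f t : C_R_NormedModule)).
    specialize (H t Ht). rewrite Cmod_norm in H. exact H.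
  - apply CI_correct; auto.
  - apply (RInt_correct (V := R_CompleteNormedModule)); auto.
Qed.

Lemma CI_norm_le_const (f : R -> CC) (M : R) a b :
  a <= b -> (forall t, a <= t <= b -> Cmod (f t) <= M) -> exI f a b ->
  Cmod (CI f a b) <= (b - a) * M.
Proof.
  intros Hab H Hf. eapply Rle_trans; [apply (CI_norm_le f (fun _ => M)); auto|].
  - apply ex_RInt_const.
  - rewrite RInt_const. apply Rle_refl.
Qed.

Lemma CI_derive (f df : R -> CC) a b :
  a <= b -> (forall t, a <= t <= b -> rder f t (df t)) ->
  (forall t, a <= t <= b -> rcont df t) -> CI df a b = (f b - f a)%C.
Proof.
  intros Hab H Hc. apply CI_unique.
  apply (is_RInt_derive (V := C_R_CompleteNormedModule)); rewrite Rmin_left, Rmax_right; auto.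
  - intros t Ht. apply rder_is_derive. auto.
  - intros t Ht. apply rcont_continuous. auto.
Qed.

Lemma Re_CI (f : R -> CC) a b : exI f a b -> Re (CI f a b) = RInt (fun t => Re (f t)) a b.
Proof.
  intros H. symmetry. apply (is_RInt_unique (V := R_CompleteNormedModule)).
  apply (is_RInt_fct_extend_fst (U := R_NormedModule) (V := R_NormedModule) f a b).
  apply CI_correct; auto.
Qed.

Lemma exI_conj (f : R -> CC) a b :
  exI f a b -> is_RInt (V := C_R_NormedModule) (fun t => Cconj (f t)) a b (Cconj (CI f a b)).
Proof.
  intros H. apply CI_correct in H.
  assert (H1 := is_RInt_fct_extend_fst (U := R_NormedModule) (V := R_NormedModule) f a b _ H).
  assert (H2 := is_RInt_fct_extend_snd (U := R_NormedModule) (V := R_NormedModule) f a b _ H).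
  apply (is_RInt_fct_extend_pair (U := R_NormedModule) (V := R_NormedModule)); auto.
  apply (is_RInt_opp (V := R_NormedModule)); auto.
Qed.

Lemma CI_conj (f : R -> CC) a b :
  exI f a b -> CI (fun t => Cconj (f t)) a b = Cconj (CI f a b).
Proof. intros H. apply CI_unique, exI_conj; auto. Qed.

Lemma rcont_bounded (f : R -> CC) a b :
  a <= b -> (forall t, a <= t <= b -> rcont f t) ->
  exists t, a <= t <= b /\ forall s, a <= s <= b -> Cmod (f s) <= Cmod (f t).
Proof.
  intros Hab H.
  destruct (continuity_ab_maj (fun t => Cmod (f t)) a b Hab) as [t Ht].
  - intros c Hc. apply continuity_pt_filterlim, rcont_real, cont_Cmod. auto.
  - exists t. split; [apply Ht|]. intros s Hs. apply Ht; auto.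
Qed.

Lemma RInt_eq_0_cont (u : R -> R) a b :
  a < b -> (forall t, a <= t <= b -> 0 <= u t) ->
  (forall t, a <= t <= b -> continuous u t) -> RInt u a b = 0 ->
  forall t, a < t < b -> u t = 0.
Proof.
  intros Hab Hp Hc H0 t Ht.
  destruct (Rle_lt_or_eq_dec 0 (u t) (Hp t (conj (Rlt_le _ _ (proj1 Ht)) (Rlt_le _ _ (proj2 Ht)))))
    as [Hu|E]; auto. exfalso.
  destruct (Hc t ltac:(lra) (fun y => u t / 2 < y)) as [[d Hd] Hn].
  { exists (mkposreal (u t / 2) ltac:(lra)). intros y Hy.
    change (Rabs (y - u t) < u t / 2) in Hy. apply Rabs_def2 in Hy. lra. }
  set (e := Rmin (d / 2) ((b - t) / 2)).
  assert (He : 0 < e) by (apply Rmin_glb_lt; lra).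
  assert (He1 : e <= d / 2) by apply Rmin_l.
  assert (He2 : e <= (b - t) / 2) by apply Rmin_r.
  assert (EX : forall x y, a <= x -> x <= y -> y <= b -> ex_RInt u x y).
  { intros x y Hx Hy Hxy. apply (ex_RInt_continuous (V := R_CompleteNormedModule)).
    rewrite Rmin_left, Rmax_right; auto. intros; apply Hc; lra. }
  assert (C1 : RInt u a t + RInt u t b = RInt u a b)
    by (apply (RInt_Chasles u a t b); apply EX; lra).
  assert (C2 : RInt u t (t + e) + RInt u (t + e) b = RInt u t b)
    by (apply (RInt_Chasles u t (t + e) b); apply EX; lra).
  assert (P1 : 0 <= RInt u a t).
  { apply RInt_ge_0; [lra|apply EX; lra|]. intros; apply Hp; lra. }
  assert (P3 : 0 <= RInt u (t + e) b).
  { apply RInt_ge_0; [lra|apply EX; lra|]. intros; apply Hp; lra. }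
  assert (P2 : e * (u t / 2) <= RInt u t (t + e)).
  { replace (e * (u t / 2)) with (RInt (fun _ => u t / 2) t (t + e)).
    - apply RInt_le; [lra|apply ex_RInt_const|apply EX; lra|].
      intros x Hx. apply Rlt_le, Hn. change (Rabs (x - t) < d). apply Rabs_def1; lra.
    - rewrite RInt_const. unfold scal; simpl; unfold mult; simpl. ring. }
  assert (0 < e * (u t / 2)) by (apply Rmult_lt_0_compat; lra).
  lra.
Qed.

(** * The unit circle, polar form and the complex exponential *)

Lemma rder_cis t : rder cis t (Ci * cis t)%C.
Proof.
  apply (der_eq _ _ _ (- sin t + Ci * cos t)%C).
  - apply (der_ext _ (fun t => cos t + Ci * sin t)%C).
    + intros y. unfold cis, RtoC, Ci, Cplus, Cmult. simpl. f_equal; ring.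
    + apply der_plus.
      * rewrite <- RtoC_opp. apply rder_of_is_derive. auto_derive; auto. ring.
      * apply der_scal. apply rder_of_is_derive. auto_derive; auto. ring.
  - unfold cis, RtoC, Ci, Cplus, Cmult, Copp. simpl. f_equal; ring.
Qed.

Lemma Cmod_cis t : Cmod (cis t) = 1.
Proof.
  unfold Cmod, cis. simpl fst. simpl snd. rewrite <- !Rsqr_pow2, Rplus_comm, sin2_cos2.
  apply sqrt_1.
Qed.

Lemma cis_plus a b : cis (a + b) = (cis a * cis b)%C.
Proof. unfold cis, Cmult. simpl. rewrite cos_plus, sin_plus. f_equal; ring. Qed.

Lemma cis_0 : cis 0 = RtoC 1.
Proof. unfold cis. rewrite cos_0, sin_0. reflexivity. Qed.

Lemma cis_PI : cis (- PI) = cis PI.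
Proof. unfold cis. rewrite cos_neg, sin_neg, sin_PI, Ropp_0. reflexivity. Qed.

Lemma polar (z : CC) : exists t, - PI <= t <= PI /\ z = (Cmod z * cis t)%C.
Proof.
  destruct (Req_dec (Cmod z) 0) as [E|E].
  - exists 0. split; [assert (H := PI_RGT_0); lra|].
    apply Cmod_eq_0 in E. rewrite E, Cmod_0. ring.
  - assert (P : 0 < Cmod z) by (assert (H := Cmod_ge_0 z); lra).
    assert (S : Re z * Re z + Im z * Im z = Cmod z * Cmod z).
    { assert (H := Cmod2_alt z). simpl in H. lra. }
    set (x := Re z / Cmod z). set (y := Im z / Cmod z).
    assert (S1 : x * x + y * y = 1).
    { unfold x, y. apply (Rmult_eq_reg_r (Cmod z * Cmod z)); [|nra].
      field_simplify; lra. }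
    assert (X : -1 <= x <= 1) by nra.
    assert (B := acos_bound x).
    assert (Z : forall t, cos t = x -> sin t = y -> z = (Cmod z * cis t)%C).
    { intros t Hc Hs. unfold cis. rewrite Hc, Hs. unfold x, y, Cmult, RtoC. simpl.
      destruct z as [u v]. simpl. f_equal; field; auto. }
    assert (SQ : sqrt (1 - x²) = Rabs y).
    { rewrite <- sqrt_Rsqr_abs. f_equal. unfold Rsqr. lra. }
    (* [acos] determines the angle up to sign; the sign of the imaginary part decides. *)
    destruct (Rle_dec 0 y) as [Hy|Hy].
    + exists (acos x). split; [lra|]. apply Z; [apply cos_acos; auto|].
      rewrite sin_acos, SQ; auto. apply Rabs_pos_eq; auto.
    + exists (- acos x). split; [lra|]. apply Z; [rewrite cos_neg; apply cos_acos; auto|].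
      rewrite sin_neg, sin_acos, SQ; auto. rewrite Rabs_left; lra.
Qed.

Lemma Cexp_plus (z w : CC) : Cexp (z + w)%C = (Cexp z * Cexp w)%C.
Proof.
  unfold Cexp. replace (Re (z + w)%C) with (Re z + Re w) by (destruct z, w; reflexivity).
  replace (Im (z + w)%C) with (Im z + Im w) by (destruct z, w; reflexivity).
  rewrite exp_plus, cis_plus, RtoC_mult. ring.
Qed.

Lemma Cexp_0 : Cexp (RtoC 0) = RtoC 1.
Proof. unfold Cexp. simpl. rewrite exp_0, cis_0. ring. Qed.

Lemma Cmod_Cexp (z : CC) : Cmod (Cexp z) = exp (Re z).
Proof.
  unfold Cexp. rewrite Cmod_mult, Cmod_cis, Cmod_R, Rmult_1_r.
  apply Rabs_pos_eq. left. apply exp_pos.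
Qed.

Lemma Cexp_neq0 (z : CC) : Cexp z <> RtoC 0.
Proof. apply Cmod_neq0. rewrite Cmod_Cexp. apply exp_pos. Qed.

Lemma Cmod_le_Re_Im (z : CC) : Cmod z <= Rabs (Re z) + Rabs (Im z).
Proof.
  replace z with (RtoC (Re z) + Ci * RtoC (Im z))%C at 1.
  - eapply Rle_trans; [apply Cmod_triangle|]. rewrite Cmod_mult, Cmod_Ci, !Cmod_R. lra.
  - destruct z as [x y]. unfold Ci, RtoC, Cplus, Cmult. simpl. f_equal; ring.
Qed.

Lemma Im_le_Cmod (z : CC) : Rabs (Im z) <= Cmod z.
Proof. eapply Rle_trans; [|apply Rmax_Cmod]. apply Rmax_r. Qed.

Lemma real_der_small (u : R -> R) (l : R) : is_derive u 0 l ->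
  forall eps, 0 < eps -> exists d, 0 < d /\ forall x, Rabs x < d ->
    Rabs (u x - u 0 - l * x) <= eps * Rabs x.
Proof.
  intros H eps He. apply rder_of_is_derive in H. destruct (H eps He) as [d [Hd H1]].
  exists d. split; auto. intros x Hx. specialize (H1 x).
  rewrite <- RtoC_minus, <- RtoC_mult, <- !RtoC_minus, !Cmod_R, Rminus_0_r in H1. auto.
Qed.

Lemma cder_Cexp_0 : cder Cexp (RtoC 0) (RtoC 1).
Proof.
  (* Each component of the remainder is at most [3 * e * m] with [m = |h|], so [eps / 10] suffices;
     [e <= 1] keeps [exp x] below 2. *)
  intros eps He. set (e := Rmin (eps / 10) 1).
  assert (P : 0 < e) by (apply Rmin_glb_lt; lra).
  assert (P1 : e <= eps / 10) by apply Rmin_l. assert (P2 : e <= 1) by apply Rmin_r.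
  destruct (real_der_small exp 1 ltac:(auto_derive; auto; rewrite exp_0; ring) e P)
    as [d1 [D1 E1]].
  destruct (real_der_small cos 0 ltac:(auto_derive; auto; rewrite sin_0; ring) e P)
    as [d2 [D2 E2]].
  destruct (real_der_small sin 1 ltac:(auto_derive; auto; rewrite cos_0; ring) e P)
    as [d3 [D3 E3]].
  rewrite exp_0 in E1. rewrite cos_0 in E2. rewrite sin_0 in E3.
  exists (Rmin (Rmin d1 d2) (Rmin d3 (e / 2))). split.
  { repeat apply Rmin_glb_lt; lra. }
  intros h Hh. cbv beta in *. rewrite Cexp_0.
  replace (h - 0)%C with h in * by ring.
  assert (Ha := Rlt_le_trans _ _ _ Hh (Rmin_l _ _)).
  assert (Hb := Rlt_le_trans _ _ _ Hh (Rmin_r _ _)).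
  assert (H1 := Rlt_le_trans _ _ _ Ha (Rmin_l _ _)).
  assert (H2 := Rlt_le_trans _ _ _ Ha (Rmin_r _ _)).
  assert (H3 := Rlt_le_trans _ _ _ Hb (Rmin_l _ _)).
  assert (H4 := Rlt_le_trans _ _ _ Hb (Rmin_r _ _)).
  assert (Rx := re_le_Cmod h). assert (Ry := Im_le_Cmod h).
  set (m := Cmod h) in *. 
  replace (Cexp h - 1 - 1 * h)%C with
    ((exp (Re h) * (cos (Im h) - 1) + (exp (Re h) - 1 - Re h),
      exp (Re h) * (sin (Im h) - Im h) + (exp (Re h) - 1) * Im h) : CC).
  2:{ destruct h as [x y]. unfold Cexp, cis, RtoC, Cminus, Cplus, Cmult, Copp. simpl. f_equal; ring. }
  set (x := Re h) in *. set (y := Im h) in *.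
  specialize (E1 x ltac:(lra)). specialize (E2 y ltac:(lra)). specialize (E3 y ltac:(lra)).
  replace (cos y - 1 - 0 * y) with (cos y - 1) in E2 by ring.
  replace (sin y - 0 - 1 * y) with (sin y - y) in E3 by ring.
  replace (exp x - 1 - 1 * x) with (exp x - 1 - x) in E1 by ring.
  assert (Q0 := Rabs_pos x). assert (Q1 := Rabs_pos y).
  assert (X : Rabs (exp x - 1) <= e).
  { replace (exp x - 1) with ((exp x - 1 - x) + x) by ring.
    eapply Rle_trans; [apply Rabs_triang|]. nra. }
  assert (X2 : Rabs (exp x) <= 2).
  { replace (exp x) with ((exp x - 1) + 1) by ring.
    eapply Rle_trans; [apply Rabs_triang|]. rewrite Rabs_R1. lra. }
  eapply Rle_trans; [apply Cmod_le_Re_Im|]. simpl.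
  assert (B1 : Rabs (exp x * (cos y - 1) + (exp x - 1 - x)) <= 2 * (e * m) + e * m).
  { eapply Rle_trans; [apply Rabs_triang|]. rewrite Rabs_mult.
    apply Rplus_le_compat.
    - apply Rmult_le_compat; try apply Rabs_pos; auto. nra.
    - nra. }
  assert (B2 : Rabs (exp x * (sin y - y) + (exp x - 1) * y) <= 2 * (e * m) + e * m).
  { eapply Rle_trans; [apply Rabs_triang|]. rewrite !Rabs_mult.
    apply Rplus_le_compat.
    - apply Rmult_le_compat; try apply Rabs_pos; auto. nra.
    - apply Rmult_le_compat; try apply Rabs_pos; auto. }
  assert (0 <= m) by apply Cmod_ge_0. unfold Re, Im in *. simpl in *. nra.
Qed.

Lemma cder_Cexp z : cder Cexp z (Cexp z).
Proof.
  apply (der_eq _ _ _ (Cexp z * (1 * 1))%C); [|ring].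
  apply (der_ext _ (fun y => Cexp z * Cexp (y - z))%C).
  - intros y. rewrite <- Cexp_plus. f_equal. ring.
  - apply der_scal. apply (der_comp idC (fun y => y - z)%C Cexp).
    + apply (der_eq _ _ _ (1 - 0)%C); [|ring]. apply der_minus; [apply der_id|apply der_const].
    + cbv beta. replace (z - z)%C with (RtoC 0) by ring. apply cder_Cexp_0.
Qed.

(** * Goursat's lemma and Cauchy's formula *)

Lemma nested_intervals (a b : nat -> R) :
  (forall n, a n <= a (S n)) -> (forall n, b (S n) <= b n) -> (forall n, a n <= b n) ->
  exists X, forall n, a n <= X <= b n.
Proof.
  intros Ha Hb Hab.
  assert (MA : forall n k, a n <= a (n + k)%nat).
  { intros n k. induction k as [|k IH].
    - rewrite Nat.add_0_r. lra.
    - rewrite Nat.add_succ_r. eapply Rle_trans; [exact IH|apply Ha]. }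
  assert (MB : forall n k, b (n + k)%nat <= b n).
  { intros n k. induction k as [|k IH].
    - rewrite Nat.add_0_r. lra.
    - rewrite Nat.add_succ_r. eapply Rle_trans; [apply Hb|exact IH]. }
  assert (AB : forall m n, a m <= b n).
  { intros m n. apply Rle_trans with (a (m + n)%nat); [apply MA|].
    apply Rle_trans with (b (m + n)%nat); [apply Hab|].
    rewrite Nat.add_comm. apply MB. }
  destruct (completeness (fun r => exists n, r = a n)) as [X [HX1 HX2]].
  - exists (b 0%nat). intros r [n ->]. apply AB.
  - exists (a 0%nat). exists 0%nat. reflexivity.
  - exists X. intros n. split.
    + apply HX1. exists n. reflexivity.
    + apply HX2. intros r [m ->]. apply AB.
Qed.

Lemma pow_half_small (K d : R) : 0 < d -> exists n, K / 2 ^ n < d.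
Proof.
  intros Hd. destruct (Pow_x_infinity 2 ltac:(rewrite Rabs_pos_eq; lra) (Rabs K / d + 1)) as [n Hn].
  exists n. specialize (Hn n (le_n n)).
  assert (P : 0 < 2 ^ n) by (apply pow_lt; lra).
  rewrite Rabs_pos_eq in Hn by lra.
  apply Rle_lt_trans with (Rabs K / 2 ^ n).
  - apply Rmult_le_compat_r; [left; apply Rinv_0_lt_compat; auto|apply RRle_abs].
  - apply (Rmult_lt_reg_r (2 ^ n)); auto.
    replace (Rabs K / 2 ^ n * 2 ^ n) with (Rabs K) by (field; lra).
    apply Rlt_le_trans with (d * (Rabs K / d + 1)).
    + replace (d * (Rabs K / d + 1)) with (Rabs K + d) by (field; lra). lra.
    + apply Rmult_le_compat_l; lra.
Qed.

(* Goursat's bisection for an additive rectangle function: [mu x y w h] is the value on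
   [x, x + w] * [y, y + h]. *)
Lemma additive_rect_zero (mu : R -> R -> R -> R -> CC) (x0 y0 w0 h0 : R) :
  0 <= w0 -> 0 <= h0 ->
  (forall x y w h, x0 <= x -> y0 <= y -> 0 <= w -> 0 <= h ->
     x + 2 * w <= x0 + w0 -> y + 2 * h <= y0 + h0 ->
     mu x y (2 * w) (2 * h) =
       (mu x y w h + mu (x + w)%R y w h + mu x (y + h)%R w h + mu (x + w)%R (y + h)%R w h)%C) ->
  (forall X Y, x0 <= X <= x0 + w0 -> y0 <= Y <= y0 + h0 -> forall eps, 0 < eps ->
     exists d, 0 < d /\ forall x y w h,
       x0 <= x <= X -> X <= x + w <= x0 + w0 -> y0 <= y <= Y -> Y <= y + h <= y0 + h0 ->
       w < d -> h < d -> Cmod (mu x y w h) <= eps * (w + h) ^ 2) ->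
  mu x0 y0 w0 h0 = RtoC 0.
Proof.
  intros Hw Hh Add Loc. apply Cmod_eq_0. apply Rle_antisym; [|apply Cmod_ge_0].
  (* The first quarter carrying at least a fourth of the value is kept. The last one is taken
     untested: if the other three fail, the triangle inequality makes it large enough. *)
  set (nxt := fun w h (p : R * R) => let (x, y) := p in
     let m := Cmod (mu x y (2 * w) (2 * h)) / 4 in
     if Rle_dec m (Cmod (mu x y w h)) then (x, y) else
     if Rle_dec m (Cmod (mu (x + w) y w h)) then (x + w, y) else
     if Rle_dec m (Cmod (mu x (y + h) w h)) then (x, y + h) else (x + w, y + h)).
  set (sq := fix sq n := match n with O => (x0, y0)
                         | S n => nxt (w0 / 2 ^ S n) (h0 / 2 ^ S n) (sq n) end).
  set (W := fun n => w0 / 2 ^ n). set (H := fun n => h0 / 2 ^ n).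
  assert (P2 : forall n, 0 < 2 ^ n) by (intros; apply pow_lt; lra).
  assert (W2 : forall n, W n = 2 * W (S n)).
  { intros n. unfold W. simpl. field. specialize (P2 n). lra. }
  assert (H2 : forall n, H n = 2 * H (S n)).
  { intros n. unfold H. simpl. field. specialize (P2 n). lra. }
  assert (Wp : forall n, 0 <= W n).
  { intros n. apply Rmult_le_pos; auto. left. apply Rinv_0_lt_compat; auto. }
  assert (Hp : forall n, 0 <= H n).
  { intros n. apply Rmult_le_pos; auto. left. apply Rinv_0_lt_compat; auto. }
  set (M := Cmod (mu x0 y0 w0 h0)).
  assert (NX : forall n,
    (fst (sq (S n)) = fst (sq n) \/ fst (sq (S n)) = fst (sq n) + W (S n)) /\
    (snd (sq (S n)) = snd (sq n) \/ snd (sq (S n)) = snd (sq n) + H (S n))).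
  { intros n. simpl. destruct (sq n) as [x y]. unfold nxt. simpl fst. simpl snd.
    change (w0 / (2 * 2 ^ n)) with (W (S n)). change (h0 / (2 * 2 ^ n)) with (H (S n)).
    destruct (Rle_dec _ _); simpl; auto. destruct (Rle_dec _ _); simpl; auto.
    destruct (Rle_dec _ _); simpl; auto. }
  assert (IN : forall n, x0 <= fst (sq n) /\ fst (sq n) + W n <= x0 + w0 /\
                         y0 <= snd (sq n) /\ snd (sq n) + H n <= y0 + h0).
  { intros n. induction n as [|n IH].
    - simpl. unfold W, H. simpl. lra.
    - destruct (NX n) as [[E|E] [E'|E']]; rewrite E, E';
        specialize (W2 n); specialize (H2 n);
        assert (A1 := Wp (S n)); assert (A2 := Hp (S n)); lra. }
  assert (LB : forall n, M / 4 ^ n <= Cmod (mu (fst (sq n)) (snd (sq n)) (W n) (H n))).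
  { intros n. induction n as [|n IH].
    - simpl. unfold W, H, M. simpl. rewrite !Rdiv_1_r. lra.
    - replace (M / 4 ^ S n) with (M / 4 ^ n / 4)
        by (simpl; field; assert (0 < 4 ^ n) by (apply pow_lt; lra); lra).
      assert (I := IN n). simpl sq. rewrite W2, H2 in IH. rewrite W2, H2 in I.
      destruct (sq n) as [x y]. simpl fst in *. simpl snd in *. unfold nxt.
      change (w0 / (2 * 2 ^ n)) with (W (S n)). change (h0 / (2 * 2 ^ n)) with (H (S n)).
      assert (A := Add x y (W (S n)) (H (S n)) ltac:(lra) ltac:(lra) (Wp _) (Hp _)
                       ltac:(lra) ltac:(lra)).
      destruct (Rle_dec _ _) as [R1|R1]; simpl; [lra|].
      destruct (Rle_dec _ _) as [R2|R2]; simpl; [lra|].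
      destruct (Rle_dec _ _) as [R3|R3]; simpl; [lra|].
      rewrite A in IH, R1, R2, R3.
      set (a := mu x y (W (S n)) (H (S n))) in *.
      set (b := mu (x + W (S n)) y (W (S n)) (H (S n))) in *.
      set (c := mu x (y + H (S n)) (W (S n)) (H (S n))) in *.
      set (e := mu (x + W (S n)) (y + H (S n)) (W (S n)) (H (S n))) in *.
      assert (T1 := Cmod_triangle (a + b + c)%C e).
      assert (T2 := Cmod_triangle (a + b)%C c). assert (T3 := Cmod_triangle a b).
      lra. }
  destruct (nested_intervals (fun n => fst (sq n)) (fun n => fst (sq n) + W n)) as [X HX].
  { intros n. cbv beta. specialize (Wp (S n)). destruct (NX n) as [[E|E] _]; rewrite E; lra. }
  { intros n. cbv beta. specialize (Wp (S n)). specialize (W2 n).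
    destruct (NX n) as [[E|E] _]; rewrite E; lra. }
  { intros n. cbv beta. specialize (Wp n). lra. }
  destruct (nested_intervals (fun n => snd (sq n)) (fun n => snd (sq n) + H n)) as [Y HY].
  { intros n. cbv beta. specialize (Hp (S n)). destruct (NX n) as [_ [E|E]]; rewrite E; lra. }
  { intros n. cbv beta. specialize (Hp (S n)). specialize (H2 n).
    destruct (NX n) as [_ [E|E]]; rewrite E; lra. }
  { intros n. cbv beta. specialize (Hp n). lra. }
  cbv beta in HX, HY.
  apply Rnot_lt_le. intros HM. fold M in HM.
  set (S2 := (w0 + h0) ^ 2). assert (S2p : 0 <= S2) by apply pow2_ge_0.
  (* At depth [n] the value is at least [M / 4^n] and at most [eps * S2 / 4^n]; with this [eps] the
     latter is at most half the former. *)
  destruct (Loc X Y) with (eps := M / (2 * (S2 + 1))) as [d [Hd HL]].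
  { specialize (HX 0%nat). unfold W in HX. simpl in HX. rewrite Rdiv_1_r in HX. lra. }
  { specialize (HY 0%nat). unfold H in HY. simpl in HY. rewrite Rdiv_1_r in HY. lra. }
  { apply Rdiv_lt_0_compat; lra. }
  destruct (pow_half_small (w0 + h0) d Hd) as [n Hn].
  assert (WH : W n + H n = (w0 + h0) / 2 ^ n).
  { unfold W, H. field. specialize (P2 n). lra. }
  assert (I := IN n). assert (B1 := Wp n). assert (B2 := Hp n).
  specialize (HX n). specialize (HY n).
  assert (U := HL (fst (sq n)) (snd (sq n)) (W n) (H n)
    ltac:(lra) ltac:(lra) ltac:(lra) ltac:(lra) ltac:(lra) ltac:(lra)).
  specialize (LB n). rewrite WH in U.
  replace (((w0 + h0) / 2 ^ n) ^ 2) with (S2 / 4 ^ n) in U.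
  2:{ unfold Rdiv. rewrite Rpow_mult_distr, pow_inv, <- pow_mult, Nat.mul_comm, pow_mult.
      unfold S2. do 3 f_equal. ring. }
  assert (P4 : 0 < / 4 ^ n) by (apply Rinv_0_lt_compat, pow_lt; lra).
  assert (E : M * / 4 ^ n <= M / (2 * (S2 + 1)) * S2 * / 4 ^ n).
  { unfold Rdiv in *. lra. }
  apply Rmult_le_reg_r in E; auto.
  replace (M / (2 * (S2 + 1)) * S2) with (M * (S2 / (2 * (S2 + 1)))) in E by (field; lra).
  assert (S2 / (2 * (S2 + 1)) <= 1 / 2).
  { apply (Rmult_le_reg_r (2 * (S2 + 1))); [lra|].
    replace (S2 / (2 * (S2 + 1)) * (2 * (S2 + 1))) with S2 by (field; lra). lra. }
  nra.
Qed.

Definition circ (r t : R) : CC := (r * cis t)%C.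

Lemma Cmod_circ r t : 0 <= r -> Cmod (circ r t) = r.
Proof. intros H. unfold circ. rewrite Cmod_mult, Cmod_cis, Cmod_R, Rabs_pos_eq; lra. Qed.

Lemma rder_circ r t : rder (circ r) t (Ci * circ r t)%C.
Proof.
  unfold circ. eapply der_eq; [apply der_scal, rder_cis|]. ring.
Qed.

Lemma rcont_circ r t : rcont (circ r) t.
Proof. eapply der_cont, rder_circ. Qed.

Lemma circ_PI r : circ r (- PI) = circ r PI.
Proof. unfold circ. now rewrite cis_PI. Qed.

Lemma CI_icirc r a b : a <= b -> CI (fun t => Ci * circ r t)%C a b = (circ r b - circ r a)%C.
Proof.
  intros H. apply CI_derive; auto.
  - intros. apply rder_circ.
  - intros. apply cont_scal, rcont_circ.
Qed.

Lemma circ_lipschitz r a b : 0 <= r -> a <= b -> Cmod (circ r b - circ r a)%C <= r * (b - a).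
Proof.
  intros Hr H. rewrite <- CI_icirc, (Rmult_comm r); auto. apply CI_norm_le_const; auto.
  - intros t _. rewrite Cmod_mult, Cmod_Ci, Cmod_circ; lra.
  - apply exI_rcont; auto. intros. apply cont_scal, rcont_circ.
Qed.

Lemma circ_neq r t a : 0 <= r -> Cmod a < r -> (circ r t - a)%C <> RtoC 0.
Proof.
  intros Hr Ha. apply Cmod_neq0. assert (H := Cmod_ge_sub (circ r t) a).
  rewrite Cmod_circ in H; lra.
Qed.

Definition cdiff (f : CC -> CC) (z : CC) : Prop := exists l, cder f z l.

Lemma cdiff_cont f z : cdiff f z -> ccont f z.
Proof. intros [l H]. eapply der_cont; eauto. Qed.

(* The circle |z| = r is contracted linearly to a; for f = 1 and f = z - a the form
   f dz / (z - a) is exact in the coordinates (s, t). *)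
Lemma contract_invariant (f : CC -> CC) (r : R) (a : CC) (s1 : R) :
  0 < r -> Cmod a < r -> (forall z, Cmod z <= r -> cdiff f z) -> 0 < s1 < 1 ->
  CI (fun t => f (a + 1 * (circ r t - a))%C * (Ci * circ r t / (circ r t - a)))%C (- PI) PI =
  CI (fun t => f (a + s1 * (circ r t - a))%C * (Ci * circ r t / (circ r t - a)))%C (- PI) PI.
Proof.
  intros Hr Ha Hf Hs1.
  set (k := fun t => (Ci * circ r t / (circ r t - a))%C).
  set (Phi := fun (s t : R) => (a + s * (circ r t - a))%C).
  assert (Kc : forall t, rcont k t).
  { intros t. apply cont_div; [apply circ_neq; lra|apply cont_scal, rcont_circ|].
    apply cont_minus; [apply rcont_circ|apply cont_const]. }
  assert (PB : forall s t, 0 <= s <= 1 -> Cmod (Phi s t) <= r).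
  { intros s t Hs. unfold Phi.
    replace (a + s * (circ r t - a))%C with ((1 - s)%R * a + s * circ r t)%C
      by (rewrite RtoC_minus; ring).
    eapply Rle_trans; [apply Cmod_triangle|]. rewrite !Cmod_mult, !Cmod_R, Cmod_circ; [|lra].
    rewrite !Rabs_pos_eq; try lra. nra. }
  assert (Pt : forall s t, rcont (Phi s) t).
  { intros s t. apply cont_plus; [apply cont_const|]. apply cont_scal.
    apply cont_minus; [apply rcont_circ|apply cont_const]. }
  assert (Ps : forall s t, rcont (fun s => Phi s t) s).
  { intros s t. apply cont_plus; [apply cont_const|].
    apply cont_mult; [apply cont_id|apply cont_const]. }
  assert (Ft : forall s t, 0 <= s <= 1 -> rcont (fun t => f (Phi s t)) t).
  { intros s t Hs. apply cont_comp; [apply Pt|]. apply cdiff_cont; auto. }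
  assert (Fs : forall s t, 0 <= s <= 1 -> rcont (fun s => f (Phi s t)) s).
  { intros s t Hs. apply (cont_comp RtoC (fun s => Phi s t) f); [apply Ps|]. apply cdiff_cont; auto. }
  assert (NZ : forall s, s1 <= s -> RtoC s <> RtoC 0).
  { intros s Hs E. apply RtoC_inj in E. lra. }
  assert (EA : forall s x y, x <= y -> 0 <= s <= 1 -> exI (fun t => f (Phi s t) * k t)%C x y).
  { intros s x y Hxy Hs. apply exI_rcont; auto. intros t _. apply cont_mult; auto. }
  assert (EB : forall t x y, s1 <= x -> x <= y -> y <= 1 -> exI (fun s => f (Phi s t) / s)%C x y).
  { intros t x y Hx Hxy Hy. apply exI_rcont; auto. intros s Hs.
    apply cont_div; [apply NZ; lra|apply Fs; lra|apply cont_id]. }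
  (* For [z = a + s (circ r t - a)] one has [dz / (z - a) = ds / s + k t dt]. So [A] and [B]
     integrate [f dz / (z - a)] along the two kinds of sides, and [mu] is its integral around the
     rectangle. Keeping [s >= s1 > 0] avoids the pole. *)
  set (A := fun s x h => CI (fun t => f (Phi s t) * k t)%C x (x + h)%R).
  set (B := fun t s w => CI (fun s => f (Phi s t) / s)%C s (s + w)%R).
  set (mu := fun s t w h => (A (s + w)%R t h - A s t h - (B (t + h)%R s w - B t s w))%C).
  assert (Z : mu s1 (- PI) (1 - s1) (2 * PI) = RtoC 0).
  { assert (HPI := PI_RGT_0).
    apply additive_rect_zero; [lra|lra| |].
    - intros s t w h Hs Ht Hw Hh Hs' Ht'.
      assert (CA : forall u, s1 <= u <= 1 -> A u t (2 * h)%R = (A u t h + A u (t + h)%R h)%C).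
      { intros u Hu. unfold A. rewrite CI_Chasles; [|apply EA; lra..].
        f_equal. ring. }
      assert (CB : forall v, B v s (2 * w)%R = (B v s w + B v (s + w)%R w)%C).
      { intros u. unfold B. rewrite CI_Chasles; [|apply EB; lra..].
        f_equal. ring. }
      unfold mu. rewrite !CA, !CB by lra.
      replace (s + w + w)%R with (s + 2 * w)%R by ring.
      replace (t + h + h)%R with (t + 2 * h)%R by ring. ring.
    - intros S T HS HT eps He.
      destruct (Hf (Phi S T)) as [l Hl]; [apply PB; lra|].
      set (q := r / (r - Cmod a)).
      assert (Hq : 0 < q) by (apply Rdiv_lt_0_compat; lra).
      assert (His : 0 < / s1) by (apply Rinv_0_lt_compat; lra).
      (* [q] bounds the kernel [k] and [/ s1] bounds [1 / s]; the four remainder integrals then add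
         up to at most [eps * (w + h) ^ 2]. *)
      set (e := eps / (4 * r * (q + / s1))).
      assert (Hd4 : 0 < 4 * r * (q + / s1)) by (apply Rmult_lt_0_compat; lra).
      assert (eX : e * (4 * r * (q + / s1)) = eps).
      { unfold e, Rdiv. rewrite Rmult_assoc, Rinv_l; lra. }
      assert (Hep : 0 < e) by (apply Rdiv_lt_0_compat; auto).
      clearbody e. destruct (Hl e Hep) as [d [Hd HD]]. clear Hl.
      (* Points of the rectangle are mapped within [2 * r * (w + h) < d] of [Phi S T]. *)
      exists (d / (4 * r)). split; [apply Rdiv_lt_0_compat; lra|].
      intros s t w h Hs Hs' Ht Ht' Hw Hh.
      assert (W0 : 0 <= w) by lra. assert (H0 : 0 <= h) by lra.
      set (rho := fun z => (f z - f (Phi S T) - l * (z - Phi S T))%C).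
      assert (DPhi : forall u v, s <= u <= s + w -> t <= v <= t + h ->
                Cmod (Phi u v - Phi S T)%C <= 2 * r * (w + h)).
      { intros u v Hu Hv. unfold Phi.
        replace (a + u * (circ r v - a) - (a + S * (circ r T - a)))%C
          with ((u - S)%R * (circ r v - a) + S * (circ r v - circ r T))%C
          by (rewrite RtoC_minus; ring).
        eapply Rle_trans; [apply Cmod_triangle|]. rewrite !Cmod_mult, !Cmod_R.
        assert (L1 : Cmod (circ r v - a)%C <= 2 * r).
        { eapply Rle_trans; [apply Cmod_triangle_sub|]. rewrite Cmod_circ; lra. }
        assert (L2 : Cmod (circ r v - circ r T)%C <= r * h).
        { destruct (Rle_dec T v).
          - eapply Rle_trans; [apply circ_lipschitz; lra|]. apply Rmult_le_compat_l; lra.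
          - rewrite Cmod_minus_sym.
            eapply Rle_trans; [apply circ_lipschitz; lra|]. apply Rmult_le_compat_l; lra. }
        assert (L3 : Rabs (u - S) <= w) by (apply Rabs_le; lra).
        assert (L4 : Rabs S <= 1) by (apply Rabs_le; lra).
        assert (Rabs (u - S) * Cmod (circ r v - a) <= w * (2 * r)).
        { apply Rmult_le_compat; auto; [apply Rabs_pos|apply Cmod_ge_0]. }
        assert (Rabs S * Cmod (circ r v - circ r T) <= 1 * (r * h)).
        { apply Rmult_le_compat; auto; [apply Rabs_pos|apply Cmod_ge_0]. }
        nra. }
      assert (RB : forall u v, s <= u <= s + w -> t <= v <= t + h ->
                Cmod (rho (Phi u v)) <= e * (2 * r * (w + h))).
      { intros u v Hu Hv. assert (D := DPhi u v Hu Hv).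
        eapply Rle_trans; [apply HD|apply Rmult_le_compat_l; lra].
        eapply Rle_lt_trans; [exact D|].
        apply Rlt_le_trans with (2 * r * (d / (4 * r) + d / (4 * r))).
        - apply Rmult_lt_compat_l; lra.
        - right. field. lra. }
      assert (Rt : forall u v, 0 <= u <= 1 -> rcont (fun v => rho (Phi u v)) v).
      { intros u v Hu. unfold rho. apply cont_minus.
        - apply cont_minus; [apply Ft; auto|apply cont_const].
        - apply cont_scal, cont_minus; [apply Pt|apply cont_const]. }
      assert (Rs : forall u v, 0 <= u <= 1 -> rcont (fun u => rho (Phi u v)) u).
      { intros u v Hu. unfold rho. apply cont_minus.
        - apply cont_minus; [apply Fs; auto|apply cont_const].
        - apply cont_scal, cont_minus; [apply Ps|apply cont_const]. }
      (* Split [f z = A0 + l * (z - a) + rho z]: the first two terms give exact forms and cancel in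
         [mu], which leaves the integrals [R1] and [R2] of the remainder. *)
      set (A0 := (f (Phi S T) + l * (a - Phi S T))%C).
      set (R1 := fun u => CI (fun v => rho (Phi u v) * k v)%C t (t + h)%R).
      set (R2 := fun v => CI (fun u => rho (Phi u v) / u)%C s (s + w)%R).
      assert (AE : forall u, s <= u <= s + w ->
        A u t h = (A0 * CI k t (t + h)%R + l * u * (circ r (t + h) - circ r t) + R1 u)%C).
      { intros u Hu. unfold A, R1.
        rewrite <- CI_icirc, <- CI_scal, <- CI_scal, <- CI_plus, <- CI_plus; try lra.
        - apply CI_ext; [lra|]. intros v _. unfold rho, A0, Phi, k. field. apply circ_neq; lra.
        - apply exI_plus; apply exI_scal; apply exI_rcont; try lra; intros; auto.
          apply cont_scal, rcont_circ.
        - apply exI_rcont; [lra|]. intros v _. apply cont_mult; auto. apply Rt; lra.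
        - apply exI_scal. apply exI_rcont; [lra|auto].
        - apply exI_scal. apply exI_rcont; [lra|]. intros. apply cont_scal, rcont_circ.
        - apply exI_rcont; [lra|]. intros. apply cont_scal, rcont_circ.
        - apply exI_rcont; [lra|auto]. }
      assert (BE : forall v,
        B v s w = (A0 * CI (fun u => / u)%C s (s + w)%R + w * (l * (circ r v - a)) + R2 v)%C).
      { intros v. unfold B, R2.
        assert (E1 : exI (fun u => / u)%C s (s + w)).
        { apply exI_rcont; [lra|]. intros u Hu. apply cont_inv; [apply NZ; lra|apply cont_id]. }
        replace (w * (l * (circ r v - a)))%C with (CI (fun _ => l * (circ r v - a))%C s (s + w)%R).
        2:{ rewrite CI_const, RtoC_plus. C_eq. ring. }
        rewrite <- CI_scal, <- CI_plus, <- CI_plus; auto.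
        - apply CI_ext; [lra|]. intros u Hu. unfold rho, A0, Phi. field. apply NZ; lra.
        - apply exI_plus; [apply exI_scal; auto|]. apply ex_RInt_const.
        - apply exI_rcont; [lra|]. intros u Hu.
          apply cont_div; [apply NZ; lra|apply Rs; lra|apply cont_id].
        - apply exI_scal; auto.
        - apply ex_RInt_const. }
      assert (B1 : forall u, s <= u <= s + w ->
                Cmod (R1 u) <= h * (e * (2 * r * (w + h)) * q)).
      { intros u Hu. unfold R1. replace h with (t + h - t) at 2 by ring.
        apply CI_norm_le_const; [lra| |].
        - intros v Hv. rewrite Cmod_mult. apply Rmult_le_compat; try apply Cmod_ge_0; auto.
          unfold k, q. rewrite Cmod_div, Cmod_mult, Cmod_Ci, Cmod_circ by (try apply circ_neq; lra).
          unfold Rdiv. rewrite Rmult_1_l. apply Rmult_le_compat_l; [lra|].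
          apply Rinv_le_contravar; [lra|]. assert (X := Cmod_ge_sub (circ r v) a).
          rewrite Cmod_circ in X; lra.
        - apply exI_rcont; [lra|]. intros v _. apply cont_mult; auto. apply Rt; lra. }
      assert (B2 : forall v, t <= v <= t + h ->
                Cmod (R2 v) <= w * (e * (2 * r * (w + h)) * / s1)).
      { intros v Hv. unfold R2. replace w with (s + w - s) at 2 by ring.
        apply CI_norm_le_const; [lra| |].
        - intros u Hu. unfold Cdiv. rewrite Cmod_mult, Cmod_inv by (apply NZ; lra).
          apply Rmult_le_compat; auto; [apply Cmod_ge_0| |].
          + left. apply Rinv_0_lt_compat. apply Cmod_gt_0, NZ; lra.
          + rewrite Cmod_R, Rabs_pos_eq by lra. apply Rinv_le_contravar; lra.
        - apply exI_rcont; [lra|]. intros u Hu.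
          apply cont_div; [apply NZ; lra|apply Rs; lra|apply cont_id]. }
      replace (mu s t w h) with ((R1 (s + w)%R - R1 s) - (R2 (t + h)%R - R2 t))%C.
      2:{ unfold mu. rewrite !AE, !BE by lra. rewrite RtoC_plus. ring. }
      eapply Rle_trans; [apply Cmod_triangle_sub|].
      assert (T1 := Cmod_triangle_sub (R1 (s + w)) (R1 s)).
      assert (T2 := Cmod_triangle_sub (R2 (t + h)) (R2 t)).
      assert (Q1 := B1 (s + w) ltac:(lra)). assert (Q2 := B1 s ltac:(lra)).
      assert (Q3 := B2 (t + h) ltac:(lra)). assert (Q4 := B2 t ltac:(lra)).
      apply Rle_trans with (2 * (h * q + w * / s1) * (e * (2 * r * (w + h)))); [nra|].
      replace (eps * (w + h) ^ 2)
        with (2 * ((w + h) * (q + / s1)) * (e * (2 * r * (w + h))))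
        by (rewrite <- eX; ring).
      apply Rmult_le_compat_r; [repeat apply Rmult_le_pos; lra|].
      assert (0 <= w * q) by (apply Rmult_le_pos; lra).
      assert (0 <= h * / s1) by (apply Rmult_le_pos; lra). lra. }
  unfold mu in Z. replace (- PI + 2 * PI)%R with PI in Z by ring.
  replace (s1 + (1 - s1))%R with 1%R in Z by ring.
  (* The sides [t = - PI] and [t = PI] are the same segment because the circle closes up, so they
     cancel. *)
  assert (E : B PI s1 (1 - s1)%R = B (- PI)%R s1 (1 - s1)%R).
  { unfold B. f_equal. apply functional_extensionality. intros s. unfold Phi.
    now rewrite circ_PI. }
  rewrite E in Z. unfold A in Z. replace (- PI + 2 * PI)%R with PI in Z by ring.
  unfold Phi, k in Z.
  match type of Z with (?x - ?y - ?z)%C = _ =>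
    replace x with ((x - y - z) + y + z)%C by ring; rewrite Z end.
  C_eq. ring.
Qed.

Lemma Cmod_ker_le r t a : Cmod a < r -> Cmod (circ r t / (circ r t - a))%C <= r / (r - Cmod a).
Proof.
  intros Ha. assert (P := Cmod_ge_0 a). rewrite Cmod_div, Cmod_circ by (try apply circ_neq; lra).
  apply Rmult_le_compat_l; [lra|]. apply Rinv_le_contravar; [lra|].
  assert (X := Cmod_ge_sub (circ r t) a). rewrite Cmod_circ in X; lra.
Qed.

Lemma rcont_ker r t a : Cmod a < r -> rcont (fun t => circ r t / (circ r t - a))%C t.
Proof.
  intros Ha. assert (P := Cmod_ge_0 a).
  apply cont_div; [apply circ_neq; lra|apply rcont_circ|].
  apply cont_minus; [apply rcont_circ|apply cont_const].
Qed.

Lemma rcont_on_circ (f : CC -> CC) r t :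
  0 <= r -> (forall z, Cmod z = r -> cdiff f z) -> rcont (fun t => f (circ r t)) t.
Proof.
  intros Hr Hf. apply cont_comp; [apply rcont_circ|]. apply cdiff_cont, Hf, Cmod_circ, Hr.
Qed.

(** The contracted integral is independent of [s] and tends to the right-hand side as [s] tends to
    0. The integral of the kernel is evaluated later, in [CI_ker]. *)
Lemma cauchy_unnormalized (f : CC -> CC) (r : R) (a : CC) :
  Cmod a < r -> (forall z, Cmod z <= r -> cdiff f z) ->
  CI (fun t => f (circ r t) * (circ r t / (circ r t - a)))%C (- PI) PI =
  (f a * CI (fun t => circ r t / (circ r t - a))%C (- PI) PI)%C.
Proof.
  intros Ha Hf. assert (Pa := Cmod_ge_0 a). assert (HPI := PI_RGT_0).
  set (k := fun t => (circ r t / (circ r t - a))%C).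
  assert (Kc : forall t, rcont k t) by (intros; apply rcont_ker; auto).
  assert (Fc : forall s t, 0 <= s <= 1 -> rcont (fun t => f (a + s * (circ r t - a))%C) t).
  { intros s t Hs. apply (cont_comp RtoC (fun t => a + s * (circ r t - a))%C f).
    - apply cont_plus; [apply cont_const|]. apply cont_scal.
      apply cont_minus; [apply rcont_circ|apply cont_const].
    - apply cdiff_cont, Hf.
      replace (a + s * (circ r t - a))%C with ((1 - s)%R * a + s * circ r t)%C
        by (rewrite RtoC_minus; ring).
      eapply Rle_trans; [apply Cmod_triangle|]. rewrite !Cmod_mult, !Cmod_R, Cmod_circ; [|lra].
      rewrite !Rabs_pos_eq; try lra. nra. }
  assert (EX : forall s, 0 <= s <= 1 -> exI (fun t => f (a + s * (circ r t - a)) * k t)%C (- PI) PI).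
  { intros s Hs. apply exI_rcont; [lra|]. intros t _. apply cont_mult; auto. }
  assert (INV : forall s, 0 < s < 1 ->
    CI (fun t => f (circ r t) * k t)%C (- PI) PI =
    CI (fun t => f (a + s * (circ r t - a)) * k t)%C (- PI) PI).
  { intros s Hs. assert (H := contract_invariant f r a s ltac:(lra) Ha Hf Hs).
    assert (X : forall u, 0 <= u <= 1 ->
      CI (fun t => f (a + u * (circ r t - a))%C * (Ci * circ r t / (circ r t - a)))%C (- PI) PI
      = (Ci * CI (fun t => f (a + u * (circ r t - a)) * k t)%C (- PI) PI)%C).
    { intros u Hu. rewrite <- CI_scal by (apply EX; auto).
      apply CI_ext; [lra|]. intros t _. unfold k. C_eq. field. apply circ_neq; lra. }
    rewrite !X in H by lra.
    replace (CI (fun t => f (circ r t) * k t)%C (- PI) PI)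
      with (CI (fun t => f (a + 1 * (circ r t - a)) * k t)%C (- PI) PI).
    - apply (f_equal (fun z => / Ci * z)%C) in H. rewrite !Cmult_assoc, Cinv_l in H by apply Ci_nz.
      rewrite !Cmult_1_l in H. exact H.
    - apply CI_ext; [lra|]. intros t _. f_equal. f_equal. ring. }
  change (CI (fun t => f (circ r t) * k t)%C (- PI) PI = (f a * CI k (- PI) PI)%C).
  apply Ceq_minus, Cmod_eq_0, Rle_antisym; [|apply Cmod_ge_0].
  apply Rnot_lt_le. intros Hlt.
  match type of Hlt with 0 < ?m => set (m0 := m) in * end.
  set (q := r / (r - Cmod a)).
  assert (Hq : 0 < q) by (apply Rdiv_lt_0_compat; lra).
  (* Integrated against a kernel bounded by [q], this tolerance bounds the difference by [m0 / 2],
     although its modulus is [m0]. *)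
  destruct (cdiff_cont f a ltac:(apply Hf; lra) (m0 / (4 * PI * q))) as [d [Hd HD]].
  { apply Rdiv_lt_0_compat; auto. apply Rmult_lt_0_compat; lra. }
  set (s := Rmin (1 / 2) (d / (4 * r))).
  assert (Hs : 0 < s) by (apply Rmin_glb_lt; [lra|apply Rdiv_lt_0_compat; lra]).
  assert (Hs1 : s <= 1 / 2) by apply Rmin_l.
  assert (Hs2 : s <= d / (4 * r)) by apply Rmin_r.
  assert (U : m0 <= (PI - - PI) * (m0 / (4 * PI * q) * q)).
  { unfold m0 at 1. rewrite (INV s) by lra.
    rewrite <- CI_scal, <- CI_minus.
    - apply CI_norm_le_const; [lra| |].
      + intros t _. replace (f (a + s * (circ r t - a)) * k t - f a * k t)%C
          with ((f (a + s * (circ r t - a)) - f a) * k t)%C by ring.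
        rewrite Cmod_mult. apply Rmult_le_compat; try apply Cmod_ge_0.
        * left. apply HD. replace (a + s * (circ r t - a) - a)%C with (s * (circ r t - a))%C by ring.
          rewrite Cmod_mult, Cmod_R, Rabs_pos_eq by lra.
          assert (Y := Cmod_triangle_sub (circ r t) a). rewrite Cmod_circ in Y by lra.
          apply Rle_lt_trans with (d / (4 * r) * (2 * r)).
          -- apply Rmult_le_compat; try lra. apply Cmod_ge_0.
          -- replace (d / (4 * r) * (2 * r)) with (d / 2) by (field; lra). lra.
        * apply Cmod_ker_le; auto.
      + apply exI_minus; [apply EX; lra|apply exI_scal, exI_rcont; auto; lra].
    - apply EX; lra.
    - apply exI_scal, exI_rcont; auto; lra.
    - apply exI_rcont; auto; lra. }
  replace ((PI - - PI) * (m0 / (4 * PI * q) * q)) with (m0 / 2) in U by (field; lra).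
  lra.
Qed.

Lemma circ_nz r t : 0 < r -> circ r t <> RtoC 0.
Proof. intros H. apply Cmod_neq0. rewrite Cmod_circ; lra. Qed.

(** At the centre the kernel is identically 1, so this case precedes [CI_ker] and serves to prove
    it. *)
Lemma mean_value (f : CC -> CC) (r : R) :
  0 < r -> (forall z, Cmod z <= r -> cdiff f z) ->
  CI (fun t => f (circ r t)) (- PI) PI = (2 * PI * f (RtoC 0))%C.
Proof.
  intros Hr Hf. assert (HPI := PI_RGT_0).
  assert (H := cauchy_unnormalized f r (RtoC 0) ltac:(rewrite Cmod_0; lra) Hf).
  assert (E : forall t, (circ r t / (circ r t - 0))%C = RtoC 1).
  { intros t. field. assert (Z := circ_nz r t Hr).
    try split; auto; replace (circ r t - 0)%C with (circ r t) by ring; auto. }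
  rewrite (CI_ext (fun t => circ r t / (circ r t - 0))%C (fun _ => RtoC 1)), CI_const in H;
    [|lra|auto].
  rewrite <- (CI_ext (fun t => f (circ r t) * (circ r t / (circ r t - 0)))%C); [|lra|].
  - rewrite H. C_eq. rewrite RtoC_opp. ring.
  - intros t _. rewrite E. C_eq. ring.
Qed.

(* The conjugate of the kernel is r^2/(r^2 - conj(a) z), which is holomorphic on the disk. *)
Lemma CI_ker (r : R) (a : CC) :
  Cmod a < r -> CI (fun t => circ r t / (circ r t - a))%C (- PI) PI = (2 * PI)%C.
Proof.
  intros Ha. assert (Pa := Cmod_ge_0 a). assert (HPI := PI_RGT_0).
  assert (NZ : forall z, Cmod z <= r -> ((r * r)%R - Cconj a * z)%C <> RtoC 0).
  { intros z Hz. apply Cmod_neq0.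
    assert (X := Cmod_ge_sub (r * r)%R (Cconj a * z)%C).
    rewrite Cmod_mult, Cmod_conj, Cmod_R, Rabs_pos_eq in X by nra.
    assert (Cmod a * Cmod z < r * r); [|lra]. assert (Y := Cmod_ge_0 z). nra. }
  assert (M := mean_value (fun z => (r * r)%R / ((r * r)%R - Cconj a * z))%C r ltac:(lra)).
  rewrite <- (Cconj_conj (CI _ _ _)), <- CI_conj.
  - rewrite (CI_ext _ (fun t => (r * r)%R / ((r * r)%R - Cconj a * circ r t))%C); [|lra|].
    + rewrite M.
      * replace ((r * r)%R - Cconj a * 0)%C with (RtoC (r * r)) by ring.
        replace (2 * PI * (RtoC (r * r) / RtoC (r * r)))%C with (2 * PI)%C.
        -- unfold Cconj, RtoC, Cmult. simpl. C_eq. f_equal; ring.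
        -- C_eq. field. intros E. apply RtoC_inj in E. nra.
      * intros z Hz. eexists. apply der_div; [apply NZ; auto|apply der_const|].
        apply der_minus; [apply der_const|apply der_scal, der_id].
    + intros t _. rewrite Cdiv_conj by (apply circ_neq; lra). rewrite Cminus_conj.
      assert (Hc : (circ r t * Cconj (circ r t))%C = RtoC (r * r)).
      { rewrite <- Cmod2_conj, Cmod_circ by lra. f_equal. ring. }
      assert (N := NZ (circ r t) ltac:(rewrite Cmod_circ; lra)). rewrite <- Hc in N |- *.
      assert (N2 : (Cconj (circ r t) - Cconj a)%C <> RtoC 0).
      { rewrite <- Cminus_conj. apply Cmod_neq0. rewrite Cmod_conj.
        apply Cmod_gt_0, circ_neq; lra. }
      C_eq. field. repeat split; auto.
  - apply exI_rcont; [lra|]. intros. apply rcont_ker; auto.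
Qed.

Lemma cauchy_formula (f : CC -> CC) (r : R) (a : CC) :
  Cmod a < r -> (forall z, Cmod z <= r -> cdiff f z) ->
  CI (fun t => f (circ r t) * (circ r t / (circ r t - a)))%C (- PI) PI = (2 * PI * f a)%C.
Proof.
  intros Ha Hf. rewrite cauchy_unnormalized, CI_ker by auto. C_eq. ring.
Qed.

(** * Holomorphic functions on a disk *)

Definition hol (R : R) (f : CC -> CC) : Prop := forall z, Cmod z < R -> cdiff f z.

Lemma cdiff_ex_derive f z :
  cdiff f z <-> ex_derive (K := C_AbsRing) (V := C_NormedModule) f z.
Proof. split; intros [l H]; exists l; apply cder_is_derive; auto. Qed.

Lemma cdiff_cderiv f z : cdiff f z -> cder f z (Cderiv f z).
Proof. intros [l H]. now rewrite (Cderiv_unique f z l H). Qed.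

Lemma cdiff_comp f g z : cdiff g z -> cdiff f (g z) -> cdiff (fun w => f (g w)) z.
Proof. intros [l H] [m H']. eexists. eapply der_comp; eauto. Qed.

Lemma cdiff_mult f g z : cdiff f z -> cdiff g z -> cdiff (fun w => f w * g w)%C z.
Proof. intros [l H] [m H']. eexists. eapply der_mult; eauto. Qed.

Lemma cdiff_plus f g z : cdiff f z -> cdiff g z -> cdiff (fun w => f w + g w)%C z.
Proof. intros [l H] [m H']. eexists. eapply der_plus; eauto. Qed.

Lemma cdiff_minus f g z : cdiff f z -> cdiff g z -> cdiff (fun w => f w - g w)%C z.
Proof. intros [l H] [m H']. eexists. eapply der_minus; eauto. Qed.

Lemma cdiff_div f g z : g z <> RtoC 0 -> cdiff f z -> cdiff g z -> cdiff (fun w => f w / g w)%C z.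
Proof. intros Hz [l H] [m H']. eexists. eapply der_div; eauto. Qed.

Lemma cdiff_const c z : cdiff (fun _ => c) z.
Proof. eexists. apply der_const. Qed.

Lemma cdiff_id z : cdiff (fun w => w) z.
Proof. eexists. apply der_id. Qed.

Lemma cdiff_scal c f z : cdiff f z -> cdiff (fun w => c * f w)%C z.
Proof. intros H. apply cdiff_mult; auto. apply cdiff_const. Qed.

Lemma cdiff_exp f z : cdiff f z -> cdiff (fun w => Cexp (f w)) z.
Proof. intros H. apply (cdiff_comp Cexp f); auto. eexists. apply cder_Cexp. Qed.

Lemma cdiff_local f g z d :
  0 < d -> (forall w, Cmod (w - z)%C < d -> f w = g w) -> cdiff f z -> cdiff g z.
Proof. intros Hd E [l H]. exists l. eapply der_local; eauto. Qed.

Lemma cder_of_quadratic (f : CC -> CC) z l d K :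
  0 < d -> (forall w, Cmod (w - z)%C < d ->
    Cmod (f w - f z - l * (w - z))%C <= K * (Cmod (w - z)%C * Cmod (w - z)%C)) ->
  cder f z l.
Proof.
  intros Hd H eps He.
  exists (Rmin d (eps / (Rabs K + 1))).
  assert (PK := Rabs_pos K).
  split. { apply Rmin_glb_lt; auto. apply Rdiv_lt_0_compat; lra. }
  intros w Hw. assert (W1 := Rlt_le_trans _ _ _ Hw (Rmin_l _ _)).
  assert (W2 := Rlt_le_trans _ _ _ Hw (Rmin_r _ _)).
  eapply Rle_trans; [apply H; auto|].
  set (h := Cmod (w - z)%C) in *. assert (Ph : 0 <= h) by apply Cmod_ge_0.
  assert (K <= Rabs K) by apply RRle_abs.
  assert (Rabs K * h <= eps).
  { apply Rle_trans with ((Rabs K + 1) * (eps / (Rabs K + 1))).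
    - apply Rmult_le_compat; lra.
    - right. field. lra. }
  rewrite <- Rmult_assoc. apply Rmult_le_compat_r; auto.
  apply Rle_trans with (Rabs K * h); auto. apply Rmult_le_compat_r; auto.
Qed.

(** Up to the factor [2 * PI], the density [f(zeta) * zeta] represents [f] for [n = 1] and its
    derivative for [n = 2], while the density [f(zeta)] with [n = 1] represents the backward shift
    of [f]. *)
Definition cauchy_transform (u : R -> CC) (r : R) (n : nat) (z : CC) : CC :=
  CI (fun t => u t * (/ (circ r t - z)) ^ n)%C (- PI) PI.

Lemma circ_dist r t z rho : Cmod z <= rho -> 0 <= r -> r - rho <= Cmod (circ r t - z)%C.
Proof. intros Hz Hr. assert (X := Cmod_ge_sub (circ r t) z). rewrite Cmod_circ in X; lra. Qed.

Lemma Cmod_inv_le (w : CC) d : 0 < d -> d <= Cmod w -> Cmod (/ w)%C <= / d.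
Proof.
  intros Hd H. rewrite Cmod_inv by (apply Cmod_neq0; lra). apply Rinv_le_contravar; auto.
Qed.

Lemma rcont_pow f n t : rcont f t -> rcont (fun t => f t ^ n)%C t.
Proof.
  intros H. induction n as [|n IH]; simpl; [apply cont_const|apply cont_mult; auto].
Qed.

Lemma cauchy_transform_ex u r n z : (forall t, rcont u t) -> Cmod z < r ->
  exI (fun t => u t * (/ (circ r t - z)) ^ n)%C (- PI) PI.
Proof.
  intros Hu Hz. assert (HPI := PI_RGT_0). assert (P := Cmod_ge_0 z).
  apply exI_rcont; [lra|]. intros t _. apply cont_mult; auto. apply rcont_pow, cont_inv.
  - apply circ_neq; lra.
  - apply cont_minus; [apply rcont_circ|apply cont_const].
Qed.

(** The Taylor remainder of [1 / (zeta - z)^n] is [h^2] times products of [n + 2] kernels: one such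
    product for [n = 1], and three counted with multiplicity for [n = 2], whence the constant 3. *)
Lemma cauchy_transform_quadratic (u : R -> CC) (r rho U : R) (n : nat) (z w : CC) :
  (n = 1 \/ n = 2)%nat ->
  (forall t, rcont u t) -> (forall t, - PI <= t <= PI -> Cmod (u t) <= U) ->
  rho < r -> Cmod z <= rho -> Cmod w <= rho ->
  Cmod (cauchy_transform u r n w - cauchy_transform u r n z - INR n * cauchy_transform u r (S n) z * (w - z))%C
  <= 2 * PI * (U * (3 * (/ (r - rho)) ^ (n + 2))) * (Cmod (w - z)%C * Cmod (w - z)%C).
Proof.
  intros Hn Hu HU Hr Hz Hw. assert (HPI := PI_RGT_0).
  assert (Pz := Cmod_ge_0 z). assert (Pw := Cmod_ge_0 w).
  assert (Pd : 0 < r - rho) by lra.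
  assert (U0 : 0 <= U) by (eapply Rle_trans; [apply Cmod_ge_0|apply (HU 0); lra]).
  set (i := / (r - rho)). assert (Pi : 0 < i) by (apply Rinv_0_lt_compat; auto).
  set (h := (w - z)%C).
  unfold cauchy_transform. set (kz := fun t => (/ (circ r t - z))%C). set (kw := fun t => (/ (circ r t - w))%C).
  assert (Ez := fun n => cauchy_transform_ex u r n z Hu ltac:(lra)).
  assert (Ew := fun n => cauchy_transform_ex u r n w Hu ltac:(lra)).
  change (Cmod (CI (fun t => u t * kw t ^ n) (- PI) PI - CI (fun t => u t * kz t ^ n) (- PI) PI -
           INR n * CI (fun t => u t * kz t ^ S n) (- PI) PI * h)%C
    <= 2 * PI * (U * (3 * i ^ (n + 2))) * (Cmod h * Cmod h)).
  replace (CI (fun t => u t * kw t ^ n) (- PI) PI - CI (fun t => u t * kz t ^ n) (- PI) PI -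
           INR n * CI (fun t => u t * kz t ^ S n) (- PI) PI * h)%C
    with (CI (fun t => u t * kw t ^ n - u t * kz t ^ n - INR n * h * (u t * kz t ^ S n))%C (- PI) PI).
  2:{ rewrite (CI_minus (fun t => u t * kw t ^ n - u t * kz t ^ n)%C
                  (fun t => INR n * h * (u t * kz t ^ S n))%C).
      - rewrite (CI_minus (fun t => u t * kw t ^ n)%C (fun t => u t * kz t ^ n)%C), CI_scal.
        + C_eq. ring.
        + apply Ez.
        + apply Ew.
        + apply Ez.
      - apply exI_minus; [apply Ew|apply Ez].
      - apply exI_scal, Ez. }
  eapply Rle_trans.
  - apply (CI_norm_le_const _ (U * (3 * i ^ (n + 2)) * (Cmod h * Cmod h))); [lra| |].
    + intros t Ht.
      assert (Nz : (circ r t - z)%C <> RtoC 0) by (apply circ_neq; lra).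
      assert (Nw : (circ r t - w)%C <> RtoC 0) by (apply circ_neq; lra).
      assert (Bz : Cmod (kz t) <= i).
      { apply Cmod_inv_le; auto. apply circ_dist; lra. }
      assert (Bw : Cmod (kw t) <= i).
      { apply Cmod_inv_le; auto. apply circ_dist; lra. }
      assert (Qz := Cmod_ge_0 (kz t)). assert (Qw := Cmod_ge_0 (kw t)).
      assert (Qh := Cmod_ge_0 h).
      assert (E2 : forall x, 0 <= x -> x <= i -> x * x <= i * i) by (intros; apply Rmult_le_compat; auto).
      assert (Z2 := E2 _ Qz Bz). assert (W2 := E2 _ Qw Bw).
      destruct Hn as [-> | ->].
      * replace (u t * kw t ^ 1 - u t * kz t ^ 1 - INR 1 * h * (u t * kz t ^ 2))%C
          with (u t * (kz t * kz t * kw t) * (h * h))%C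
          by (unfold kz, kw, h; simpl; field; auto).
        rewrite !Cmod_mult. apply Rmult_le_compat_r; [nra|].
        apply Rmult_le_compat; auto; [apply Cmod_ge_0|nra|].
        replace (i ^ (1 + 2)) with (i * i * i) by (simpl; ring).
        assert (Cmod (kz t) * Cmod (kz t) * Cmod (kw t) <= i * i * i).
        { apply Rmult_le_compat; auto; nra. }
        assert (0 <= i * i * i) by (apply Rlt_le; repeat apply Rmult_lt_0_compat; auto).
        lra.
      * replace (u t * kw t ^ 2 - u t * kz t ^ 2 - INR 2 * h * (u t * kz t ^ 3))%C
          with (u t * (kz t * kz t * (kw t * kw t) + 2 * (kz t * kz t * (kz t * kw t))) * (h * h))%C
          by (unfold kz, kw, h; simpl INR; rewrite RtoC_plus; simpl; field; auto).
        rewrite Cmod_mult, (Cmod_mult (u t)), (Cmod_mult h h). apply Rmult_le_compat_r; [nra|].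
        apply Rmult_le_compat; auto; try apply Cmod_ge_0.
        eapply Rle_trans; [apply Cmod_triangle|]. rewrite !Cmod_mult, Cmod_R.
        rewrite Rabs_pos_eq by lra.
        replace (i ^ (2 + 2)) with (i * i * (i * i)) by (simpl; ring).
        assert (Cmod (kz t) * Cmod (kz t) * (Cmod (kw t) * Cmod (kw t)) <= i * i * (i * i)).
        { apply Rmult_le_compat; auto; nra. }
        assert (Cmod (kz t) * Cmod (kz t) * (Cmod (kz t) * Cmod (kw t)) <= i * i * (i * i)).
        { apply Rmult_le_compat; auto; try nra. }
        lra.
    + apply exI_minus; [apply exI_minus; [apply Ew|apply Ez]|apply exI_scal, Ez].
  - right. ring.
Qed.

Lemma cder_cauchy_transform (u : R -> CC) (r : R) (n : nat) (z : CC) :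
  (n = 1 \/ n = 2)%nat -> (forall t, rcont u t) -> Cmod z < r ->
  cder (cauchy_transform u r n) z (INR n * cauchy_transform u r (S n) z)%C.
Proof.
  intros Hn Hu Hz. assert (HPI := PI_RGT_0).
  destruct (rcont_bounded u (- PI) PI ltac:(lra) ltac:(auto)) as [t0 [_ HU]].
  eapply cder_of_quadratic with (d := (r - Cmod z) / 2); [lra|].
  intros w Hw. apply (cauchy_transform_quadratic u r ((r + Cmod z) / 2) (Cmod (u t0)) n z w); auto; try lra.
  assert (X := Cmod_triangle (w - z)%C z). replace (w - z + z)%C with w in X by ring. lra.
Qed.

Lemma PI2_neq0 : (2 * PI)%C <> RtoC 0.
Proof.
  rewrite <- RtoC_mult. intros E. apply RtoC_inj in E. assert (H := PI_RGT_0). lra.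
Qed.

Lemma hol_as_cauchy_transform f r z :
  Cmod z < r -> (forall z, Cmod z <= r -> cdiff f z) ->
  f z = (/ (2 * PI) * cauchy_transform (fun t => f (circ r t) * circ r t)%C r 1 z)%C.
Proof.
  intros Hz Hf. assert (HPI := PI_RGT_0). assert (P := Cmod_ge_0 z).
  assert (H := cauchy_formula f r z Hz Hf). unfold cauchy_transform.
  rewrite (CI_ext _ (fun t => f (circ r t) * (circ r t / (circ r t - z)))%C); [|lra|].
  - rewrite H. C_eq. rewrite Cmult_assoc, Cinv_l; [ring|apply PI2_neq0].
  - intros t _. C_eq. simpl. field. apply circ_neq; lra.
Qed.

Lemma rcont_dens f r t :
  0 <= r -> (forall z, Cmod z <= r -> cdiff f z) -> rcont (fun t => f (circ r t) * circ r t)%C t.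
Proof.
  intros Hr Hf. apply cont_mult; [|apply rcont_circ].
  apply rcont_on_circ; auto. intros z Hz. apply Hf. lra.
Qed.

Lemma Cderiv_as_cauchy_transform f r z :
  Cmod z < r -> (forall z, Cmod z <= r -> cdiff f z) ->
  Cderiv f z = (/ (2 * PI) * cauchy_transform (fun t => f (circ r t) * circ r t)%C r 2 z)%C.
Proof.
  intros Hz Hf. assert (P := Cmod_ge_0 z). apply Cderiv_unique.
  apply (der_local _ (fun z => (/ (2 * PI) * cauchy_transform (fun t => f (circ r t) * circ r t) r 1 z)%C)
           _ _ _ (r - Cmod z)); [lra| |].
  - intros w Hw. symmetry. apply hol_as_cauchy_transform; auto.
    assert (X := Cmod_triangle (w - z)%C z). replace (w - z + z)%C with w in X by ring. lra.
  - eapply der_eq; [apply der_scal, cder_cauchy_transform; auto; intros; apply rcont_dens; auto; lra|].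
    simpl. ring.
Qed.

Lemma hol_closed R f r : hol R f -> r < R -> forall z, Cmod z <= r -> cdiff f z.
Proof. intros H Hr z Hz. apply H. lra. Qed.

Lemma hol_Cderiv R f : hol R f -> hol R (Cderiv f).
Proof.
  intros H z Hz. set (r := (Cmod z + R) / 2). assert (P := Cmod_ge_0 z).
  assert (Hf := hol_closed R f r H ltac:(unfold r; lra)).
  apply (cdiff_local (fun z => (/ (2 * PI) * cauchy_transform (fun t => f (circ r t) * circ r t) r 2 z)%C)
           _ _ (r - Cmod z)); [unfold r; lra| |].
  - intros w Hw. symmetry. apply Cderiv_as_cauchy_transform; auto.
    assert (X := Cmod_triangle (w - z)%C z). replace (w - z + z)%C with w in X by ring. lra.
  - eexists. apply der_scal, cder_cauchy_transform; auto; [|unfold r; lra].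
    intros; apply rcont_dens; auto; unfold r; lra.
Qed.

(** The uniformity in both points is what differentiation under the integral sign and the
    discretized comparison of support functions rely on. *)
Lemma hol_quadratic R f rho : hol R f -> 0 <= rho < R -> exists K, 0 <= K /\
  forall z w, Cmod z <= rho -> Cmod w <= rho ->
  Cmod (f w - f z - Cderiv f z * (w - z))%C <= K * (Cmod (w - z)%C * Cmod (w - z)%C).
Proof.
  intros H Hr. assert (HPI := PI_RGT_0). set (r := (rho + R) / 2).
  assert (Hr1 : rho < r < R) by (unfold r; lra).
  assert (Hf := hol_closed R f r H ltac:(lra)).
  set (u := fun t => (f (circ r t) * circ r t)%C).
  assert (Hu : forall t, rcont u t) by (intros; apply rcont_dens; auto; lra).
  destruct (rcont_bounded u (- PI) PI ltac:(lra) ltac:(auto)) as [t0 [_ HU]].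
  exists (Cmod (/ (2 * PI))%C * (2 * PI * (Cmod (u t0) * (3 * (/ (r - rho)) ^ (1 + 2))))).
  split.
  { apply Rmult_le_pos; [apply Cmod_ge_0|]. apply Rmult_le_pos; [lra|].
    apply Rmult_le_pos; [apply Cmod_ge_0|]. apply Rmult_le_pos; [lra|].
    apply pow_le. left. apply Rinv_0_lt_compat. lra. }
  intros z w Hz Hw.
  rewrite (hol_as_cauchy_transform f r z), (hol_as_cauchy_transform f r w), (Cderiv_as_cauchy_transform f r z) by (auto; lra).
  fold u.
  replace (/ (2 * PI) * cauchy_transform u r 1 w - / (2 * PI) * cauchy_transform u r 1 z - / (2 * PI) * cauchy_transform u r 2 z * (w - z))%C
    with (/ (2 * PI) * (cauchy_transform u r 1 w - cauchy_transform u r 1 z - INR 1 * cauchy_transform u r 2 z * (w - z)))%C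
    by (simpl; ring).
  rewrite Cmod_mult, Rmult_assoc. apply Rmult_le_compat_l; [apply Cmod_ge_0|].
  apply cauchy_transform_quadratic; auto; lra.
Qed.

(** The backward shift of Hardy space theory: it deletes the constant Taylor coefficient and moves
    the others down. The case distinction copies that of [qphi], so that the two agree when
    [f 0 = 1]. *)
Definition backshift (f : CC -> CC) (z : CC) : CC :=
  if Req_EM_T (Cmod z) 0 then Cderiv f (RtoC 0) else ((f z - f (RtoC 0)) / z)%C.

Lemma backshift_0 f : backshift f (RtoC 0) = Cderiv f (RtoC 0).
Proof. unfold backshift. rewrite Cmod_0. destruct (Req_EM_T 0 0); congruence. Qed.

Lemma backshift_neq f z : z <> RtoC 0 -> backshift f z = ((f z - f (RtoC 0)) / z)%C.
Proof.
  intros H. unfold backshift. destruct (Req_EM_T (Cmod z) 0) as [E|E]; auto.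
  apply Cmod_eq_0 in E. congruence.
Qed.

Lemma backshift_eq f z : f z = (f (RtoC 0) + z * backshift f z)%C.
Proof.
  destruct (classic (z = RtoC 0)) as [-> | H]; [ring|].
  rewrite backshift_neq by auto. field. auto.
Qed.

(** Since [zeta / (zeta - z) = 1 + z / (zeta - z)], subtracting [f 0] from Cauchy's formula leaves a
    factor [z]. Dividing by it gives an expression that makes sense at 0 as well. *)
Lemma backshift_as_cauchy_transform f r z :
  Cmod z < r -> (forall z, Cmod z <= r -> cdiff f z) ->
  backshift f z = (/ (2 * PI) * cauchy_transform (fun t => f (circ r t)) r 1 z)%C.
Proof.
  intros Hz Hf. assert (P := Cmod_ge_0 z). assert (HPI := PI_RGT_0).
  assert (Fc : forall t, rcont (fun t => f (circ r t)) t).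
  { intros t. apply rcont_on_circ; [lra|]. intros; apply Hf; lra. }
  destruct (classic (z = RtoC 0)) as [-> | H].
  - rewrite backshift_0, (Cderiv_as_cauchy_transform f r); auto. f_equal. unfold cauchy_transform.
    apply CI_ext; [lra|]. intros t _. C_eq. simpl.
    field. apply circ_nz; lra.
  - rewrite backshift_neq by auto.
    rewrite (hol_as_cauchy_transform f r z), (hol_as_cauchy_transform f r (RtoC 0)) by (auto; rewrite Cmod_0; lra).
    assert (Hu : forall t, rcont (fun t => f (circ r t) * circ r t)%C t)
      by (intros; apply rcont_dens; auto; lra).
    replace (cauchy_transform (fun t => f (circ r t) * circ r t)%C r 1 z)
      with (cauchy_transform (fun t => f (circ r t) * circ r t)%C r 1 (RtoC 0) + z * cauchy_transform (fun t => f (circ r t)) r 1 z)%C.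
    + field. split; auto. intros E. apply PI2_neq0. rewrite E. ring.
    + unfold cauchy_transform. rewrite <- CI_scal, <- CI_plus.
      * apply CI_ext; [lra|]. intros t _. C_eq. simpl.
        field. split; [apply circ_neq; lra|apply circ_nz; lra].
      * apply cauchy_transform_ex; auto. rewrite Cmod_0; lra.
      * apply exI_scal, cauchy_transform_ex; auto.
      * apply cauchy_transform_ex; auto.
Qed.

Lemma hol_backshift R f : hol R f -> hol R (backshift f).
Proof.
  intros H z Hz. set (r := (Cmod z + R) / 2). assert (P := Cmod_ge_0 z).
  assert (Hf := hol_closed R f r H ltac:(unfold r; lra)).
  apply (cdiff_local (fun z => (/ (2 * PI) * cauchy_transform (fun t => f (circ r t)) r 1 z)%C)
           _ _ (r - Cmod z)); [unfold r; lra| |].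
  - intros w Hw. symmetry. apply backshift_as_cauchy_transform; auto.
    assert (X := Cmod_triangle (w - z)%C z). replace (w - z + z)%C with w in X by ring. lra.
  - eexists. apply der_scal, cder_cauchy_transform; auto; [|unfold r; lra].
    intros t. apply rcont_on_circ; [unfold r; lra|]. intros; apply Hf; lra.
Qed.

Lemma cont_eq_at (f g : CC -> CC) z d :
  0 < d -> ccont f z -> ccont g z -> (forall w, 0 < Cmod (w - z)%C < d -> f w = g w) -> f z = g z.
Proof.
  intros Hd Hf Hg E. apply Ceq_minus, Cmod_eq_0, Rle_antisym; [|apply Cmod_ge_0].
  apply Rnot_lt_le. intros L. set (e := Cmod (f z - g z)%C) in *.
  destruct (Hf (e / 2) ltac:(lra)) as [d1 [D1 H1]]. destruct (Hg (e / 2) ltac:(lra)) as [d2 [D2 H2]].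
  set (m := Rmin d (Rmin d1 d2)).
  assert (Pm : 0 < m) by (repeat apply Rmin_glb_lt; auto).
  assert (M1 : m <= d) by apply Rmin_l.
  assert (M2 : m <= d1) by (eapply Rle_trans; [apply Rmin_r|apply Rmin_l]).
  assert (M3 : m <= d2) by (eapply Rle_trans; [apply Rmin_r|apply Rmin_r]).
  set (w := (z + (m / 2)%R)%C).
  assert (Cw : Cmod (w - z)%C = m / 2).
  { replace (w - z)%C with (RtoC (m / 2)) by (unfold w; ring).
    rewrite Cmod_R, Rabs_pos_eq; lra. }
  specialize (E w ltac:(lra)). specialize (H1 w ltac:(lra)). specialize (H2 w ltac:(lra)).
  assert (T := Cmod_triangle_sub (g w - g z)%C (f w - f z)%C).
  replace (g w - g z - (f w - f z))%C with (f z - g z)%C in T by (rewrite E; ring).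
  fold e in T. lra.
Qed.

(** Riemann's argument: [z^2 f(z)] is differentiable at 0 with derivative 0. Shifting it twice gives
    a holomorphic function equal to [f] off 0, and at 0 by continuity. *)
Lemma removable R f :
  0 < R -> ccont f (RtoC 0) -> (forall z, 0 < Cmod z < R -> cdiff f z) -> hol R f.
Proof.
  intros HR Hc Hf z Hz.
  assert (Z0 : forall w : CC, (w - 0)%C = w) by (intros; ring).
  destruct (Rle_lt_or_eq_dec 0 (Cmod z) (Cmod_ge_0 z)) as [L|E]; [apply Hf; lra|].
  symmetry in E. apply Cmod_eq_0 in E. subst z.
  set (k := fun z => (z * z * f z)%C).
  assert (K0 : cder k (RtoC 0) (RtoC 0)).
  { destruct (Hc 1 Rlt_0_1) as [d [Hd HD]].
    apply (cder_of_quadratic k _ _ d (Cmod (f (RtoC 0)) + 1) Hd).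
    intros w Hw. specialize (HD w Hw). cbv beta in *. unfold k.
    replace (w * w * f w - 0 * 0 * f (RtoC 0) - 0 * (w - 0))%C with (w * w * f w)%C by ring.
    rewrite Z0 in *. rewrite !Cmod_mult, Rmult_comm.
    apply Rmult_le_compat_r; [apply Rmult_le_pos; apply Cmod_ge_0|].
    assert (T := Cmod_ge_sub (f w) (f (RtoC 0))). lra. }
  assert (Hk : hol R k).
  { intros z Hz'. destruct (Rle_lt_or_eq_dec 0 (Cmod z) (Cmod_ge_0 z)) as [L|E].
    - apply cdiff_mult; [apply cdiff_mult; apply cdiff_id|apply Hf; lra].
    - symmetry in E. apply Cmod_eq_0 in E. subst z. eexists; exact K0. }
  assert (Hb := hol_backshift _ _ (hol_backshift _ _ Hk)).
  assert (E : forall w, w <> RtoC 0 -> backshift (backshift k) w = f w).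
  { intros w Hw. rewrite !backshift_neq, backshift_0, (Cderiv_unique _ _ _ K0) by auto. unfold k.
    field. auto. }
  assert (E0 : backshift (backshift k) (RtoC 0) = f (RtoC 0)).
  { apply (cont_eq_at _ _ _ 1); [lra| |auto|].
    - apply cdiff_cont, Hb. auto.
    - intros w [Hw _]. apply E. rewrite Z0 in Hw. apply Cmod_neq0; auto. }
  apply (cdiff_local (backshift (backshift k)) _ _ 1); [lra| |apply Hb; auto].
  intros w _. destruct (classic (w = RtoC 0)) as [-> | H]; auto.
Qed.

(** * The maximum principle *)

Lemma pow_bounded_le_1 (x q : R) : 0 <= x -> (forall n, x ^ n <= q) -> x <= 1.
Proof.
  intros Hx H. apply Rnot_lt_le. intros L.
  destruct (Pow_x_infinity x ltac:(rewrite Rabs_pos_eq; lra) (q + 1)) as [n Hn].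
  specialize (Hn n (le_n n)). specialize (H n).
  rewrite Rabs_pos_eq in Hn by (apply pow_le; lra). lra.
Qed.

(* Landau's trick: apply the crude bound from Cauchy's formula to f^n. *)
Lemma max_modulus f r M a :
  (forall z, Cmod z <= r -> cdiff f z) -> (forall z, Cmod z = r -> Cmod (f z) <= M) ->
  Cmod a < r -> Cmod (f a) <= M.
Proof.
  intros Hf HM Ha. assert (HPI := PI_RGT_0). assert (Pa := Cmod_ge_0 a).
  assert (M0 : 0 <= M).
  { eapply Rle_trans; [apply Cmod_ge_0|apply (HM (circ r 0)), Cmod_circ; lra]. }
  set (q := r / (r - Cmod a)). assert (Hq : 0 < q) by (apply Rdiv_lt_0_compat; lra).
  assert (B : forall n, Cmod (f a) ^ n <= M ^ n * q).
  { intros n.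
    assert (Hn : forall z, Cmod z <= r -> cdiff (fun z => f z ^ n)%C z).
    { intros z Hz. destruct (Hf z Hz) as [l Hl]. eapply der_pow; eauto. }
    assert (H := cauchy_formula (fun z => f z ^ n)%C r a Ha Hn).
    assert (N : Cmod (CI (fun t => f (circ r t) ^ n * (circ r t / (circ r t - a)))%C (- PI) PI)
                <= (PI - - PI) * (M ^ n * q)).
    { apply CI_norm_le_const; [lra| |].
      - intros t _. rewrite Cmod_mult, Cmod_pow. apply Rmult_le_compat.
        + apply pow_le, Cmod_ge_0.
        + apply Cmod_ge_0.
        + apply pow_incr. split; [apply Cmod_ge_0|apply HM, Cmod_circ; lra].
        + apply Cmod_ker_le; auto.
      - apply exI_rcont; [lra|]. intros t _. apply cont_mult; [|apply rcont_ker; auto].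
        apply (rcont_on_circ (fun z => f z ^ n)%C); [lra|]. intros; apply Hn; lra. }
    rewrite H, !Cmod_mult, Cmod_pow, !Cmod_R, !Rabs_pos_eq in N by lra.
    apply (Rmult_le_reg_l (2 * PI)); lra. }
  destruct (Req_dec M 0) as [E|E].
  - specialize (B 1%nat). simpl in B. rewrite E in *. lra.
  - assert (X : Cmod (f a) / M <= 1).
    { apply pow_bounded_le_1 with q.
      - apply Rmult_le_pos; [apply Cmod_ge_0|]. left. apply Rinv_0_lt_compat. lra.
      - intros n. unfold Rdiv. rewrite Rpow_mult_distr, pow_inv.
        assert (0 < M ^ n) by (apply pow_lt; lra).
        apply (Rmult_le_reg_r (M ^ n)); auto. rewrite Rmult_assoc, Rinv_l by lra.
        specialize (B n). lra. }
    apply (Rmult_le_compat_r M) in X; auto. unfold Rdiv in X.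
    rewrite Rmult_assoc, Rinv_l in X; lra.
Qed.

Lemma on_circ r z : Cmod z = r -> exists t, - PI <= t <= PI /\ z = circ r t.
Proof. intros H. destruct (polar z) as [t [Ht E]]. exists t. rewrite <- H. auto. Qed.

Lemma max_on_circle f r :
  0 < r -> (forall z, Cmod z <= r -> cdiff f z) ->
  exists z0, Cmod z0 = r /\ forall z, Cmod z <= r -> Cmod (f z) <= Cmod (f z0).
Proof.
  intros Hr Hf. assert (HPI := PI_RGT_0).
  destruct (rcont_bounded (fun t => f (circ r t)) (- PI) PI) as [t0 [Ht0 H0]].
  - lra.
  - intros t _. apply rcont_on_circ; [lra|]. intros; apply Hf; lra.
  - exists (circ r t0). split; [apply Cmod_circ; lra|].
    assert (HC : forall z, Cmod z = r -> Cmod (f z) <= Cmod (f (circ r t0))).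
    { intros z Hz. destruct (on_circ r z Hz) as [t [Ht E]]. rewrite E. apply H0; auto. }
    intros z [Hz|Hz]; auto. apply (max_modulus f r); auto.
Qed.

(** Maximum modulus applied to [exp f], whose modulus is [exp (Re f)]. *)
Lemma max_Re_on_circle f r :
  0 < r -> (forall z, Cmod z <= r -> cdiff f z) ->
  exists z0, Cmod z0 = r /\ forall z, Cmod z <= r -> Re (f z) <= Re (f z0).
Proof.
  intros Hr Hf.
  destruct (max_on_circle (fun z => Cexp (f z)) r Hr) as [z0 [H0 H]].
  - intros z Hz. apply cdiff_exp; auto.
  - exists z0. split; auto. intros z Hz. specialize (H z Hz). rewrite !Cmod_Cexp in H.
    destruct (Rle_dec (Re (f z)) (Re (f z0))) as [L|L]; auto.
    apply Rnot_le_lt, exp_increasing in L. lra.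
Qed.

Lemma hol_bounded R f r : hol R f -> 0 <= r < R -> exists M, 0 <= M /\
  forall z, Cmod z <= r -> Cmod (f z) <= M.
Proof.
  intros H Hr.
  destruct (max_on_circle f ((r + R) / 2) ltac:(lra)) as [z0 [_ HM]].
  - apply (hol_closed R); auto; lra.
  - exists (Cmod (f z0)). split; [apply Cmod_ge_0|]. intros z Hz. apply HM. lra.
Qed.

(** * Primitives along radii *)

Lemma scal_lt R z s : Cmod z < R -> 0 <= s <= 1 -> Cmod (s * z)%C < R.
Proof.
  intros Hz Hs. rewrite Cmod_mult, Cmod_R, Rabs_pos_eq by lra.
  assert (P := Cmod_ge_0 z). nra.
Qed.

Lemma rcont_radial R h z s :
  hol R h -> Cmod z < R -> 0 <= s <= 1 -> rcont (fun s => h (s * z)%C) s.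
Proof.
  intros H Hz Hs. apply (cont_comp RtoC (fun s => s * z)%C h).
  - apply cont_mult; [apply cont_id|apply cont_const].
  - apply cdiff_cont, H, scal_lt; auto.
Qed.

Lemma rder_radial f z (s : R) : cdiff f (s * z)%C -> rder (fun s => f (s * z)%C) s (Cderiv f (s * z)%C * z)%C.
Proof.
  intros H. eapply der_eq.
  - apply (der_comp RtoC (fun s => s * z)%C f); [|apply cdiff_cderiv; exact H].
    apply der_mult; [apply der_id|apply der_const].
  - cbv beta. ring.
Qed.

(** Differentiating under the integral sign gives the integral of [h(s z) + s z h'(s z)], which is
    the derivative of [s h(s z)] in [s]. *)
Lemma seg_int_der R h z : hol R h -> Cmod z < R -> cder (seg_int h) z (h z).
Proof.
  intros H Hz. assert (Pz := Cmod_ge_0 z). set (rho := (Cmod z + R) / 2).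
  destruct (hol_quadratic R h rho H ltac:(unfold rho; lra)) as [K [HK0 HK]].
  destruct (hol_bounded R (Cderiv h) rho (hol_Cderiv _ _ H) ltac:(unfold rho; lra)) as [M [HM0 HM]].
  assert (Hd := hol_Cderiv _ _ H).
  assert (EI : forall w, Cmod w < R -> exI (fun s => h (s * w) * w)%C 0 1).
  { intros w Hw. apply exI_rcont; [lra|]. intros s Hs.
    apply cont_mult; [eapply rcont_radial; eauto|apply cont_const]. }
  assert (rcd : forall s, 0 <= s <= 1 ->
    rcont (fun s => h (s * z) + s * (Cderiv h (s * z) * z))%C s).
  { intros s Hs. apply cont_plus; [eapply rcont_radial; eauto|].
    apply cont_mult; [apply cont_id|]. apply cont_mult; [|apply cont_const].
    eapply rcont_radial; eauto. }
  assert (EV : CI (fun s => h (s * z) + s * (Cderiv h (s * z) * z))%C 0 1 = h z).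
  { rewrite (CI_derive (fun s => s * h (s * z))%C); [|lra| |auto].
    - C_eq. replace (1 * z)%C with z by ring. ring.
    - intros s Hs. eapply der_eq; [apply der_mult; [apply der_id|]|].
      + apply rder_radial, H, scal_lt; auto.
      + cbv beta. ring. }
  (* The remainder of the integrand is [s h'(s z) (w - z)^2 + w E], where [E] is the Taylor
     remainder of [h] between [s z] and [s w]; [M] bounds [h'] and [rho] bounds [|w|]. *)
  apply (cder_of_quadratic _ _ _ ((R - Cmod z) / 2) (M + rho * K)); [lra|].
  intros w Hw. assert (T := Cmod_triangle (w - z)%C z).
  replace (w - z + z)%C with w in T by ring.
  rewrite <- EV. unfold seg_int.
  replace (CI (fun s => h (s * w) * w)%C 0 1 - CI (fun s => h (s * z) * z)%C 0 1 -
     CI (fun s => h (s * z) + s * (Cderiv h (s * z) * z))%C 0 1 * (w - z))%C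
  with (CI (fun s => h (s * w) * w - h (s * z) * z
              - (w - z) * (h (s * z) + s * (Cderiv h (s * z) * z)))%C 0 1).
  2:{ rewrite (CI_minus (fun s => h (s * w) * w - h (s * z) * z)%C
                (fun s => (w - z) * (h (s * z) + s * (Cderiv h (s * z) * z)))%C).
      - rewrite (CI_minus (fun s => h (s * w) * w)%C (fun s => h (s * z) * z)%C), CI_scal.
        + C_eq. ring.
        + apply exI_rcont; auto; lra.
        + apply EI; lra.
        + apply EI; lra.
      - apply exI_minus; apply EI; lra.
      - apply exI_scal, exI_rcont; auto; lra. }
  eapply Rle_trans; [apply (CI_norm_le_const _ ((M + rho * K) * (Cmod (w - z) * Cmod (w - z)))); [lra| |]|].
  - intros s Hs.
    assert (S1 : Cmod (s * z)%C <= rho).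
    { left. apply scal_lt; auto. unfold rho; lra. }
    assert (S2 : Cmod (s * w)%C <= rho).
    { left. apply scal_lt; auto. unfold rho; lra. }
    set (E := (h (s * w) - h (s * z) - Cderiv h (s * z) * (s * w - s * z))%C).
    assert (BE := HK (s * z)%C (s * w)%C S1 S2). fold E in BE.
    replace (s * w - s * z)%C with (s * (w - z))%C in BE by ring.
    rewrite Cmod_mult, Cmod_R, Rabs_pos_eq in BE by lra.
    replace (h (s * w) * w - h (s * z) * z - (w - z) * (h (s * z) + s * (Cderiv h (s * z) * z)))%C
      with (s * Cderiv h (s * z) * ((w - z) * (w - z)) + w * E)%C by (unfold E; ring).
    eapply Rle_trans; [apply Cmod_triangle|]. rewrite !Cmod_mult, Cmod_R, Rabs_pos_eq by lra.
    set (m := Cmod (w - z)%C) in *. assert (Pm : 0 <= m) by apply Cmod_ge_0.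
    assert (Pw := Cmod_ge_0 w). specialize (HM _ S1). assert (PD := Cmod_ge_0 (Cderiv h (s * z)%C)).
    assert (PE := Cmod_ge_0 E).
    assert (Pmm : 0 <= m * m) by nra.
    assert (BE' : Cmod E <= K * (m * m)).
    { eapply Rle_trans; [exact BE|]. apply Rmult_le_compat_l; auto.
      apply Rmult_le_compat; nra. }
    assert (Cmod w <= rho) by (unfold rho; lra).
    assert (s * Cmod (Cderiv h (s * z)) <= M) by nra.
    assert (s * Cmod (Cderiv h (s * z)) * (m * m) <= M * (m * m)) by (apply Rmult_le_compat_r; auto).
    assert (Cmod w * Cmod E <= rho * (K * (m * m))) by (apply Rmult_le_compat; auto).
    lra.
  - apply exI_minus; [apply exI_minus; apply EI; lra|]. apply exI_scal, exI_rcont; auto; lra.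
  - right. ring.
Qed.

Lemma hol_eq_of_Cderiv R f g :
  hol R f -> hol R g -> f (RtoC 0) = g (RtoC 0) ->
  (forall z, Cmod z < R -> Cderiv f z = Cderiv g z) -> forall z, Cmod z < R -> f z = g z.
Proof.
  intros Hf Hg H0 HD z Hz.
  assert (X : forall h, hol R h ->
    CI (fun s => Cderiv h (s * z) * z)%C 0 1 = (h z - h (RtoC 0))%C).
  { intros h Hh. rewrite (CI_derive (fun s => h (s * z)%C)); [|lra| |].
    - C_eq. f_equal; [f_equal; ring|f_equal; f_equal; ring].
    - intros s Hs. apply rder_radial, Hh, scal_lt; auto.
    - intros s Hs. apply cont_mult; [|apply cont_const].
      eapply rcont_radial; eauto. apply hol_Cderiv; auto. }
  assert (E : (f z - f (RtoC 0))%C = (g z - g (RtoC 0))%C).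
  { rewrite <- (X f Hf), <- (X g Hg). apply CI_ext; [lra|].
    intros s Hs. rewrite HD; auto. apply scal_lt; auto. }
  replace (f z) with ((f z - f (RtoC 0)) + f (RtoC 0))%C by ring. rewrite E, H0. ring.
Qed.

Lemma seg_int_0 h : seg_int h (RtoC 0) = RtoC 0.
Proof.
  unfold seg_int. rewrite (CI_ext _ (fun _ => RtoC 0)); [|lra|].
  - rewrite CI_const. C_eq. ring.
  - intros. C_eq. ring.
Qed.

(** * Littlewood's inequality and the Schwarz lemma *)

Ltac R_eq := match goal with |- @eq _ ?x ?y => change (@eq R x y) end.

Lemma RInt_nonneg_eq_0 (u : R -> R) a b :
  a < b -> (forall t, a <= t <= b -> 0 <= u t) ->
  (forall t, a <= t <= b -> continuous u t) -> RInt u a b = 0 ->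
  forall t, a <= t <= b -> u t = 0.
Proof.
  intros Hab Hp Hc H0 t Ht.
  apply Rle_antisym; [|auto]. apply Rnot_lt_le. intros Hu.
  destruct (Hc t Ht (fun y => u t / 2 < y)) as [[d Hd] Hn].
  { exists (mkposreal (u t / 2) ltac:(lra)). intros y Hy.
    change (Rabs (y - u t) < u t / 2) in Hy. apply Rabs_def2 in Hy. lra. }
  (* A small move towards the midpoint lands in the open interval, where [RInt_eq_0_cont] applies,
     and stays where [u] is positive. *)
  set (t' := if Rle_dec t ((a + b) / 2) then t + Rmin (d / 2) ((b - a) / 4)
             else t - Rmin (d / 2) ((b - a) / 4)).
  assert (He : 0 < Rmin (d / 2) ((b - a) / 4)) by (apply Rmin_glb_lt; lra).
  assert (He1 := Rmin_l (d / 2) ((b - a) / 4)). assert (He2 := Rmin_r (d / 2) ((b - a) / 4)).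
  assert (T : a < t' < b /\ Rabs (t' - t) < d).
  { unfold t'. destruct (Rle_dec _ _); (split; [lra|apply Rabs_def1; lra]). }
  destruct T as [T1 T2].
  assert (E := RInt_eq_0_cont u a b Hab Hp Hc H0 t' T1).
  specialize (Hn t' T2). lra.
Qed.

Lemma RInt_plusR (f g : R -> R) a b : ex_RInt f a b -> ex_RInt g a b ->
  RInt (fun t => f t + g t) a b = RInt f a b + RInt g a b.
Proof. apply (RInt_plus (V := R_CompleteNormedModule)). Qed.

Lemma RInt_minusR (f g : R -> R) a b : ex_RInt f a b -> ex_RInt g a b ->
  RInt (fun t => f t - g t) a b = RInt f a b - RInt g a b.
Proof. apply (RInt_minus (V := R_CompleteNormedModule)). Qed.

Lemma RInt_scalR (c : R) (f : R -> R) a b : ex_RInt f a b ->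
  RInt (fun t => c * f t) a b = c * RInt f a b.
Proof. apply (RInt_scal (V := R_CompleteNormedModule)). Qed.

Definition M2 (r : R) (f : CC -> CC) : R :=
  RInt (fun t => Cmod (f (circ r t)) ^ 2) (- PI) PI.

Lemma rcont_Cmod2 f t : rcont f t -> rcont (fun t => RtoC (Cmod (f t) ^ 2)) t.
Proof.
  intros H. apply (cont_ext _ (fun t => RtoC (Cmod (f t)) * RtoC (Cmod (f t)))%C).
  - intros y. rewrite <- RtoC_mult. f_equal. ring.
  - apply cont_mult; apply cont_Cmod; auto.
Qed.

Lemma ex_M2 r f : 0 <= r -> (forall z, Cmod z = r -> cdiff f z) ->
  ex_RInt (fun t => Cmod (f (circ r t)) ^ 2) (- PI) PI.
Proof.
  intros Hr Hf. assert (HPI := PI_RGT_0). apply ex_RInt_rcont; [lra|].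
  intros t _. apply (rcont_Cmod2 (fun t => f (circ r t))), rcont_on_circ; auto.
Qed.

Lemma M2_pos r f : 0 <= r -> (forall z, Cmod z = r -> cdiff f z) -> 0 <= M2 r f.
Proof.
  intros Hr Hf. assert (HPI := PI_RGT_0).
  apply RInt_ge_0; [lra|apply ex_M2; auto|]. intros. apply pow2_ge_0.
Qed.

Lemma Cmod2_plus (c v : CC) :
  Cmod (c + v)%C ^ 2 = Cmod c ^ 2 + Cmod v ^ 2 + 2 * Re (Cconj c * v)%C.
Proof. rewrite !Cmod2_alt. destruct c, v. simpl. ring. Qed.

(** Constants are orthogonal to functions vanishing at 0: the cross term is the real part of a mean
    value. *)
Lemma M2_add_const r (c : CC) v :
  0 < r -> (forall z, Cmod z <= r -> cdiff v z) -> v (RtoC 0) = RtoC 0 ->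
  M2 r (fun z => c + v z)%C = 2 * PI * Cmod c ^ 2 + M2 r v.
Proof.
  intros Hr Hv H0. assert (HPI := PI_RGT_0).
  assert (Hv' : forall z, Cmod z = r -> cdiff v z) by (intros; apply Hv; lra).
  assert (EX := ex_M2 r v ltac:(lra) Hv').
  assert (EC : exI (fun t => Cconj c * v (circ r t))%C (- PI) PI).
  { apply exI_rcont; [lra|]. intros t _. apply cont_scal, rcont_on_circ; auto; lra. }
  assert (EV : exI (fun t => v (circ r t))%C (- PI) PI).
  { apply exI_rcont; [lra|]. intros t _. apply rcont_on_circ; auto; lra. }
  assert (ER : ex_RInt (fun t => Re (Cconj c * v (circ r t))%C) (- PI) PI).
  { apply ex_RInt_rcont; [lra|]. intros t _. apply (cont_Re RtoC (fun t => Cconj c * v (circ r t))%C).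
    apply cont_scal, rcont_on_circ; auto; lra. }
  assert (Z : RInt (fun t => Re (Cconj c * v (circ r t))%C) (- PI) PI = 0).
  { rewrite <- Re_CI by auto. rewrite CI_scal, mean_value, H0 by auto.
    replace (Cconj c * (2 * PI * 0))%C with (RtoC 0) by ring. reflexivity. }
  unfold M2.
  rewrite (RInt_ext _ (fun t => (Cmod c ^ 2 + Cmod (v (circ r t)) ^ 2)
                         + 2 * Re (Cconj c * v (circ r t))%C)).
  2:{ intros; apply Cmod2_plus. }
  rewrite RInt_plusR, RInt_plusR, RInt_scalR, RInt_const, Z; auto.
  - unfold scal; simpl; unfold mult; simpl. ring.
  - apply ex_RInt_const.
  - apply (ex_RInt_plus (V := R_NormedModule)); [apply ex_RInt_const|auto].
  - apply (ex_RInt_scal (V := R_NormedModule)); auto.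
Qed.

Lemma M2_ext r f g : 0 <= r -> (forall z, Cmod z = r -> f z = g z) -> M2 r f = M2 r g.
Proof.
  intros Hr E. unfold M2. apply RInt_ext. intros t _. rewrite E; auto. apply Cmod_circ; auto.
Qed.

(** One step of Parseval's identity, splitting off the constant coefficient. *)
Lemma M2_backshift R r f : 0 < r < R -> hol R f ->
  M2 r f = 2 * PI * Cmod (f (RtoC 0)) ^ 2 + r ^ 2 * M2 r (backshift f).
Proof.
  intros Hr Hf.
  assert (Hb := hol_backshift R f Hf).
  rewrite (M2_ext r f (fun z => f (RtoC 0) + z * backshift f z)%C); [|lra|intros; apply backshift_eq].
  rewrite M2_add_const; [|lra| |].
  - f_equal. unfold M2.
    rewrite (RInt_ext _ (fun t => r ^ 2 * Cmod (backshift f (circ r t)) ^ 2)).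
    + apply (RInt_scal (V := R_CompleteNormedModule)). apply ex_M2; [lra|].
      intros; apply Hb; lra.
    + intros t _. rewrite Cmod_mult, Cmod_circ by lra. R_eq. ring.
  - intros z Hz. apply cdiff_mult; [apply cdiff_id|apply Hb; lra].
  - ring.
Qed.

(** Cauchy's formula for [f^2] bounds a point value by the mean square. *)
Lemma point_le_M2 r rho f z :
  Cmod z <= r -> r < rho -> (forall z, Cmod z <= rho -> cdiff f z) ->
  2 * PI * Cmod (f z) ^ 2 <= rho / (rho - r) * M2 rho f.
Proof.
  intros Hz Hr Hf. assert (HPI := PI_RGT_0). assert (Pz := Cmod_ge_0 z).
  assert (H := cauchy_formula (fun z => f z * f z)%C rho z ltac:(lra)
                 ltac:(intros; apply cdiff_mult; auto)).
  assert (Hf' : forall z, Cmod z = rho -> cdiff f z) by (intros; apply Hf; lra).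
  replace (2 * PI * Cmod (f z) ^ 2) with (Cmod (2 * PI * (f z * f z))%C).
  2:{ rewrite !Cmod_mult, !Cmod_R, !Rabs_pos_eq by lra. ring. }
  rewrite <- H. unfold M2.
  replace (rho / (rho - r) * RInt (fun t => Cmod (f (circ rho t)) ^ 2) (- PI) PI)
    with (RInt (fun t => rho / (rho - r) * Cmod (f (circ rho t)) ^ 2) (- PI) PI).
  2:{ apply (RInt_scal (V := R_CompleteNormedModule)). apply ex_M2; auto; lra. }
  apply CI_norm_le; [lra| | |].
  - intros t _. rewrite !Cmod_mult, Rmult_comm.
    apply Rmult_le_compat; [apply Cmod_ge_0| | |right; ring].
    + apply Rmult_le_pos; apply Cmod_ge_0.
    + eapply Rle_trans; [apply Cmod_ker_le; lra|].
      apply Rmult_le_compat_l; [lra|]. apply Rinv_le_contravar; lra.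
  - apply exI_rcont; [lra|]. intros t _. apply cont_mult; [|apply rcont_ker; lra].
    apply (rcont_on_circ (fun z => f z * f z)%C); [lra|]. intros; apply cdiff_mult; auto.
  - apply (ex_RInt_scal (V := R_NormedModule)). apply ex_M2; auto; lra.
Qed.

Fixpoint backshift_iter (n : nat) (f : CC -> CC) : CC -> CC :=
  match n with O => f | S n => backshift_iter n (backshift f) end.

Lemma hol_backshift_iter R n f : hol R f -> hol R (backshift_iter n f).
Proof. revert f. induction n as [|n IH]; simpl; auto. intros f H. apply IH, hol_backshift, H. Qed.

Lemma M2_backshift_iter rho R n f : 0 < rho < R -> hol R f -> rho ^ (2 * n) * M2 rho (backshift_iter n f) <= M2 rho f.
Proof.
  intros Hr. revert f. induction n as [|n IH]; intros f Hf; simpl backshift_iter.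
  - simpl. lra.
  - assert (H := IH (backshift f) (hol_backshift _ _ Hf)).
    rewrite (M2_backshift R rho f Hr Hf).
    replace (2 * S n)%nat with (2 + 2 * n)%nat by lia. rewrite pow_add, Rmult_assoc.
    assert (P := pow2_ge_0 (Cmod (f (RtoC 0)))). assert (HPI := PI_RGT_0).
    assert (0 <= 2 * PI * Cmod (f (RtoC 0)) ^ 2) by (apply Rmult_le_pos; lra).
    assert (rho ^ 2 * (rho ^ (2 * n) * M2 rho (backshift_iter n (backshift f))) <= rho ^ 2 * M2 rho (backshift f)).
    { apply Rmult_le_compat_l; auto. apply pow2_ge_0. }
    lra.
Qed.

(** Cauchy's estimate in terms of shifts: they grow at most like [rho^(-n)] on [|z| <= r]. The gain
    [(r / rho)^n] closes the iterations in [littlewood] and [isolated_zeros]. *)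
Lemma backshift_iter_bound R f r rho : hol R f -> 0 <= r < rho -> rho < R ->
  exists K, 0 <= K /\ forall n z, Cmod z <= r -> rho ^ (2 * n) * Cmod (backshift_iter n f z) ^ 2 <= K.
Proof.
  intros Hf Hr HR. assert (HPI := PI_RGT_0).
  assert (Q : 0 < rho / (rho - r)) by (apply Rdiv_lt_0_compat; lra).
  assert (PM : 0 <= M2 rho f) by (apply M2_pos; [lra|intros; apply Hf; lra]).
  exists (/ (2 * PI) * (rho / (rho - r) * M2 rho f)). split.
  - apply Rmult_le_pos; [left; apply Rinv_0_lt_compat; lra|]. apply Rmult_le_pos; lra.
  - intros n z Hz.
    assert (H := point_le_M2 r rho (backshift_iter n f) z Hz ltac:(lra)
      (hol_closed R _ rho (hol_backshift_iter R n f Hf) ltac:(lra))).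
    assert (H2 := M2_backshift_iter rho R n f ltac:(lra) Hf).
    assert (P := pow_lt rho (2 * n) ltac:(lra)).
    apply (Rmult_le_reg_l (2 * PI)); [lra|].
    rewrite <- (Rmult_assoc (2 * PI) (/ (2 * PI))), Rinv_r, Rmult_1_l by lra.
    apply (Rmult_le_compat_l (rho ^ (2 * n))) in H; [|lra].
    apply (Rmult_le_compat_l (rho / (rho - r))) in H2; [|lra].
    replace (2 * PI * (rho ^ (2 * n) * Cmod (backshift_iter n f z) ^ 2))
      with (rho ^ (2 * n) * (2 * PI * Cmod (backshift_iter n f z) ^ 2)) by ring.
    eapply Rle_trans; [exact H|]. eapply Rle_trans; [|exact H2]. right; ring.
Qed.

Lemma geometric_le_0 (x K q : R) : 0 <= q < 1 -> (forall n, x <= K * q ^ n) -> x <= 0.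
Proof.
  intros Hq H. apply Rnot_lt_le. intros Hx.
  assert (PK := Rabs_pos K).
  destruct (pow_lt_1_zero q ltac:(rewrite Rabs_pos_eq; lra) (x / (Rabs K + 1))) as [n Hn].
  { apply Rdiv_lt_0_compat; lra. }
  specialize (Hn n (le_n n)). specialize (H n).
  assert (P : 0 <= q ^ n) by (apply pow_le; lra). rewrite Rabs_pos_eq in Hn by auto.
  assert (K <= Rabs K) by apply RRle_abs.
  assert ((Rabs K + 1) * q ^ n < x).
  { apply (Rmult_lt_compat_l (Rabs K + 1)) in Hn; [|lra].
    replace ((Rabs K + 1) * (x / (Rabs K + 1))) with x in Hn by (field; lra). lra. }
  nra.
Qed.

(** With [b = backshift h], compare [h(z) = h(0) + z b(z)] with [h(w) = h(0) + w b(w)]. The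
    constants contribute equally, and replacing [|w|^2] by [r^2] in the mean square of [w b(w)]
    produces the last integral. *)
Lemma M2_subordinate r h w :
  0 < r < 1 -> hol 1 h -> hol 1 w -> (forall z, Cmod z < 1 -> Cmod (w z) <= Cmod z) ->
  M2 r h - M2 r (fun z => h (w z)) =
  r ^ 2 * (M2 r (backshift h) - M2 r (fun z => backshift h (w z))) +
  RInt (fun t => (r ^ 2 - Cmod (w (circ r t)) ^ 2) * Cmod (backshift h (w (circ r t))) ^ 2) (- PI) PI.
Proof.
  intros Hr Hh Hw Hwz. assert (HPI := PI_RGT_0).
  assert (Hb := hol_backshift 1 h Hh).
  assert (HB : hol 1 (fun z => backshift h (w z))).
  { intros z Hz. apply cdiff_comp; auto. apply Hb. specialize (Hwz z Hz). lra. }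
  assert (W0 : w (RtoC 0) = RtoC 0).
  { apply Cmod_eq_0, Rle_antisym; [|apply Cmod_ge_0]. rewrite <- Cmod_0 at 2. apply Hwz.
    rewrite Cmod_0; lra. }
  rewrite (M2_backshift 1 r h Hr Hh).
  rewrite (M2_ext r (fun z => h (w z)) (fun z => h (RtoC 0) + w z * backshift h (w z))%C);
    [|lra|intros; apply backshift_eq].
  rewrite M2_add_const; [|lra| |rewrite W0; ring].
  2:{ intros z Hz. apply cdiff_mult; [apply Hw|apply HB]; lra. }
  assert (HBr : forall z, Cmod z = r -> cdiff (fun z => backshift h (w z)) z) by (intros; apply HB; lra).
  assert (HWr : forall z, Cmod z = r -> cdiff w z) by (intros; apply Hw; lra).
  assert (E1 := ex_M2 r _ ltac:(lra) HBr).
  assert (E2 : ex_RInt (fun t => (r ^ 2 - Cmod (w (circ r t)) ^ 2) * Cmod (backshift h (w (circ r t))) ^ 2)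
                 (- PI) PI).
  { apply ex_RInt_rcont; [lra|]. intros t _.
    apply (cont_ext _ (fun t => (RtoC (r ^ 2) - RtoC (Cmod (w (circ r t)) ^ 2))
                          * RtoC (Cmod (backshift h (w (circ r t))) ^ 2))%C).
    - intros y. now rewrite RtoC_mult, RtoC_minus.
    - apply cont_mult; [apply cont_minus; [apply cont_const|]|].
      + apply (rcont_Cmod2 (fun t => w (circ r t))), rcont_on_circ; auto; lra.
      + apply (rcont_Cmod2 (fun t => backshift h (w (circ r t)))).
        apply (rcont_on_circ (fun z => backshift h (w z))); auto; lra. }
  assert (E : r ^ 2 * M2 r (fun z => backshift h (w z)) - M2 r (fun z => w z * backshift h (w z))%C =
    RInt (fun t => (r ^ 2 - Cmod (w (circ r t)) ^ 2) * Cmod (backshift h (w (circ r t))) ^ 2) (- PI) PI).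
  { rewrite (RInt_ext (fun t => (r ^ 2 - Cmod (w (circ r t)) ^ 2) * Cmod (backshift h (w (circ r t))) ^ 2)
       (fun t => r ^ 2 * Cmod (backshift h (w (circ r t))) ^ 2 -
                 Cmod (w (circ r t) * backshift h (w (circ r t)))%C ^ 2)).
    - rewrite RInt_minusR, RInt_scalR; auto.
      + apply (ex_RInt_scal (V := R_NormedModule)); auto.
      + apply (ex_M2 r (fun z => w z * backshift h (w z))%C); [lra|]. intros z Hz. apply cdiff_mult; auto.
    - intros t _. rewrite Cmod_mult. R_eq. ring. }
  rewrite <- E. ring.
Qed.

Lemma defect_nonneg r h w t :
  0 < r < 1 -> (forall z, Cmod z < 1 -> Cmod (w z) <= Cmod z) ->
  0 <= (r ^ 2 - Cmod (w (circ r t)) ^ 2) * Cmod (backshift h (w (circ r t))) ^ 2.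
Proof.
  intros Hr Hwz. apply Rmult_le_pos; [|apply pow2_ge_0].
  assert (H := Hwz (circ r t)). rewrite Cmod_circ in H by lra. specialize (H ltac:(lra)).
  assert (P := Cmod_ge_0 (w (circ r t))). nra.
Qed.

Lemma rcont_defect r h w t :
  0 < r < 1 -> hol 1 h -> hol 1 w -> (forall z, Cmod z < 1 -> Cmod (w z) <= Cmod z) ->
  continuous (fun t => (r ^ 2 - Cmod (w (circ r t)) ^ 2) * Cmod (backshift h (w (circ r t))) ^ 2) t.
Proof.
  intros Hr Hh Hw Hwz. apply rcont_real.
  apply (cont_ext _ (fun t => (RtoC (r ^ 2) - RtoC (Cmod (w (circ r t)) ^ 2))
                          * RtoC (Cmod (backshift h (w (circ r t))) ^ 2))%C).
  - intros y. now rewrite RtoC_mult, RtoC_minus.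
  - apply cont_mult; [apply cont_minus; [apply cont_const|]|].
    + apply (rcont_Cmod2 (fun t => w (circ r t))), rcont_on_circ; [lra|]. intros; apply Hw; lra.
    + apply (rcont_Cmod2 (fun t => backshift h (w (circ r t)))).
      apply (rcont_on_circ (fun z => backshift h (w z))); [lra|]. intros z Hz.
      apply cdiff_comp; [apply Hw; lra|]. apply (hol_backshift 1 h Hh).
      specialize (Hwz z ltac:(lra)). lra.
Qed.

(** The difference [D] satisfies [D h >= r^(2n) * D (backshift_iter n h)]. The last factor is at
    least a negative constant times [rho^(-2n)] with [r < rho < 1], so the lower bound for [D h]
    tends to 0. *)
Lemma littlewood r h w :
  0 < r < 1 -> hol 1 h -> hol 1 w -> (forall z, Cmod z < 1 -> Cmod (w z) <= Cmod z) ->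
  M2 r (fun z => h (w z)) <= M2 r h.
Proof.
  intros Hr Hh Hw Hwz. assert (HPI := PI_RGT_0). set (rho := (r + 1) / 2).
  set (D := fun h => M2 r h - M2 r (fun z => h (w z))).
  assert (Step : forall h, hol 1 h -> r ^ 2 * D (backshift h) <= D h).
  { intros k Hk. unfold D. rewrite (M2_subordinate r k w Hr Hk Hw Hwz).
    assert (0 <= RInt (fun t => (r ^ 2 - Cmod (w (circ r t)) ^ 2)
                         * Cmod (backshift k (w (circ r t))) ^ 2) (- PI) PI); [|lra].
    apply RInt_ge_0; [lra| |].
    - apply (ex_RInt_continuous (V := R_CompleteNormedModule)). intros. apply rcont_defect; auto.
    - intros. apply defect_nonneg; auto. }
  assert (Steps : forall n h, hol 1 h -> r ^ (2 * n) * D (backshift_iter n h) <= D h).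
  { induction n as [|n IH]; intros k Hk; simpl backshift_iter; [simpl; lra|].
    replace (2 * S n)%nat with (2 + 2 * n)%nat by lia. rewrite pow_add, Rmult_assoc.
    eapply Rle_trans; [|apply Step; auto]. apply Rmult_le_compat_l; [apply pow2_ge_0|].
    apply IH, hol_backshift, Hk. }
  destruct (backshift_iter_bound 1 h r rho Hh ltac:(unfold rho; lra) ltac:(unfold rho; lra)) as [K [HK0 HK]].
  assert (Pr : 0 < r / rho < 1).
  { unfold rho. split; [apply Rdiv_lt_0_compat; lra|].
    apply (Rmult_lt_reg_r ((r + 1) / 2)); [lra|]. unfold Rdiv at 1.
    rewrite Rmult_assoc, Rinv_l by lra. lra. }
  assert (L : - D h <= 0); [|unfold D in L; lra].
  apply (geometric_le_0 _ (2 * PI * K) ((r / rho) ^ 2)).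
  { simpl. split; [|nra]. nra. }
  intros n. specialize (Steps n h Hh).
  assert (Hn := hol_backshift_iter 1 n h Hh).
  assert (B : M2 r (fun z => backshift_iter n h (w z)) <= 2 * PI * (K * / rho ^ (2 * n))).
  { unfold M2.
    replace (2 * PI * (K * / rho ^ (2 * n))) with (RInt (fun _ => K * / rho ^ (2 * n)) (- PI) PI).
    - apply RInt_le; [lra| |apply ex_RInt_const|].
      + apply (ex_M2 r (fun z => backshift_iter n h (w z))); [lra|]. intros z Hz.
        apply cdiff_comp; [apply Hw; lra|]. apply Hn. specialize (Hwz z ltac:(lra)). lra.
      + intros t _. assert (P := pow_lt rho (2 * n) ltac:(unfold rho; lra)).
        apply (Rmult_le_reg_r (rho ^ (2 * n))); auto.
        rewrite (Rmult_assoc K), Rinv_l, Rmult_1_r by lra. rewrite Rmult_comm. apply HK.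
        assert (H := Hwz (circ r t)). rewrite Cmod_circ in H by lra. apply H. lra.
    - rewrite RInt_const. unfold scal; simpl; unfold mult; simpl. ring. }
  assert (P1 := M2_pos r (backshift_iter n h) ltac:(lra) ltac:(intros; apply Hn; lra)).
  assert (P2 := pow_lt r (2 * n) ltac:(lra)).
  assert (P3 := pow_lt rho (2 * n) ltac:(unfold rho; lra)).
  rewrite <- pow_mult. unfold Rdiv. rewrite Rpow_mult_distr, pow_inv.
  assert (- D (backshift_iter n h) <= 2 * PI * (K * / rho ^ (2 * n))) by (unfold D; lra).
  apply Rle_trans with (r ^ (2 * n) * - D (backshift_iter n h)); [lra|].
  apply Rle_trans with (r ^ (2 * n) * (2 * PI * (K * / rho ^ (2 * n)))).
  - apply Rmult_le_compat_l; lra.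
  - right. ring.
Qed.

(** Equality makes the first defect vanish. As [|w| < r] on the circle, [backshift h] composed with
    [w] is zero there, and the mean value property gives [backshift h 0 = h'(0) = 0]. *)
Lemma littlewood_strict r h w :
  0 < r < 1 -> hol 1 h -> hol 1 w -> (forall z, Cmod z < 1 -> Cmod (w z) <= Cmod z) ->
  Cderiv h (RtoC 0) <> RtoC 0 -> (forall z, 0 < Cmod z < 1 -> Cmod (w z) < Cmod z) ->
  M2 r (fun z => h (w z)) < M2 r h.
Proof.
  intros Hr Hh Hw Hwz Hd Hs. assert (HPI := PI_RGT_0).
  assert (Hb := hol_backshift 1 h Hh).
  destruct (Rle_lt_or_eq_dec _ _ (littlewood r h w Hr Hh Hw Hwz)) as [L|E]; auto.
  exfalso. apply Hd. rewrite <- backshift_0.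
  assert (X := M2_subordinate r h w Hr Hh Hw Hwz).
  assert (Y := littlewood r (backshift h) w Hr Hb Hw Hwz).
  set (u := fun t => (r ^ 2 - Cmod (w (circ r t)) ^ 2) * Cmod (backshift h (w (circ r t))) ^ 2) in X.
  assert (Pu : 0 <= RInt u (- PI) PI).
  { apply RInt_ge_0; [lra| |].
    - apply (ex_RInt_continuous (V := R_CompleteNormedModule)). intros. apply rcont_defect; auto.
    - intros. apply defect_nonneg; auto. }
  assert (0 <= r ^ 2) by apply pow2_ge_0.
  assert (Zu : RInt u (- PI) PI = 0) by nra.
  assert (Z := RInt_nonneg_eq_0 u (- PI) PI ltac:(lra)
    ltac:(intros; apply defect_nonneg; auto) ltac:(intros; apply rcont_defect; auto) Zu).
  assert (W0 : w (RtoC 0) = RtoC 0).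
  { apply Cmod_eq_0, Rle_antisym; [|apply Cmod_ge_0]. rewrite <- Cmod_0 at 2. apply Hwz.
    rewrite Cmod_0; lra. }
  assert (M : CI (fun t => backshift h (w (circ r t))) (- PI) PI = (2 * PI * backshift h (w (RtoC 0)))%C).
  { apply (mean_value (fun z => backshift h (w z))); [lra|]. intros z Hz.
    apply cdiff_comp; [apply Hw; lra|]. apply Hb. specialize (Hwz z ltac:(lra)). lra. }
  rewrite (CI_ext _ (fun _ => RtoC 0)), CI_const, W0 in M; [|lra|].
  - replace (backshift h (RtoC 0)) with (/ (2 * PI) * (2 * PI * backshift h (RtoC 0)))%C.
    + rewrite <- M. C_eq. ring.
    + rewrite Cmult_assoc, Cinv_l by apply PI2_neq0. ring.
  - intros t Ht. apply Cmod_eq_0. specialize (Z t Ht). unfold u in Z.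
    assert (S := Hs (circ r t)). rewrite Cmod_circ in S by lra. specialize (S ltac:(lra)).
    assert (P := Cmod_ge_0 (w (circ r t))).
    apply Rmult_integral in Z. destruct Z as [Z|Z]; [nra|].
    simpl in Z. rewrite Rmult_1_r in Z. apply Rmult_integral in Z. tauto.
Qed.

(** * The Schwarz lemma and its equality case *)

Lemma schwarz w :
  hol 1 w -> (forall z, Cmod z < 1 -> Cmod (w z) <= 1) -> w (RtoC 0) = RtoC 0 ->
  forall z, Cmod z < 1 -> Cmod (backshift w z) <= 1.
Proof.
  intros Hw H1 H0 z Hz. apply Rnot_lt_le. intros L.
  assert (Pz := Cmod_ge_0 z).
  (* A radius [rho < 1] beyond both [|z|] and [1 / |backshift w z|]: the bound [1 / rho] from the
     maximum principle is then smaller than the value it bounds. *)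
  set (c := Rmax (Cmod z) (/ Cmod (backshift w z))).
  assert (C1 : c < 1).
  { apply Rmax_lub_lt; auto. rewrite <- Rinv_1. apply Rinv_lt_contravar; lra. }
  assert (C2 : Cmod z <= c) by apply Rmax_l.
  assert (C3 : / Cmod (backshift w z) <= c) by apply Rmax_r.
  assert (C4 : 0 < / Cmod (backshift w z)) by (apply Rinv_0_lt_compat; lra).
  set (rho := (c + 1) / 2).
  assert (M : Cmod (backshift w z) <= / rho).
  { apply (max_modulus (backshift w) rho).
    - apply (hol_closed 1); [apply hol_backshift; auto|unfold rho; lra].
    - intros y Hy. rewrite backshift_neq by (apply Cmod_neq0; unfold rho in Hy; lra).
      rewrite H0. replace (w y - 0)%C with (w y) by ring.
      rewrite Cmod_div by (apply Cmod_neq0; unfold rho in Hy; lra). rewrite Hy.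
      unfold Rdiv. rewrite <- (Rmult_1_l (/ rho)) at 2.
      apply Rmult_le_compat_r; [left; apply Rinv_0_lt_compat; unfold rho; lra|].
      apply H1. unfold rho in Hy; lra.
    - unfold rho; lra. }
  assert (/ rho < / c) by (apply Rinv_lt_contravar; [|unfold rho; lra]; apply Rmult_lt_0_compat; unfold rho; lra).
  assert (/ c <= / / Cmod (backshift w z)) by (apply Rinv_le_contravar; lra).
  rewrite Rinv_inv in *. lra.
Qed.

Lemma schwarz_le w :
  hol 1 w -> (forall z, Cmod z < 1 -> Cmod (w z) <= 1) -> w (RtoC 0) = RtoC 0 ->
  forall z, Cmod z < 1 -> Cmod (w z) <= Cmod z.
Proof.
  intros Hw H1 H0 z Hz. rewrite (backshift_eq w z), H0, Cplus_0_l, Cmod_mult.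
  assert (H := schwarz w Hw H1 H0 z Hz). assert (P := Cmod_ge_0 z).
  rewrite <- (Rmult_1_r (Cmod z)) at 2. apply Rmult_le_compat_l; auto.
Qed.

(** For [|c| < 1], it shows that the disk automorphism [b |-> (b - c) / (1 - conj(c) b)] preserves
    both the closed disk and the unit circle. *)
Lemma pick_identity (b c : CC) :
  Cmod (1 - Cconj c * b)%C ^ 2 - Cmod (b - c)%C ^ 2 = (1 - Cmod b ^ 2) * (1 - Cmod c ^ 2).
Proof. rewrite !Cmod2_alt. destruct b, c. simpl. ring. Qed.

(** Here [b = w / z] has modulus at most 1 and modulus 1 at [z0]. If [|b(0)| < 1], the automorphism
    moving [b(0)] to 0 turns [b] into a function obeying Schwarz's bound, contradicted at [z0]. So
    [|b(0)| = 1], and Parseval makes [b] constant. *)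
Lemma schwarz_eq w z0 :
  hol 1 w -> (forall z, Cmod z < 1 -> Cmod (w z) <= 1) -> w (RtoC 0) = RtoC 0 ->
  0 < Cmod z0 < 1 -> Cmod (w z0) = Cmod z0 ->
  exists eps, Cmod eps = 1 /\ forall z, Cmod z < 1 -> w z = (eps * z)%C.
Proof.
  intros Hw H1 H0 Hz0 E. assert (HPI := PI_RGT_0).
  set (b := backshift w). assert (Hb : hol 1 b) by (apply hol_backshift; auto).
  assert (B1 := schwarz w Hw H1 H0). fold b in B1.
  assert (Z0 : Cmod (RtoC 0) < 1) by (rewrite Cmod_0; lra).
  assert (Bz0 : Cmod (b z0) = 1).
  { unfold b. rewrite backshift_neq by (apply Cmod_neq0; lra). rewrite H0.
    replace (w z0 - 0)%C with (w z0) by ring. rewrite Cmod_div by (apply Cmod_neq0; lra).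
    rewrite E. field. lra. }
  set (c := b (RtoC 0)) in *.
  assert (C1 : Cmod c = 1).
  { destruct (Rle_lt_or_eq_dec _ _ (B1 _ Z0)) as [L|]; auto. exfalso. fold c in L.
    assert (NZ : forall z, Cmod z < 1 -> (1 - Cconj c * b z)%C <> RtoC 0).
    { intros z Hz. apply Cmod_neq0. assert (T := Cmod_ge_sub (RtoC 1) (Cconj c * b z)%C).
      rewrite Cmod_1, Cmod_mult, Cmod_conj in T. specialize (B1 z Hz).
      assert (P := Cmod_ge_0 (b z)). assert (P2 := Cmod_ge_0 c). nra. }
    set (m := fun z => ((b z - c) / (1 - Cconj c * b z))%C).
    assert (S : Cmod (m z0) <= Cmod z0).
    { apply (schwarz_le m); [| | |lra].
      - intros z Hz. apply cdiff_div; [apply NZ; auto| |].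
        + apply cdiff_minus; [auto|apply cdiff_const].
        + apply cdiff_minus; [apply cdiff_const|apply cdiff_scal; auto].
      - intros z Hz. unfold m. rewrite Cmod_div by (apply NZ; auto).
        assert (P : 0 < Cmod (1 - Cconj c * b z)%C) by (apply Cmod_gt_0, NZ; auto).
        apply (Rmult_le_reg_r (Cmod (1 - Cconj c * b z)%C)); auto.
        unfold Rdiv. rewrite Rmult_assoc, Rinv_l by lra.
        assert (I := pick_identity (b z) c). assert (P2 := Cmod_ge_0 (b z - c)%C).
        specialize (B1 z Hz). assert (P3 := Cmod_ge_0 (b z)). assert (P4 := Cmod_ge_0 c).
        assert (0 <= (1 - Cmod (b z) ^ 2) * (1 - Cmod c ^ 2)) by (apply Rmult_le_pos; nra).
        nra.
      - unfold m. fold c. unfold Cdiv. ring. }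
    assert (Cmod (m z0) = 1); [|lra].
    unfold m. rewrite Cmod_div by (apply NZ; lra).
    assert (I := pick_identity (b z0) c). rewrite Bz0 in I.
    assert (P : 0 < Cmod (1 - Cconj c * b z0)%C) by (apply Cmod_gt_0, NZ; lra).
    assert (P2 := Cmod_ge_0 (b z0 - c)%C).
    assert (X : Cmod (1 - Cconj c * b z0)%C = Cmod (b z0 - c)%C) by nra.
    rewrite <- X. field. lra. }
  exists c. split; auto. intros z Hz. rewrite (backshift_eq w z), H0, Cplus_0_l. fold b.
  rewrite Cmult_comm. f_equal.
  destruct (Req_dec (Cmod z) 0) as [Ez|Ez]; [apply Cmod_eq_0 in Ez; subst; reflexivity|].
  set (r := Cmod z). assert (Hr : 0 < r < 1) by (split; auto; assert (P := Cmod_ge_0 z); unfold r; lra).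
  assert (Hbb := hol_backshift 1 b Hb).
  (* [|b| <= 1] gives [M2 r b <= 2 * PI], and the constant coefficient [c] already accounts for all
     of it. *)
  assert (X := M2_backshift 1 r b Hr Hb). fold c in X. rewrite C1 in X.
  assert (Y : M2 r b <= 2 * PI).
  { unfold M2. replace (2 * PI) with (RInt (fun _ => 1) (- PI) PI).
    - apply RInt_le; [lra|apply ex_M2; [lra|intros; apply Hb; lra]|apply ex_RInt_const|].
      intros t _. assert (B := B1 (circ r t)). rewrite Cmod_circ in B by lra.
      specialize (B ltac:(lra)). assert (P := Cmod_ge_0 (b (circ r t))). nra.
    - rewrite RInt_const. unfold scal; simpl; unfold mult; simpl. ring. }
  assert (P := M2_pos r (backshift b) ltac:(lra) ltac:(intros; apply Hbb; lra)).
  assert (Z : M2 r (backshift b) = 0).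
  { assert (0 < r ^ 2) by (apply pow_lt; lra). nra. }
  destruct (on_circ r z eq_refl) as [t [Ht Et]].
  assert (Q := RInt_nonneg_eq_0 _ (- PI) PI ltac:(lra)
    ltac:(intros; apply pow2_ge_0)
    ltac:(intros; apply rcont_real, (rcont_Cmod2 (fun t => backshift b (circ r t))), rcont_on_circ;
          [lra|intros; apply Hbb; lra]) Z t Ht).
  cbv beta in Q. rewrite (backshift_eq b z). fold c. rewrite Et.
  replace (backshift b (circ r t)) with (RtoC 0); [ring|]. symmetry. apply Cmod_eq_0.
  simpl in Q. rewrite Rmult_1_r in Q. apply Rmult_integral in Q. tauto.
Qed.

(** * Inverses of injective holomorphic functions *)

Lemma cont_neq0 f z : ccont f z -> f z <> RtoC 0 ->
  exists d, 0 < d /\ forall w, Cmod (w - z)%C < d -> f w <> RtoC 0.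
Proof.
  intros Hc Hz. assert (P : 0 < Cmod (f z)) by (apply Cmod_gt_0; auto).
  destruct (Hc (Cmod (f z)) P) as [d [Hd H]]. exists d. split; auto.
  intros w Hw E. specialize (H w Hw). rewrite E in H.
  replace (0 - f z)%C with (- f z)%C in H by ring. rewrite Cmod_opp in H. lra.
Qed.

Lemma backshift_iter_isolated R n f : 0 < R -> hol R f -> backshift_iter n f (RtoC 0) <> RtoC 0 ->
  exists d, 0 < d /\ forall z, 0 < Cmod z < d -> f z <> RtoC 0.
Proof.
  intros HR. revert f. induction n as [|n IH]; simpl; intros f Hf Hn;
    (destruct (classic (f (RtoC 0) = RtoC 0)) as [E|E];
     [|destruct (cont_neq0 f (RtoC 0)) as [d [Hd H]]; auto;
       [apply cdiff_cont, Hf; rewrite Cmod_0; auto|];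
       exists d; split; auto; intros z Hz; apply H;
       replace (z - 0)%C with z by ring; apply Hz]).
  - contradiction.
  - destruct (IH (backshift f) (hol_backshift _ _ Hf) Hn) as [d [Hd H]]. exists d. split; auto.
    intros z Hz. rewrite backshift_eq, E, Cplus_0_l. apply Cmult_neq_0; auto.
    apply Cmod_neq0. lra.
Qed.

Lemma backshift_iter_pow n f z : (forall k, backshift_iter k f (RtoC 0) = RtoC 0) -> f z = (z ^ n * backshift_iter n f z)%C.
Proof.
  revert f. induction n as [|n IH]; intros f H; simpl.
  - ring.
  - rewrite (backshift_eq f z), (H 0%nat : f (RtoC 0) = RtoC 0), (IH (backshift f)) at 1.
    + ring.
    + intros k. apply (H (S k)).
Qed.

(** Either some Taylor coefficient is nonzero and the first such one dominates near 0, or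
    [f = z^n b_n] for every [n] and the geometric bound on [b_n] forces [f = 0]. *)
Lemma isolated_zeros R f : 0 < R -> hol R f ->
  (exists d, 0 < d /\ forall z, Cmod z < d -> f z = RtoC 0) \/
  (exists d, 0 < d /\ forall z, 0 < Cmod z < d -> f z <> RtoC 0).
Proof.
  intros HR Hf. destruct (classic (exists n, backshift_iter n f (RtoC 0) <> RtoC 0)) as [[n Hn]|N].
  - right. eapply backshift_iter_isolated; eauto.
  - left. assert (H : forall k, backshift_iter k f (RtoC 0) = RtoC 0).
    { intros k. apply NNPP. intros C. apply N. exists k. auto. }
    (* The two radii have ratio 1/2, so [|f(z)|^2] is bounded by [K * (1 / 4)^n]. *)
    destruct (backshift_iter_bound R f (R / 4) (R / 2) Hf ltac:(lra) ltac:(lra)) as [K [_ HK]].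
    exists (R / 4). split; [lra|]. intros z Hz. apply Cmod_eq_0, Rle_antisym; [|apply Cmod_ge_0].
    assert (S : Cmod (f z) ^ 2 <= 0).
    { apply (geometric_le_0 _ K (1 / 4)); [lra|]. intros n.
      rewrite (backshift_iter_pow n f z H), Cmod_mult, Cmod_pow.
      specialize (HK n z ltac:(lra)).
      assert (P : (Cmod z ^ n) ^ 2 <= (R / 4) ^ (2 * n)).
      { rewrite <- pow_mult, Nat.mul_comm. apply pow_incr. split; [apply Cmod_ge_0|lra]. }
      rewrite Rpow_mult_distr.
      apply Rle_trans with ((R / 4) ^ (2 * n) * Cmod (backshift_iter n f z) ^ 2).
      - apply Rmult_le_compat_r; auto. apply pow2_ge_0.
      - replace ((R / 4) ^ (2 * n)) with ((1 / 4) ^ n * (R / 2) ^ (2 * n)).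
        + rewrite Rmult_assoc, Rmult_comm. apply Rmult_le_compat_r; auto. apply pow_le; lra.
        + rewrite !pow_mult, <- Rpow_mult_distr. f_equal. simpl. field. }
    assert (P := Cmod_ge_0 (f z)). nra.
Qed.

(** With [m] the minimum of [|G - G(0)|] on a circle, let [c] be an omitted value within [m / 2] of
    [G(0)]. Then [1 / (G - c)] is holomorphic, at most [2 / m] on the circle, yet larger at the
    centre. *)
Lemma open_at_0 R G d : hol R G -> (forall z, 0 < Cmod z < R -> G z <> G (RtoC 0)) ->
  0 < d < R -> exists eta, 0 < eta /\
    forall c, Cmod (c - G (RtoC 0))%C < eta -> exists z, Cmod z < d /\ G z = c.
Proof.
  intros HG Hinj Hd. assert (HPI := PI_RGT_0). set (r := d / 2).
  assert (NZ : forall t, (G (circ r t) - G (RtoC 0))%C <> RtoC 0).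
  { intros t. apply Cminus_eq_contra, Hinj. rewrite Cmod_circ; unfold r; lra. }
  (* The minimum of the modulus is found as the maximum of its reciprocal. *)
  destruct (rcont_bounded (fun t => / (G (circ r t) - G (RtoC 0)))%C (- PI) PI) as [t0 [_ H0]].
  - lra.
  - intros t _. apply cont_inv; auto. apply cont_minus; [|apply cont_const].
    apply rcont_on_circ; [unfold r; lra|]. intros z Hz. apply HG. unfold r in Hz; lra.
  - set (m := Cmod (G (circ r t0) - G (RtoC 0))%C).
    assert (Pm : 0 < m) by (apply Cmod_gt_0; auto).
    assert (LB : forall z, Cmod z = r -> m <= Cmod (G z - G (RtoC 0))%C).
    { intros z Hz. destruct (on_circ r z Hz) as [t [Ht ->]]. specialize (H0 t Ht).
      rewrite !Cmod_inv in H0 by auto. fold m in H0. apply Rnot_lt_le. intros L.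
      apply Rinv_lt_contravar in L; [lra|]. apply Rmult_lt_0_compat; auto. apply Cmod_gt_0; auto. }
    exists (m / 2). split; [lra|]. intros c Hc.
    destruct (classic (exists z, Cmod z <= r /\ G z = c)) as [[z [Hz E]]|N].
    { exists z. split; auto. unfold r in Hz; lra. }
    exfalso.
    assert (N0 : forall z, Cmod z <= r -> (G z - c)%C <> RtoC 0).
    { intros z Hz. apply Cminus_eq_contra. intros E. apply N. exists z. auto. }
    assert (M : Cmod (/ (G (RtoC 0) - c))%C <= / (m / 2)).
    { apply (max_modulus (fun z => / (G z - c))%C r).
      - intros z Hz. destruct (HG z) as [l Hl]; [unfold r in Hz; lra|].
        eexists. apply der_inv; [apply N0; auto|].
        apply der_minus; [exact Hl|apply der_const].
      - intros z Hz. apply Cmod_inv_le; [lra|].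
        assert (T := Cmod_ge_sub (G z - G (RtoC 0))%C (c - G (RtoC 0))%C).
        replace (G z - G (RtoC 0) - (c - G (RtoC 0)))%C with (G z - c)%C in T by ring.
        specialize (LB z Hz). lra.
      - rewrite Cmod_0. unfold r; lra. }
    rewrite Cmod_inv, Cmod_minus_sym in M by (apply N0; rewrite Cmod_0; unfold r; lra).
    assert (P : 0 < Cmod (c - G (RtoC 0))%C).
    { rewrite Cmod_minus_sym. apply Cmod_gt_0, N0. rewrite Cmod_0; unfold r; lra. }
    apply Rinv_lt_contravar in Hc; [lra|]. apply Rmult_lt_0_compat; lra.
Qed.

Definition inj_D (G : CC -> CC) : Prop :=
  forall z w : CC, inD z -> inD w -> G z = G w -> z = w.

Definition Ginv (G : CC -> CC) (c : CC) : CC :=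
  epsilon (inhabits (RtoC 0)) (fun z : CC => Cmod z < 1 /\ G z = c).

Lemma Ginv_spec G c : (exists z, Cmod z < 1 /\ G z = c) -> Cmod (Ginv G c) < 1 /\ G (Ginv G c) = c.
Proof.
  intros H. apply (epsilon_spec (inhabits (RtoC 0)) (fun z : CC => Cmod z < 1 /\ G z = c) H).
Qed.

Lemma Ginv_G G z : inj_D G -> Cmod z < 1 -> Ginv G (G z) = z.
Proof.
  intros Hi Hz. destruct (Ginv_spec G (G z)) as [H1 H2]; [exists z; auto|].
  apply Hi; auto.
Qed.

Lemma cder_shift f a z l : cder f (a + z)%C l -> cder (fun z => f (a + z)%C) z l.
Proof.
  intros H. eapply der_eq; [apply (der_comp idC (fun z => a + z)%C f); [|exact H]|].
  - apply der_plus; [apply der_const|apply der_id].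
  - ring.
Qed.

Lemma hol_shift f a R : hol 1 f -> Cmod a + R <= 1 -> hol R (fun z => f (a + z)%C).
Proof.
  intros Hf Ha z Hz. destruct (Hf (a + z)%C) as [l Hl].
  - eapply Rle_lt_trans; [apply Cmod_triangle|]. lra.
  - exists l. apply cder_shift; auto.
Qed.

Lemma open_at G a d : hol 1 G -> inj_D G -> Cmod a < 1 -> 0 < d -> exists eta, 0 < eta /\
  forall c, Cmod (c - G a)%C < eta -> exists z, Cmod (z - a)%C < d /\ Cmod z < 1 /\ G z = c.
Proof.
  intros HG Hi Ha Hd. set (R := 1 - Cmod a).
  assert (Z0 : (a + 0)%C = a) by ring.
  assert (B : forall z, Cmod z < R -> Cmod (a + z)%C < 1).
  { intros z Hz. eapply Rle_lt_trans; [apply Cmod_triangle|]. unfold R in Hz; lra. }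
  destruct (open_at_0 R (fun z => G (a + z)%C) (Rmin d (R / 2))) as [eta [He H]].
  - apply hol_shift; auto. unfold R; lra.
  - intros z Hz E. rewrite Z0 in E. apply Hi in E; [|apply B; lra|exact Ha].
    assert (z = RtoC 0) by (replace z with (a + z - a)%C by ring; rewrite E; ring).
    subst z. rewrite Cmod_0 in Hz. lra.
  - assert (R2 := Rmin_r d (R / 2)). assert (0 < R) by (unfold R; lra).
    split; [apply Rmin_glb_lt; lra|lra].
  - exists eta. split; auto. intros c Hc. rewrite Z0 in H.
    destruct (H c Hc) as [z [Hz E]]. exists (a + z)%C.
    assert (H1 := Rlt_le_trans _ _ _ Hz (Rmin_l _ _)).
    assert (H2 := Rlt_le_trans _ _ _ Hz (Rmin_r _ _)).
    replace (a + z - a)%C with z by ring. split; auto. split; auto. apply B.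
    assert (P := Cmod_ge_0 z). lra.
Qed.

Lemma Ginv_cont G a : hol 1 G -> inj_D G -> Cmod a < 1 -> ccont (Ginv G) (G a).
Proof.
  intros HG Hi Ha eps He. destruct (open_at G a eps HG Hi Ha He) as [eta [Hp H]].
  exists eta. split; auto. intros c Hc. destruct (H c Hc) as [z [Hz [Hz1 E]]].
  rewrite <- E, !Ginv_G by auto. exact Hz.
Qed.

Lemma Ginv_der_of_neq0 G a : hol 1 G -> inj_D G -> Cmod a < 1 -> Cderiv G a <> RtoC 0 ->
  cder (Ginv G) (G a) (/ Cderiv G a)%C.
Proof.
  intros HG Hi Ha Hn. set (m := Cderiv G a) in *.
  assert (Pm : 0 < Cmod m) by (apply Cmod_gt_0; auto).
  intros eps He.
  (* The first bound gives [|G z - G a| >= |m| |h| / 2]; the second turns the error [e |h| / |m|]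
     into at most [eps |G z - G a|]. *)
  set (e := Rmin (Cmod m / 2) (eps * (Cmod m * Cmod m) / 2)).
  assert (E1 : e <= Cmod m / 2) by apply Rmin_l.
  assert (E2 : e <= eps * (Cmod m * Cmod m) / 2) by apply Rmin_r.
  assert (Pe : 0 < e).
  { apply Rmin_glb_lt; [lra|]. assert (0 < Cmod m * Cmod m) by nra. 
    assert (0 < eps * (Cmod m * Cmod m)) by (apply Rmult_lt_0_compat; auto). lra. }
  destruct (cdiff_cderiv G a (HG a Ha) e Pe) as [d [Hd HD]].
  destruct (open_at G a d HG Hi Ha Hd) as [eta [Hp H]].
  exists eta. split; auto. intros c Hc. destruct (H c Hc) as [z [Hz [Hz1 E]]].
  rewrite <- E, !Ginv_G by auto. specialize (HD z Hz). cbv beta in HD. fold m in HD.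
  set (h := (z - a)%C) in *. assert (Ph := Cmod_ge_0 h).
  assert (T := Cmod_ge_sub (m * h)%C (m * h - (G z - G a))%C).
  replace (m * h - (m * h - (G z - G a)))%C with (G z - G a)%C in T by ring.
  rewrite (Cmod_minus_sym (m * h)) , Cmod_mult in T.
  replace (h - / m * (G z - G a))%C with (- (/ m * (G z - G a - m * h)))%C by (field; auto).
  rewrite Cmod_opp, Cmod_mult, Cmod_inv by auto.
  apply (Rmult_le_reg_l (Cmod m)); auto. rewrite <- Rmult_assoc, Rinv_r, Rmult_1_l by lra.
  apply Rle_trans with (e * Cmod h); auto.
  assert (Cmod m / 2 * Cmod h <= Cmod (G z - G a)%C) by nra.
  apply Rle_trans with (eps * (Cmod m * Cmod m) / 2 * Cmod h); [nra|].
  replace (eps * (Cmod m * Cmod m) / 2 * Cmod h)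
    with (Cmod m * (eps * (Cmod m / 2 * Cmod h))) by field.
  apply Rmult_le_compat_l; [lra|]. apply Rmult_le_compat_l; lra.
Qed.

(* Near a critical point the inverse would be holomorphic off one point and continuous there,
   hence holomorphic, contradicting the chain rule. *)
Lemma inj_Cderiv_neq0 G a : hol 1 G -> inj_D G -> Cmod a < 1 -> Cderiv G a <> RtoC 0.
Proof.
  intros HG Hi Ha E0. set (R := 1 - Cmod a). assert (HR : 0 < R) by (unfold R; lra).
  assert (B : forall z, Cmod z < R -> Cmod (a + z)%C < 1).
  { intros z Hz. eapply Rle_lt_trans; [apply Cmod_triangle|]. unfold R in Hz; lra. }
  assert (DS : forall z, Cmod z < R -> Cderiv (fun z => G (a + z)%C) z = Cderiv G (a + z)%C).
  { intros z Hz. apply Cderiv_unique, cder_shift, cdiff_cderiv, HG, B, Hz. }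
  destruct (isolated_zeros R (fun z => Cderiv G (a + z)%C) HR) as [[d [Hd H]]|[d [Hd H]]].
  - apply hol_shift; [apply hol_Cderiv; auto|unfold R; lra].
  - set (e := Rmin d R). assert (Pe : 0 < e) by (apply Rmin_glb_lt; auto).
    assert (L1 : e <= d) by apply Rmin_l. assert (L2 : e <= R) by apply Rmin_r.
    assert (C : Cmod (RtoC (e / 2)) = e / 2) by (rewrite Cmod_R, Rabs_pos_eq; lra).
    assert (X : G (a + (e / 2)%R)%C = G a).
    { apply (hol_eq_of_Cderiv e (fun z => G (a + z)%C) (fun _ => G a)); try lra.
      - apply hol_shift; auto. unfold R in L2; lra.
      - intros z _. apply cdiff_const.
      - f_equal. ring.
      - intros z Hz. rewrite DS, H by lra. symmetry. apply Cderiv_unique, der_const. }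
    apply Hi in X; [|apply B; lra|exact Ha].
    assert (Y : RtoC (e / 2) = RtoC 0).
    { replace (RtoC (e / 2)) with (a + (e / 2)%R - a)%C by ring. rewrite X. ring. }
    rewrite Y, Cmod_0 in C. lra.
  - destruct (open_at G a d HG Hi Ha Hd) as [eta [Hp HO]].
    set (J := fun w => Ginv G (G a + w)%C).
    assert (HJ : hol eta J).
    { apply removable; auto.
      - apply (cont_comp idC (fun w => G a + w)%C (Ginv G)).
        + apply cont_plus; [apply cont_const|apply cont_id].
        + cbv beta. replace (G a + 0)%C with (G a) by ring. apply Ginv_cont; auto.
      - intros w Hw. destruct (HO (G a + w)%C) as [z [Hz [Hz1 E]]].
        { replace (G a + w - G a)%C with w by ring. apply Hw. }
        exists (/ Cderiv G z)%C. apply (cder_shift (Ginv G)). rewrite <- E.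
        apply Ginv_der_of_neq0; auto.
        replace z with (a + (z - a))%C by ring. apply H. split; auto.
        apply Cmod_gt_0. intros Z. assert (z = a) by (replace z with (z - a + a)%C by ring; rewrite Z; ring).
        subst z. assert (w = RtoC 0) by (transitivity (G a + w - G a)%C; [ring|rewrite <- E; ring]).
        subst w. rewrite Cmod_0 in Hw. lra. }
    destruct (HJ (RtoC 0)) as [l Hl]; [rewrite Cmod_0; auto|].
    assert (C1 : cder (fun z => J (G z - G a)%C) a (l * (0 - 0))%C).
    { apply (der_comp idC (fun z => G z - G a)%C J).
      - apply der_minus; [|apply der_const]. rewrite <- E0. apply cdiff_cderiv; auto.
      - cbv beta. replace (G a - G a)%C with (RtoC 0) by ring. exact Hl. }
    assert (C2 : cder (fun z => z) a (l * (0 - 0))%C).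
    { apply (der_local _ (fun z => J (G z - G a)%C) _ _ _ R HR); auto.
      intros z Hz. unfold J. replace (G a + (G z - G a))%C with (G z) by ring.
      apply Ginv_G; auto. replace z with (a + (z - a))%C by ring. apply B; auto. }
    assert (C3 := cder_unique _ _ _ _ C2 (der_id idC a)).
    replace (l * (0 - 0))%C with (RtoC 0) in C3 by ring. apply RtoC_inj in C3. lra.
Qed.

Lemma cdiff_Ginv G a : hol 1 G -> inj_D G -> Cmod a < 1 -> cdiff (Ginv G) (G a).
Proof. intros HG Hi Ha. eexists. apply Ginv_der_of_neq0; auto. apply inj_Cderiv_neq0; auto. Qed.

(** The subordination principle, with [Ginv G] after [p] as the Schwarz function. It is used for
    [phi], for [K], and for the scaled maps [t * g]. *)
Lemma subordination G p :
  hol 1 G -> inj_D G -> hol 1 p -> p (RtoC 0) = G (RtoC 0) ->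
  (forall z, Cmod z < 1 -> exists w, Cmod w < 1 /\ G w = p z) ->
  exists w, hol 1 w /\ w (RtoC 0) = RtoC 0 /\ (forall z, Cmod z < 1 -> Cmod (w z) < 1) /\
    (forall z, Cmod z < 1 -> p z = G (w z)) /\ (forall z, Cmod z < 1 -> Cmod (w z) <= Cmod z).
Proof.
  intros HG Hi Hp H0 Hs. set (w := fun z => Ginv G (p z)).
  assert (W1 : forall z, Cmod z < 1 -> Cmod (w z) < 1) by (intros z Hz; apply Ginv_spec; auto).
  assert (WG : forall z, Cmod z < 1 -> p z = G (w z)).
  { intros z Hz. symmetry. apply Ginv_spec; auto. }
  assert (W0 : w (RtoC 0) = RtoC 0).
  { unfold w. rewrite H0. apply Ginv_G; auto. rewrite Cmod_0; lra. }
  assert (HW : hol 1 w).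
  { intros z Hz. apply (cdiff_comp (Ginv G) p); auto. rewrite WG by auto. apply cdiff_Ginv; auto. }
  exists w. repeat split; auto. apply schwarz_le; auto. intros z Hz. left; auto.
Qed.

(** * Starlike and convex maps *)

Lemma left_max (u : R -> R) (t0 l : R) :
  is_derive u t0 l -> (exists d, 0 < d /\ forall t, t0 - d < t < t0 -> u t <= u t0) -> 0 <= l.
Proof.
  intros H [d [Hd HM]]. apply Rnot_lt_le. intros L.
  destruct (rder_of_is_derive u t0 l H (- l / 2) ltac:(lra)) as [e [He HE]].
  set (m := Rmin (d / 2) (e / 2)). assert (Pm : 0 < m) by (apply Rmin_glb_lt; lra).
  assert (M1 : m <= d / 2) by apply Rmin_l. assert (M2 : m <= e / 2) by apply Rmin_r.
  specialize (HE (t0 - m)). specialize (HM (t0 - m) ltac:(lra)).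
  rewrite <- !RtoC_minus, <- RtoC_mult, <- RtoC_minus, !Cmod_R in HE.
  replace (t0 - m - t0) with (- m) in HE by ring.
  rewrite Rabs_Ropp, (Rabs_pos_eq m) in HE by lra. specialize (HE ltac:(lra)).
  assert (B := Rabs_le_between' (u (t0 - m) - u t0) (l * - m) (- l / 2 * m)).
  apply B in HE. nra.
Qed.

Lemma right_max (u : R -> R) (t0 l : R) :
  is_derive u t0 l -> (exists d, 0 < d /\ forall t, t0 < t < t0 + d -> u t <= u t0) -> l <= 0.
Proof.
  intros H [d [Hd HM]]. apply Rnot_lt_le. intros L.
  destruct (rder_of_is_derive u t0 l H (l / 2) ltac:(lra)) as [e [He HE]].
  set (m := Rmin (d / 2) (e / 2)). assert (Pm : 0 < m) by (apply Rmin_glb_lt; lra).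
  assert (M1 : m <= d / 2) by apply Rmin_l. assert (M2 : m <= e / 2) by apply Rmin_r.
  specialize (HE (t0 + m)). specialize (HM (t0 + m) ltac:(lra)).
  rewrite <- !RtoC_minus, <- RtoC_mult, <- RtoC_minus, !Cmod_R in HE.
  replace (t0 + m - t0) with m in HE by ring.
  rewrite (Rabs_pos_eq m) in HE by lra. specialize (HE ltac:(lra)).
  assert (B := Rabs_le_between' (u (t0 + m) - u t0) (l * m) (l / 2 * m)).
  apply B in HE. nra.
Qed.

(** The radial derivative of [Re f] is [Re (z0 * l)], nonnegative by maximality from inside; the
    tangential one is [- Im (z0 * l)], zero by maximality along the circle. *)
Lemma boundary_max f z0 l :
  0 < Cmod z0 -> cder f z0 l -> (forall z, Cmod z <= Cmod z0 -> Re (f z) <= Re (f z0)) ->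
  0 <= Re (z0 * l)%C /\ (z0 * l)%C = RtoC (Re (z0 * l)%C).
Proof.
  intros Hz Hl HM.
  assert (HR : is_derive (fun s : R => Re (f (s * z0)%C)) 1 (Re (l * z0)%C)).
  { apply rder_Re. eapply der_eq.
    - apply (der_comp RtoC (fun s => s * z0)%C f); [apply der_mult; [apply der_id|apply der_const]|].
      cbv beta. replace (1 * z0)%C with z0 by ring. exact Hl.
    - cbv beta. ring. }
  assert (HT : is_derive (fun t : R => Re (f (z0 * cis t)%C)) 0 (Re (l * (z0 * Ci))%C)).
  { apply rder_Re. eapply der_eq.
    - apply (der_comp RtoC (fun t => z0 * cis t)%C f); [apply der_scal, rder_cis|].
      cbv beta. rewrite cis_0. replace (z0 * 1)%C with z0 by ring. exact Hl.
    - cbv beta. rewrite cis_0. ring. }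
  assert (L : 0 <= Re (l * z0)%C).
  { apply (left_max _ _ _ HR). exists 1. split; [lra|]. intros t Ht. cbv beta.
    replace (1 * z0)%C with z0 by ring. apply HM.
    rewrite Cmod_mult, Cmod_R, Rabs_pos_eq by lra. nra. }
  assert (HM' : forall t, Re (f (z0 * cis t)%C) <= Re (f (z0 * cis 0)%C)).
  { intros t. rewrite cis_0. replace (z0 * 1)%C with z0 by ring. apply HM.
    rewrite Cmod_mult, Cmod_cis. lra. }
  assert (T1 : 0 <= Re (l * (z0 * Ci))%C).
  { apply (left_max _ _ _ HT). exists 1. split; [lra|]. intros; apply HM'. }
  assert (T2 : Re (l * (z0 * Ci))%C <= 0).
  { apply (right_max _ _ _ HT). exists 1. split; [lra|]. intros; apply HM'. }
  rewrite Cmult_comm. split; auto.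
  destruct l as [a b], z0 as [x y]. unfold RtoC, Ci, Cmult, Re, Im in *. simpl in *.
  f_equal. lra.
Qed.

Lemma interior_max f z0 l d :
  0 < d -> cder f z0 l -> (forall z, Cmod (z - z0)%C < d -> Re (f z) <= Re (f z0)) -> l = RtoC 0.
Proof.
  intros Hd Hl HM.
  (* In the direction [conj(l)], the steepest one, [Re f] increases at the rate [|l|^2]. *)
  assert (HR : is_derive (fun s : R => Re (f (z0 + s * Cconj l)%C)) 0 (Re (l * Cconj l)%C)).
  { apply rder_Re. eapply der_eq.
    - apply (der_comp RtoC (fun s => z0 + s * Cconj l)%C f).
      + apply der_plus; [apply der_const|apply der_mult; [apply der_id|apply der_const]].
      + cbv beta. replace (z0 + 0 * Cconj l)%C with z0 by ring. exact Hl.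
    - cbv beta. ring. }
  assert (L : Re (l * Cconj l)%C <= 0).
  { apply (right_max _ _ _ HR). assert (P := Cmod_ge_0 l).
    exists (d / (Cmod l + 1)). split; [apply Rdiv_lt_0_compat; lra|].
    intros t Ht. cbv beta. replace (z0 + 0 * Cconj l)%C with z0 by ring. apply HM.
    replace (z0 + t * Cconj l - z0)%C with (t * Cconj l)%C by ring.
    rewrite Cmod_mult, Cmod_conj, Cmod_R, Rabs_pos_eq by lra.
    apply Rle_lt_trans with (t * (Cmod l + 1)); [nra|].
    apply Rlt_le_trans with (d / (Cmod l + 1) * (Cmod l + 1)).
    - apply Rmult_lt_compat_r; lra.
    - right. field. lra. }
  rewrite <- Cmod2_conj in L. simpl in L. apply Cmod_eq_0.
  assert (P := Cmod_ge_0 l). nra.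
Qed.

Definition starlike_map (g : CC -> CC) : Prop :=
  hol 1 g /\ inj_D g /\ g (RtoC 0) = RtoC 0 /\
  forall (z : CC) (t : R), Cmod z < 1 -> 0 <= t <= 1 ->
    exists z', Cmod z' < 1 /\ g z' = (t * g z)%C.

Lemma starlike_neq0 g z : starlike_map g -> 0 < Cmod z < 1 -> g z <> RtoC 0.
Proof.
  intros (_ & Hi & H0 & _) Hz E. rewrite <- H0 in E. apply Hi in E; [|apply Hz|].
  - rewrite E, Cmod_0 in Hz. lra.
  - unfold inD. rewrite Cmod_0; lra.
Qed.

(** [t * g] is subordinate to [g], so [|z'| <= |z|]. Equality would make the Schwarz function a
    rotation, and the derivatives at 0 would give [t = 1]. Hence the images of concentric disks are
    starlike too. *)
Lemma starlike_shrink g z z' (t : R) : starlike_map g -> 0 < Cmod z < 1 -> Cmod z' < 1 ->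
  0 <= t < 1 -> g z' = (t * g z)%C -> Cmod z' < Cmod z.
Proof.
  intros Hg Hz Hz' Ht E. destruct (Hg) as (HG & Hi & H0 & Hs).
  destruct (subordination g (fun z => t * g z)%C) as (w & Hw & W0 & W1 & WG & WS); auto.
  - intros y Hy. apply cdiff_scal; auto.
  - rewrite H0. ring.
  - intros y Hy. apply Hs; auto; lra.
  - assert (Ew : w z = z').
    { apply Hi; [apply W1; lra|auto|]. rewrite <- WG by lra. auto. }
    rewrite <- Ew. destruct (Rle_lt_or_eq_dec _ _ (WS z ltac:(lra))) as [L|Eq]; auto.
    exfalso.
    destruct (schwarz_eq w z) as (eps & He & HE); auto.
    { intros y Hy. left; auto. }
    assert (Z : Cmod (RtoC 0) < 1) by (rewrite Cmod_0; lra).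
    assert (D := cdiff_cderiv g _ (HG _ Z)).
    assert (D1 : cder (fun z => t * g z)%C (RtoC 0) (t * Cderiv g (RtoC 0))%C)
      by (apply der_scal; auto).
    assert (D2 : cder (fun z => t * g z)%C (RtoC 0) (Cderiv g (RtoC 0) * (eps * 1))%C).
    { apply (der_local _ (fun z => g (eps * z)%C) _ _ _ 1); [lra| |].
      - intros y Hy. replace (y - 0)%C with y in Hy by ring. rewrite WG, HE by auto. reflexivity.
      - apply (der_comp idC (fun z => eps * z)%C g); [apply der_scal, der_id|].
        cbv beta. rewrite Cmult_0_r. exact D. }
    assert (EQ := cder_unique _ _ _ _ D1 D2).
    apply (f_equal Cmod) in EQ. rewrite !Cmod_mult, Cmod_R, He, Cmod_1, Rabs_pos_eq in EQ by lra.
    assert (P : 0 < Cmod (Cderiv g (RtoC 0))) by (apply Cmod_gt_0, inj_Cderiv_neq0; auto).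
    nra.
Qed.

(* [z K'(z) = g(z)] with [g] starlike: this is Alexander's description of convex maps. *)
Definition alexander (g K : CC -> CC) : Prop :=
  hol 1 K /\ Cderiv K (RtoC 0) <> RtoC 0 /\
  forall z, Cmod z < 1 -> (z * Cderiv K z)%C = g z.

Lemma alexander_neq0 g K z : starlike_map g -> alexander g K -> Cmod z < 1 ->
  Cderiv K z <> RtoC 0.
Proof.
  intros Hg (_ & H0 & HK) Hz E. destruct (classic (z = RtoC 0)) as [-> | N]; auto.
  apply (starlike_neq0 g z Hg).
  - split; auto. apply Cmod_gt_0; auto.
  - rewrite <- HK, E by auto. ring.
Qed.

(** The hypotheses put [g z0] and [g z2] on one ray from 0; a ratio other than 1 would, by
    [starlike_shrink], give points of different moduli. *)
Lemma ray_eq g z0 z2 : starlike_map g -> 0 < Cmod z2 < 1 -> Cmod z0 = Cmod z2 ->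
  0 <= Re (Cconj (g z2) * g z0)%C ->
  (Cconj (g z2) * g z0)%C = RtoC (Re (Cconj (g z2) * g z0)%C) -> z0 = z2.
Proof.
  intros Hg Hz2 Hz0 HL HE. set (lam := Re (Cconj (g z2) * g z0)%C) in *.
  assert (N2 := starlike_neq0 g z2 Hg Hz2).
  assert (N0 : g z0 <> RtoC 0) by (apply (starlike_neq0 g z0 Hg); lra).
  assert (P2 : 0 < Cmod (g z2)) by (apply Cmod_gt_0; auto).
  assert (Q : 0 < Cmod (g z2) ^ 2) by (apply pow_lt; auto).
  set (t := lam / Cmod (g z2) ^ 2).
  assert (Et : g z0 = (t * g z2)%C).
  { unfold t. rewrite RtoC_div by lra. rewrite <- HE, Cmod2_conj. field. split; auto.
    apply Cmod_neq0. rewrite Cmod_conj. auto. }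
  assert (Pt : 0 <= t) by (apply Rmult_le_pos; auto; left; apply Rinv_0_lt_compat; auto).
  destruct (Rtotal_order t 1) as [L|[L|L]].
  - assert (X := starlike_shrink g z2 z0 t Hg Hz2 ltac:(lra) ltac:(lra) Et). lra.
  - destruct Hg as (_ & Hi & _). apply Hi; unfold inD; try lra. rewrite Et, L. ring.
  - assert (X := starlike_shrink g z0 z2 (/ t) Hg ltac:(lra) ltac:(lra)).
    assert (0 < / t) by (apply Rinv_0_lt_compat; lra).
    assert (/ t < 1) by (rewrite <- Rinv_1; apply Rinv_lt_contravar; lra).
    specialize (X ltac:(lra)). rewrite Et, RtoC_inv in X by lra.
    assert (RtoC t <> RtoC 0) by (intros E; apply RtoC_inj in E; lra).
    specialize (X ltac:(field; auto)). lra.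
Qed.

Lemma boundary_max_alexander g K (c : CC) z0 : alexander g K -> 0 < Cmod z0 < 1 ->
  (forall z, Cmod z <= Cmod z0 -> Re (c * K z)%C <= Re (c * K z0)%C) ->
  0 <= Re (c * g z0)%C /\ (c * g z0)%C = RtoC (Re (c * g z0)%C).
Proof.
  intros (HK & _ & HE) Hz HM.
  assert (B := boundary_max (fun z => c * K z)%C z0 (c * Cderiv K z0)%C ltac:(lra)).
  replace (z0 * (c * Cderiv K z0))%C with (c * g z0)%C in B by (rewrite <- HE by lra; ring).
  apply B; auto. apply der_scal, cdiff_cderiv, HK. lra.
Qed.

(** The functional with normal [g z2] is maximal at some point of the circle, where [g] has the same
    direction as [g z2]; by [ray_eq] that point is [z2]. *)
Lemma supporting_line g K z2 : starlike_map g -> alexander g K -> 0 < Cmod z2 < 1 ->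
  forall z, Cmod z <= Cmod z2 -> Re (Cconj (g z2) * K z)%C <= Re (Cconj (g z2) * K z2)%C.
Proof.
  intros Hg HA Hz2. set (c := Cconj (g z2)).
  destruct (max_Re_on_circle (fun z => c * K z)%C (Cmod z2) ltac:(lra)) as [z0 [E0 HM]].
  - intros z Hz. apply cdiff_scal. apply HA. lra.
  - rewrite <- E0 in HM.
    destruct (boundary_max_alexander g K c z0 HA ltac:(lra) HM) as [L1 L2].
    rewrite (ray_eq g z0 z2 Hg Hz2 E0 L1 L2) in HM. exact HM.
Qed.

(** Strict convexity: an interior maximum would be a critical point of [K], and a second one on the
    circle is excluded by [ray_eq]. *)
Lemma supporting_line_eq g K z z2 : starlike_map g -> alexander g K -> 0 < Cmod z2 < 1 ->
  Cmod z <= Cmod z2 -> Re (Cconj (g z2) * K z)%C = Re (Cconj (g z2) * K z2)%C -> z = z2.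
Proof.
  intros Hg HA Hz2 Hz E. set (c := Cconj (g z2)) in *.
  assert (HS := supporting_line g K z2 Hg HA Hz2). fold c in HS.
  destruct (Rle_lt_or_eq_dec _ _ Hz) as [L|Eq].
  - exfalso. assert (Z : (c * Cderiv K z)%C = RtoC 0).
    { apply (interior_max (fun z => c * K z)%C z _ (Cmod z2 - Cmod z)); [lra| |].
      - apply der_scal, cdiff_cderiv, HA. lra.
      - intros y Hy. rewrite E. apply HS.
        assert (T := Cmod_triangle (y - z)%C z). replace (y - z + z)%C with y in T by ring. lra. }
    revert Z. apply Cmult_neq_0.
    + apply Cmod_neq0. unfold c. rewrite Cmod_conj. apply Cmod_gt_0.
      apply (starlike_neq0 g z2 Hg Hz2).
    + apply (alexander_neq0 g K z Hg HA). lra.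
  - destruct (boundary_max_alexander g K c z HA ltac:(lra)) as [L1 L2].
    + intros y Hy. rewrite E. apply HS. lra.
    + apply (ray_eq g z z2 Hg Hz2 Eq L1 L2).
Qed.

(** If [K z = K w] with [|z| <= |w|], then [z] attains the maximum of the functional with normal
    [g w], which only [w] attains. *)
Lemma alexander_inj g K : starlike_map g -> alexander g K -> inj_D K.
Proof.
  intros Hg HA.
  assert (H : forall z w, Cmod z <= Cmod w -> Cmod w < 1 -> K z = K w -> z = w).
  { intros z w Hzw Hw E. destruct (Rle_lt_or_eq_dec 0 (Cmod w) (Cmod_ge_0 w)) as [L|Eq].
    - apply (supporting_line_eq g K z w Hg HA); auto. rewrite E. reflexivity.
    - symmetry in Eq. assert (P := Cmod_ge_0 z).
      assert (Ez : Cmod z = 0) by lra. apply Cmod_eq_0 in Eq. apply Cmod_eq_0 in Ez. congruence. }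
  intros z w Hz Hw E. destruct (Rle_dec (Cmod z) (Cmod w)) as [L|L].
  - apply H; auto.
  - symmetry. apply H; auto. lra.
Qed.

(** * Comparison of support functions and inclusion of the images *)

Lemma Re_close (c a b l h : CC) e :
  Cmod (a - b - l * h)%C <= e -> Re (c * b)%C + Re (c * (l * h))%C - Cmod c * e <= Re (c * a)%C.
Proof.
  intros H.
  replace (c * a)%C with (c * b + c * (l * h) + c * (a - b - l * h))%C by ring.
  assert (A := re_le_Cmod (c * (a - b - l * h))%C). rewrite Cmod_mult in A.
  apply Rabs_le_between in A. assert (P := Cmod_ge_0 c).
  assert (Cmod c * Cmod (a - b - l * h)%C <= Cmod c * e) by (apply Rmult_le_compat_l; auto).
  unfold Re, Cplus in *. simpl in *. lra.
Qed.

(** If [c g(u)] exceeded [c g(z)], then [g(z)] would be a multiple of [g(u)] by a factor in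
    [[0, 1)], and [starlike_shrink] would give [|z| < |u|]. *)
Lemma normal_derivative_le g (c z u : CC) : starlike_map g -> 0 < Cmod z < 1 -> Cmod u <= Cmod z ->
  0 <= Re (c * g z)%C -> (c * g z)%C = RtoC (Re (c * g z)%C) ->
  (c * g u)%C = RtoC (Re (c * g u)%C) -> Re (c * g u)%C <= Re (c * g z)%C.
Proof.
  intros Hg Hz Hu Pz Ez Eu. apply Rnot_lt_le. intros L.
  set (a := Re (c * g z)%C) in *. set (b := Re (c * g u)%C) in *.
  assert (Nb : RtoC b <> RtoC 0) by (intros E; apply RtoC_inj in E; lra).
  assert (Nc : c <> RtoC 0).
  { intros E. apply Nb. rewrite <- Eu, E. ring. }
  assert (Eg : g z = ((a / b)%R * g u)%C).
  { rewrite RtoC_div by lra. replace (g z) with (/ c * (c * g z))%C by (field; auto).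
    replace (g u) with (/ c * (c * g u))%C by (field; auto). rewrite Ez, Eu. field. auto. }
  assert (Nu : 0 < Cmod u).
  { apply Cmod_gt_0. intros E. apply Nb. rewrite <- Eu, E.
    destruct Hg as (_ & _ & H0 & _). rewrite H0. ring. }
  assert (X := starlike_shrink g u z (a / b) Hg ltac:(lra) ltac:(lra)).
  assert (0 <= a / b < 1).
  { split; [apply Rmult_le_pos; auto; left; apply Rinv_0_lt_compat; lra|].
    apply (Rmult_lt_reg_r b); [lra|]. unfold Rdiv. rewrite Rmult_assoc, Rinv_l; lra. }
  specialize (X ltac:(auto) Eg). lra.
Qed.

(* The support functions of the images of |z| <= rho are compared by summing their
   increments over the radii [i * delta]; the normal derivatives telescope. *)
Lemma support_function_step g K F om (c : CC) (r C : R) (n : nat) :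
  starlike_map g -> alexander g K -> hol 1 F -> F (RtoC 0) = K (RtoC 0) ->
  (forall z, Cmod z < 1 -> (z * Cderiv F z)%C = g (om z)) ->
  (forall z, Cmod z < 1 -> Cmod (om z) <= Cmod z) ->
  0 < r < 1 -> 0 <= C -> (0 < n)%nat ->
  (forall z w, Cmod z <= r -> Cmod w <= r ->
     Cmod (K w - K z - Cderiv K z * (w - z))%C <= C * (Cmod (w - z)%C * Cmod (w - z)%C)) ->
  (forall z w, Cmod z <= r -> Cmod w <= r ->
     Cmod (F w - F z - Cderiv F z * (w - z))%C <= C * (Cmod (w - z)%C * Cmod (w - z)%C)) ->
  forall i, (S i <= n)%nat -> forall zF zK,
    Cmod zF = INR (S i) * (r / INR n) ->
    (forall z, Cmod z <= Cmod zF -> Re (c * F z)%C <= Re (c * F zF)%C) ->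
    Cmod zK = INR (S i) * (r / INR n) ->
    (forall z, Cmod z <= Cmod zK -> Re (c * K z)%C <= Re (c * K zK)%C) ->
    - (2 * (Cmod c * (C * ((r / INR n) * (r / INR n)))) * INR (S i)) <=
      Re (c * K zK)%C - Re (c * F zF)%C + Re (c * g zK)%C / INR (S i).
Proof.
  intros Hg HA HF H0 HFE Hom Hr HC Hn QK QF.
  assert (Pn : 0 < INR n) by (apply lt_0_INR; auto).
  set (del := r / INR n). assert (Pd : 0 < del) by (apply Rdiv_lt_0_compat; lra).
  assert (Bi : forall i, (i <= n)%nat -> INR i * del <= r).
  { intros i Hi. apply le_INR in Hi. apply Rle_trans with (INR n * del).
    - apply Rmult_le_compat_r; lra.
    - unfold del. right. field. lra. }
  set (E := Cmod c * (C * (del * del))).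
  assert (Pdd : 0 <= del * del) by nra.
  assert (PE : 0 <= E) by (apply Rmult_le_pos; [apply Cmod_ge_0|apply Rmult_le_pos; auto]).
  assert (LF : forall z, 0 < Cmod z < 1 ->
    (forall y, Cmod y <= Cmod z -> Re (c * F y)%C <= Re (c * F z)%C) ->
    (c * g (om z))%C = RtoC (Re (c * g (om z))%C)).
  { intros z Hz HM.
    assert (B := boundary_max (fun z => c * F z)%C z (c * Cderiv F z)%C ltac:(lra)).
    replace (z * (c * Cderiv F z))%C with (c * g (om z))%C in B by (rewrite <- HFE by lra; ring).
    apply B; auto. apply der_scal, cdiff_cderiv, HF. lra. }
  (* Pulled in to the previous radius, the maximum point of [F] is a competitor there; [E] bounds
     the second-order error. *)
  assert (IF : forall i, (S i <= n)%nat -> forall zF, Cmod zF = INR (S i) * del ->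
    Re (c * F zF)%C - Re (c * g (om zF))%C / INR (S i) - E <=
    Re (c * F (RtoC (INR i / INR (S i)) * zF))%C).
  { intros i Hi zF HzF. assert (B := Bi _ Hi). assert (PS : 0 < INR (S i)) by (apply lt_0_INR; lia).
    assert (Pi := pos_INR i). assert (ES := S_INR i).
    set (y := (RtoC (INR i / INR (S i)) * zF)%C).
    assert (Ey : (y - zF)%C = (- (RtoC (/ INR (S i)) * zF))%C).
    { unfold y. replace (INR i / INR (S i)) with (1 - / INR (S i)).
      - rewrite RtoC_minus. ring.
      - rewrite ES. field. lra. }
    assert (My : Cmod (y - zF)%C = del).
    { rewrite Ey, Cmod_opp, Cmod_mult, Cmod_R, Rabs_pos_eq, HzF.
      - field. lra.
      - left. apply Rinv_0_lt_compat; auto. }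
    assert (Hy : Cmod y <= r).
    { unfold y. rewrite Cmod_mult, Cmod_R, Rabs_pos_eq, HzF.
      - replace (INR i / INR (S i) * (INR (S i) * del)) with (INR i * del) by (field; lra).
        apply Bi. lia.
      - apply Rmult_le_pos; auto. left. apply Rinv_0_lt_compat; auto. }
    assert (Q := QF zF y ltac:(lra) Hy). rewrite My in Q.
    apply (Re_close c) in Q. fold E in Q.
    replace (c * (Cderiv F zF * (y - zF)))%C with (RtoC (- / INR (S i)) * (c * g (om zF)))%C in Q.
    2:{ rewrite Ey, <- HFE, RtoC_opp by lra. ring. }
    rewrite re_scal_l in Q. unfold Rdiv. lra. }
  induction i as [|i IH]; intros Hi zF zK HzF MF HzK MK;
    assert (B := Bi _ Hi).
  (* At the first radius the pulled-in point is 0, where [F] and [K] agree, and the value there is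
     at most the maximum for [K]. *)
  - change (INR 1) with 1 in *. rewrite Rmult_1_l in HzF, HzK, B.
    destruct (boundary_max_alexander g K c zK HA ltac:(lra) MK) as [L1 L2].
    assert (NL := normal_derivative_le g c zK (om zF) Hg ltac:(lra)
      ltac:(rewrite HzK, <- HzF; apply Hom; lra) L1 L2 (LF zF ltac:(lra) MF)).
    assert (I := IF 0%nat Hi zF ltac:(change (INR 1) with 1; lra)). change (INR 1) with 1 in I. change (INR 0) with 0 in I.
    replace (RtoC (0 / 1) * zF)%C with (RtoC 0) in I
      by (replace (0 / 1) with 0 by field; ring).
    assert (M0 := MK (RtoC 0) ltac:(rewrite Cmod_0; lra)). rewrite H0 in I. lra.
  - assert (Pi := lt_0_INR (S i) ltac:(lia)). assert (Bi' := Bi (S i) ltac:(lia)).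
    set (q := INR (S (S i))) in *. set (p := INR (S i)) in *.
    assert (Eq : q = p + 1) by (unfold q, p; rewrite (S_INR (S i)); reflexivity).
    assert (Pp : 0 < p * del) by (apply Rmult_lt_0_compat; auto).
    destruct (max_Re_on_circle (fun z => c * F z)%C (p * del) Pp) as [yF [EyF MyF]].
    { intros z Hz. apply cdiff_scal, HF. lra. }
    destruct (max_Re_on_circle (fun z => c * K z)%C (p * del) Pp) as [yK [EyK MyK]].
    { intros z Hz. apply cdiff_scal, HA. lra. }
    rewrite <- EyF in MyF. rewrite <- EyK in MyK.
    assert (P := IH ltac:(lia) yF yK EyF MyF EyK MyK).
    assert (Pq : 0 < q * del) by (apply Rmult_lt_0_compat; lra).
    destruct (boundary_max_alexander g K c zK HA ltac:(lra) MK) as [L1 L2].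
    assert (NL := normal_derivative_le g c zK (om zF) Hg ltac:(lra)
      ltac:(rewrite HzK, <- HzF; apply Hom; lra) L1 L2 (LF zF ltac:(lra) MF)).
    assert (I := IF (S i) Hi zF HzF). fold q in I. fold p in I.
    assert (UF : Re (c * F (RtoC (p / q) * zF))%C <= Re (c * F yF)%C).
    { apply MyF. rewrite Cmod_mult, Cmod_R, Rabs_pos_eq, HzF, EyF.
      - right. field. lra.
      - apply Rmult_le_pos; [lra|]. left. apply Rinv_0_lt_compat; lra. }
    (* For [K] the old maximum point is pushed out to the new radius. So [K] advances with the slope
       at the inner radius and [F] with the slope at the outer one; the last term of the conclusion
       carries this lag of one step. *)
    set (x := (RtoC (q / p) * yK)%C).
    assert (Ex : (x - yK)%C = (RtoC (/ p) * yK)%C).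
    { unfold x. replace (q / p) with (1 + / p) by (rewrite Eq; field; lra).
      rewrite RtoC_plus. ring. }
    assert (Mx : Cmod (x - yK)%C = del).
    { rewrite Ex, Cmod_mult, Cmod_R, Rabs_pos_eq, EyK.
      - field. lra.
      - left. apply Rinv_0_lt_compat; auto. }
    assert (Hx : Cmod x = q * del).
    { unfold x. rewrite Cmod_mult, Cmod_R, Rabs_pos_eq, EyK.
      - field. lra.
      - apply Rmult_le_pos; [lra|]. left. apply Rinv_0_lt_compat; auto. }
    assert (Q := QK yK x ltac:(lra) ltac:(lra)). rewrite Mx in Q.
    apply (Re_close c) in Q. fold E in Q.
    replace (c * (Cderiv K yK * (x - yK)))%C with (RtoC (/ p) * (c * g yK))%C in Q.
    2:{ destruct HA as (_ & _ & HE). rewrite Ex, <- HE by lra. ring. }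
    rewrite re_scal_l in Q.
    assert (UK := MK x ltac:(lra)).
    assert (D : Re (c * g (om zF))%C / q <= Re (c * g zK)%C / q).
    { apply Rmult_le_compat_r; auto. left. apply Rinv_0_lt_compat; lra. }
    assert (XE : 2 * E * q = 2 * E * p + 2 * E) by (rewrite Eq; ring).
    unfold Rdiv in *. lra.
Qed.

(** With [n] radii there are [n] errors of order [1 / n^2], and the leftover slope term is divided
    by [n], so everything lost is of order [1 / n]. *)
Lemma support_function_le g K F om (c : CC) (r : R) zK :
  starlike_map g -> alexander g K -> hol 1 F -> F (RtoC 0) = K (RtoC 0) ->
  (forall z, Cmod z < 1 -> (z * Cderiv F z)%C = g (om z)) ->
  (forall z, Cmod z < 1 -> Cmod (om z) <= Cmod z) ->
  0 < r < 1 -> Cmod zK = r -> (forall z, Cmod z <= r -> Re (c * K z)%C <= Re (c * K zK)%C) ->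
  forall z, Cmod z <= r -> Re (c * F z)%C <= Re (c * K zK)%C.
Proof.
  intros Hg HA HF H0 HFE Hom Hr HzK MK z Hz.
  destruct (max_Re_on_circle (fun z => c * F z)%C r ltac:(lra)) as [zF [EF MF]].
  { intros y Hy. apply cdiff_scal, HF. lra. }
  apply Rle_trans with (Re (c * F zF)%C); [apply MF; auto|].
  destruct (hol_quadratic 1 K r ltac:(apply HA) ltac:(lra)) as [C1 [P1 Q1]].
  destruct (hol_quadratic 1 F r HF ltac:(lra)) as [C2 [P2 Q2]].
  pose (C := C1 + C2).
  assert (LC : forall x a, 0 <= a -> x <= C1 * (a * a) \/ x <= C2 * (a * a) -> x <= C * (a * a)).
  { intros x a Ha. assert (0 <= a * a) by nra.
    assert (0 <= C1 * (a * a)) by (apply Rmult_le_pos; auto).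
    assert (0 <= C2 * (a * a)) by (apply Rmult_le_pos; auto). unfold C. rewrite Rmult_plus_distr_r. intros [X|X]; lra. }
  apply Rnot_lt_le. intros L. set (d := Re (c * F zF)%C - Re (c * K zK)%C).
  (* The total loss is at most [M / n], which falls below the supposed excess [d] once
     [n > M / d]. *)
  set (M := Rabs (Re (c * g zK)%C) + 2 * (Cmod c * (C * (r * r)))).
  assert (Pd : 0 < d) by (unfold d; lra).
  destruct (INR_unbounded (M / d)) as [n Hn].
  assert (PC : 0 <= Cmod c * (C * (r * r))).
  { apply Rmult_le_pos; [apply Cmod_ge_0|]. apply Rmult_le_pos; [unfold C; lra|nra]. }
  assert (PM : 0 <= M) by (unfold M; assert (X := Rabs_pos (Re (c * g zK)%C)); lra).
  assert (Pn : 0 < INR n).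
  { apply Rle_lt_trans with (M / d); auto. apply Rmult_le_pos; auto. left. apply Rinv_0_lt_compat; auto. }
  destruct n as [|i]; [simpl in Pn; lra|].
  assert (S := support_function_step g K F om c r C (S i) Hg HA HF H0 HFE Hom Hr
    ltac:(unfold C; lra) ltac:(lia)
    ltac:(intros; apply LC; [apply Cmod_ge_0|left; apply Q1; auto])
    ltac:(intros; apply LC; [apply Cmod_ge_0|right; apply Q2; auto])
    i (le_n _) zF zK).
  set (n := INR (Datatypes.S i)) in *.
  assert (En : n * (r / n) = r) by (field; lra). rewrite En in S.
  specialize (S EF ltac:(rewrite EF; auto) HzK ltac:(rewrite HzK; auto)).
  replace (2 * (Cmod c * (C * (r / n * (r / n)))) * n) with (2 * (Cmod c * (C * (r * r))) / n)
    in S by (field; lra).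
  assert (X : Re (c * g zK)%C / n <= Rabs (Re (c * g zK)%C) / n).
  { apply Rmult_le_compat_r; [left; apply Rinv_0_lt_compat; auto|apply RRle_abs]. }
  assert (Y : d <= M / n) by (unfold d, M, Rdiv in *; lra).
  assert (Z : M / n < d).
  { apply (Rmult_lt_reg_r n); auto. unfold Rdiv. rewrite Rmult_assoc, Rinv_l, Rmult_1_r by lra.
    apply (Rmult_lt_compat_r d) in Hn; auto. unfold Rdiv in Hn.
    rewrite Rmult_assoc, Rinv_l, Rmult_1_r in Hn by lra. lra. }
  lra.
Qed.

(** If [K] omits [F z1], take the point of the image of [|z| <= r] nearest to it; by the maximum
    principle for [1 / (K - F z1)] it is some [K z2] with [|z2| = r]. The vector from [K z2] to
    [F z1] is a positive multiple of the normal [g z2], so [F z1] lies beyond the supporting line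
    there. *)
Lemma image_subset g K F om z1 :
  starlike_map g -> alexander g K -> hol 1 F -> F (RtoC 0) = K (RtoC 0) ->
  (forall z, Cmod z < 1 -> (z * Cderiv F z)%C = g (om z)) ->
  (forall z, Cmod z < 1 -> Cmod (om z) <= Cmod z) ->
  Cmod z1 < 1 -> exists w, Cmod w < 1 /\ K w = F z1.
Proof.
  intros Hg HA HF H0 HFE Hom Hz1.
  destruct (Rle_lt_or_eq_dec 0 (Cmod z1) (Cmod_ge_0 z1)) as [L|Eq].
  2:{ exists z1. split; auto. symmetry in Eq. apply Cmod_eq_0 in Eq. subst. auto. }
  set (r := Cmod z1) in *. apply NNPP. intros N.
  assert (NZ : forall z, Cmod z <= r -> (K z - F z1)%C <> RtoC 0).
  { intros z Hz. apply Cminus_eq_contra. intros E. apply N. exists z. split; auto. lra. }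
  assert (HK : hol 1 K) by apply HA.
  set (h := fun z => (/ (K z - F z1))%C).
  destruct (max_on_circle h r L) as [z2 [E2 M2]].
  { intros z Hz. destruct (HK z ltac:(lra)) as [l Hl].
    eexists. apply der_inv; [apply NZ; auto|]. apply der_minus; [exact Hl|apply der_const]. }
  set (d := (F z1 - K z2)%C).
  assert (N2 := NZ z2 ltac:(lra)).
  assert (Nd : d <> RtoC 0).
  { unfold d. intros E. apply N2. replace (K z2 - F z1)%C with (- (F z1 - K z2))%C by ring.
    rewrite E. ring. }
  destruct HA as (_ & HA0 & HAE). assert (HA : alexander g K) by (split; auto).
  (* The factor [- d] makes the value at [z2] equal to 1, the maximum of the modulus, so the real
     part is maximal there too. *)
  assert (B := boundary_max (fun z => (- d) * h z)%C z2
     ((- d) * (- Cderiv K z2 / ((K z2 - F z1) * (K z2 - F z1))))%C ltac:(lra)).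
  assert (Ng := starlike_neq0 g z2 Hg ltac:(lra)).
  replace (z2 * (- d * (- Cderiv K z2 / ((K z2 - F z1) * (K z2 - F z1)))))%C with (g z2 / d)%C in B.
  2:{ rewrite <- HAE by lra.
      replace (K z2 - F z1)%C with (- d)%C by (unfold d; ring). field. auto. }
  destruct B as [L1 L2].
  - apply der_scal. eapply der_eq.
    + apply der_inv; [auto|]. apply der_minus; [apply cdiff_cderiv, HK; lra|apply der_const].
    + cbv beta. unfold Cdiv. ring.
  - intros z Hz. rewrite E2 in Hz.
    replace (Re (- d * h z2)%C) with 1.
    + eapply Rle_trans; [apply RRle_abs|]. eapply Rle_trans; [apply re_le_Cmod|].
      specialize (M2 z Hz). rewrite Cmod_mult, Cmod_opp.
      apply Rle_trans with (Cmod d * Cmod (h z2)).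
      * apply Rmult_le_compat_l; auto. apply Cmod_ge_0.
      * right. unfold h. rewrite Cmod_inv by auto.
        replace (K z2 - F z1)%C with (- d)%C by (unfold d; ring). rewrite Cmod_opp.
        apply Rinv_r. apply Rgt_not_eq, Cmod_gt_0; auto.
    + unfold h. replace (- d)%C with (K z2 - F z1)%C by (unfold d; ring).
      rewrite Cinv_r by auto. reflexivity.
  - set (lam := Re (g z2 / d)%C) in *.
    assert (Pl : 0 < lam).
    { destruct L1 as [L1|L1]; auto. exfalso. rewrite <- L1 in L2.
      apply Ng. replace (g z2) with (g z2 / d * d)%C by (field; auto). rewrite L2. ring. }
    assert (Nl : RtoC lam <> RtoC 0) by (intros E; apply RtoC_inj in E; lra).
    assert (Ed : F z1 = (K z2 + (/ lam)%R * g z2)%C).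
    { rewrite RtoC_inv by lra. replace (g z2) with (lam * d)%C.
      - unfold d. field. auto.
      - rewrite <- L2. field. auto. }
    assert (SL := supporting_line g K z2 Hg HA ltac:(lra)). rewrite E2 in SL.
    assert (SF := support_function_le g K F om (Cconj (g z2)) r z2 Hg HA HF H0 HFE Hom
                    ltac:(lra) E2 SL z1 ltac:(unfold r; lra)).
    rewrite Ed in SF.
    replace (Cconj (g z2) * (K z2 + (/ lam)%R * g z2))%C
      with (Cconj (g z2) * K z2 + RtoC (/ lam) * (g z2 * Cconj (g z2)))%C in SF by ring.
    rewrite <- Cmod2_conj, <- RtoC_mult in SF.
    assert (0 < / lam * Cmod (g z2) ^ 2).
    { apply Rmult_lt_0_compat; [apply Rinv_0_lt_compat; auto|].
      apply pow_lt, Cmod_gt_0; auto. }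
    unfold Re, Cplus in SF. simpl in *. lra.
Qed.

(** * The length inequality *)

Lemma hol_holo_D f : holo_D f -> hol 1 f.
Proof. intros H z Hz. apply cdiff_ex_derive, H, Hz. Qed.

Lemma hol_seg_int R h : hol R h -> hol R (seg_int h).
Proof. intros H z Hz. eexists. eapply seg_int_der; eauto. Qed.

Lemma Cderiv_seg_int R h z : hol R h -> Cmod z < R -> Cderiv (seg_int h) z = h z.
Proof. intros H Hz. apply Cderiv_unique. eapply seg_int_der; eauto. Qed.

Lemma Cmod_1_conj eps : Cmod eps = 1 -> (Cconj eps * eps)%C = RtoC 1.
Proof. intros H. rewrite Cmult_comm, <- Cmod2_conj, H. f_equal. ring. Qed.

Lemma Cmod_rot eps z : Cmod eps = 1 -> Cmod (eps * z)%C = Cmod z.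
Proof. intros H. rewrite Cmod_mult, H. ring. Qed.

Lemma cder_rot f eps z l : cder f (eps * z)%C l -> cder (fun z => f (eps * z)%C) z (l * eps)%C.
Proof.
  intros H. eapply der_eq.
  - apply (der_comp idC (fun z => eps * z)%C f); [apply der_scal, der_id|exact H].
  - ring.
Qed.

Lemma starlike_map_of_domain Omega phi :
  normalized_riemann_map Omega phi -> starlike_wrt_1 Omega ->
  starlike_map (fun z => phi z - 1)%C.
Proof.
  intros (Hh & Hi & HO & H0 & _) Hs. apply hol_holo_D in Hh. split; [|split; [|split]].
  - intros z Hz. apply cdiff_minus; [apply Hh; auto|apply cdiff_const].
  - intros z w Hz Hw E. apply Hi; auto.
    replace (phi z) with (phi z - 1 + 1)%C by ring. rewrite E. ring.
  - rewrite H0. ring.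
  - intros z t Hz Ht.
    assert (X : Omega (phi z)) by (apply HO; exists z; auto).
    apply (fun X => Hs _ X t Ht), HO in X. destruct X as [z' [Hz' E]].
    exists z'. split; auto. rewrite E. ring.
Qed.

Lemma qphi_backshift phi : phi (RtoC 0) = RtoC 1 -> qphi phi = backshift phi.
Proof. intros H. unfold qphi, backshift. rewrite H. reflexivity. Qed.

Lemma alexander_qphi phi :
  hol 1 phi -> inj_D phi -> phi (RtoC 0) = RtoC 1 ->
  alexander (fun z => phi z - 1)%C (seg_int (qphi phi)).
Proof.
  intros Hh Hi H0. rewrite (qphi_backshift phi H0). assert (HB := hol_backshift 1 phi Hh).
  assert (Z : Cmod (RtoC 0) < 1) by (rewrite Cmod_0; lra).
  split; [|split].
  - apply hol_seg_int; auto.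
  - rewrite (Cderiv_seg_int 1), backshift_0 by auto. apply inj_Cderiv_neq0; auto.
  - intros z Hz. rewrite (Cderiv_seg_int 1), (backshift_eq phi z), H0 by auto. ring.
Qed.

Definition logder (f : CC -> CC) (z : CC) : CC := (Cderiv (Cderiv f) z / Cderiv f z)%C.

Lemma hol_logder f : hol 1 f -> (forall z, Cmod z < 1 -> Cderiv f z <> RtoC 0) -> hol 1 (logder f).
Proof.
  intros Hf Hn z Hz. apply cdiff_div; auto; repeat apply (hol_Cderiv 1); auto.
Qed.

(** This avoids branches of the logarithm: with [F] the primitive of [f'' / f'], the product
    [f' exp(-F)] has derivative zero and equals 1 at 0. *)
Lemma Cderiv_eq_exp f : hol 1 f -> (forall z, Cmod z < 1 -> Cderiv f z <> RtoC 0) ->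
  Cderiv f (RtoC 0) = RtoC 1 ->
  forall z, Cmod z < 1 -> Cderiv f z = Cexp (seg_int (logder f) z).
Proof.
  intros Hf Hn H1 z Hz. assert (Hl := hol_logder f Hf Hn). assert (Hd := hol_Cderiv 1 f Hf).
  set (F := seg_int (logder f)). set (u := fun z => (Cderiv f z * Cexp (-1 * F z))%C).
  assert (Du : forall z, Cmod z < 1 -> cder u z (RtoC 0)).
  { intros y Hy. eapply der_eq.
    - apply der_mult; [apply cdiff_cderiv, Hd, Hy|].
      apply (der_comp idC (fun z => -1 * F z)%C Cexp); [|apply cder_Cexp].
      apply der_scal. apply (seg_int_der 1); auto.
    - cbv beta. unfold logder. field. auto. }
  assert (E : u z = RtoC 1).
  { apply (hol_eq_of_Cderiv 1 u (fun _ => RtoC 1)); auto.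
    - intros y Hy. eexists. apply Du, Hy.
    - intros y _. apply cdiff_const.
    - unfold u, F. rewrite seg_int_0, H1, Cmult_0_r, Cexp_0. ring.
    - intros y Hy. rewrite (Cderiv_unique _ _ _ (Du y Hy)).
      symmetry. apply Cderiv_unique, der_const. }
  unfold u in E.
  assert (I : (Cexp (-1 * F z) * Cexp (F z))%C = RtoC 1).
  { rewrite <- Cexp_plus, <- Cexp_0. f_equal. ring. }
  replace (Cderiv f z) with (Cderiv f z * (Cexp (-1 * F z) * Cexp (F z)))%C by (rewrite I; ring).
  rewrite Cmult_assoc, E. ring.
Qed.

Lemma Cmod_Cexp_half (z : CC) : Cmod (Cexp z) = Cmod (Cexp (/ 2 * z)%C) ^ 2.
Proof.
  replace (Cexp z) with (Cexp (/ 2 * z) * Cexp (/ 2 * z))%C.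
  - rewrite Cmod_mult. ring.
  - rewrite <- Cexp_plus. f_equal. field.
Qed.

Lemma Lr_M2 r f h : 0 < r < 1 -> hol 1 h ->
  (forall z, Cmod z < 1 -> Cmod (Cderiv f z) = Cmod (h z) ^ 2) -> Lr r f = r * M2 r h.
Proof.
  intros Hr Hh E. unfold M2. rewrite <- RInt_scalR.
  - apply RInt_ext. intros t _. rewrite <- E; [reflexivity|]. rewrite Cmod_circ; lra.
  - apply ex_M2; [lra|]. intros z Hz. apply Hh. lra.
Qed.

Theorem theorem1 (Omega : CC -> Prop) (phi : CC -> CC)
  (hphi : normalized_riemann_map Omega phi)
  (hOmega1 : Omega (RtoC 1))
  (hOmegaC : exists w : CC, ~ Omega w)
  (hstar : starlike_wrt_1 Omega) :
  forall f : CC -> CC, classC Omega f ->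
  forall r : R, 0 < r < 1 ->
    Lr r f <= Lr r (kOmega phi) /\
    (Lr r f = Lr r (kOmega phi) <->
     exists eps : CC, Cmod eps = 1 /\
       forall z : CC, inD z -> f z = Cmult (Cconj eps) (kOmega phi (Cmult eps z))).
Proof.
  intros f [[Hf [f0 f1]] HC] r Hr. apply hol_holo_D in Hf.
  assert (Hg := starlike_map_of_domain Omega phi hphi hstar).
  destruct hphi as (Hh & Hi & HO & H0 & _). apply hol_holo_D in Hh.
  assert (HA := alexander_qphi phi Hh Hi H0).
  set (g := fun z => (phi z - 1)%C) in *. set (K := seg_int (qphi phi)) in *.
  assert (HK : hol 1 K) by apply HA.
  assert (K0 : K (RtoC 0) = RtoC 0) by apply seg_int_0.
  assert (Hn : forall z, Cmod z < 1 -> Cderiv f z <> RtoC 0) by (intros; apply HC; auto).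
  assert (Hl := hol_logder f Hf Hn). set (F := seg_int (logder f)).
  assert (HF : hol 1 F) by (apply hol_seg_int; auto).
  assert (Ef := Cderiv_eq_exp f Hf Hn f1). fold F in Ef.
  destruct (subordination phi (fun z => 1 + z * logder f z)%C) as (om & _ & _ & _ & Eom & Hom); auto.
  { intros z Hz. apply cdiff_plus; [apply cdiff_const|]. apply cdiff_mult; [apply cdiff_id|auto]. }
  { rewrite H0. ring. }
  { intros z Hz. destruct (HC z Hz) as [_ X]. apply HO in X. destruct X as [w [Hw E]].
    exists w. split; auto. rewrite E. unfold logder, Cdiv. ring. }
  assert (EF : forall z, Cmod z < 1 -> (z * Cderiv F z)%C = g (om z)).
  { intros z Hz. unfold F. rewrite (Cderiv_seg_int 1) by auto. unfold g. rewrite <- Eom by auto. ring. }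
  assert (F0 : F (RtoC 0) = K (RtoC 0)) by (rewrite K0; apply seg_int_0).
  assert (Ki := alexander_inj g K Hg HA).
  destruct (subordination K F) as (w & Hw & W0 & W1 & Ew & Ws); auto.
  { intros z Hz. apply (image_subset g K F om); auto. }
  set (h := fun z => Cexp (/ 2 * K z)%C).
  assert (Hhh : hol 1 h) by (intros z Hz; apply cdiff_exp, cdiff_scal, HK, Hz).
  assert (Dk : forall z, Cmod z < 1 -> cder (kOmega phi) z (Cexp (K z))).
  { intros z Hz. apply (seg_int_der 1 (fun t => Cexp (K t))); auto.
    intros y Hy. apply cdiff_exp, HK, Hy. }
  assert (Lk : Lr r (kOmega phi) = r * M2 r h).
  { apply Lr_M2; auto. intros z Hz. rewrite (Cderiv_unique _ _ _ (Dk z Hz)). apply Cmod_Cexp_half. }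
  assert (Lf : Lr r f = r * M2 r (fun z => h (w z))).
  { apply Lr_M2; auto.
    - intros z Hz. apply cdiff_comp; [auto|apply Hhh; auto].
    - intros z Hz. rewrite Ef, Ew by auto. apply Cmod_Cexp_half. }
  assert (LE : Lr r f <= Lr r (kOmega phi)).
  { rewrite Lk, Lf. apply Rmult_le_compat_l; [lra|]. apply littlewood; auto. }
  split; auto. split.
  - intros E. rewrite Lk, Lf in E. apply Rmult_eq_reg_l in E; [|lra].
    (* Either [w] is a rotation, by the equality case of Schwarz, or [|w z| < |z|] off 0 and
       [littlewood_strict] contradicts the equality of lengths. *)
    destruct (classic (exists z, 0 < Cmod z < 1 /\ Cmod (w z) = Cmod z)) as [[z0 [Hz0 E0]]|N].
    + destruct (schwarz_eq w z0 Hw) as (eps & He & HE); auto.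
      { intros z Hz. left. auto. }
      exists eps. split; auto. intros z Hz.
      assert (Dr : forall z, Cmod z < 1 ->
        cder (fun z => Cconj eps * kOmega phi (eps * z))%C z (Cexp (K (eps * z)%C))).
      { intros y Hy. eapply der_eq.
        - apply der_scal, cder_rot, Dk. rewrite Cmod_rot; auto.
        - transitivity ((Cconj eps * eps) * Cexp (K (eps * y)))%C; [ring|].
          rewrite Cmod_1_conj by auto. ring. }
      apply (hol_eq_of_Cderiv 1 f (fun z => Cconj eps * kOmega phi (eps * z))%C); auto.
      * intros y Hy. eexists. apply Dr, Hy.
      * rewrite f0, Cmult_0_r. unfold kOmega. rewrite seg_int_0. ring.
      * intros y Hy. rewrite (Cderiv_unique _ _ _ (Dr y Hy)), Ef, Ew, HE by auto. reflexivity.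
    + exfalso. assert (S := littlewood_strict r h w Hr Hhh Hw Ws).
      assert (X : M2 r (fun z => h (w z)) < M2 r h); [|lra]. apply S.
      * rewrite (Cderiv_unique h (RtoC 0) (Cexp (/ 2 * K (RtoC 0)) * (/ 2 * Cderiv K (RtoC 0)))%C).
        -- apply Cmult_neq_0; [apply Cexp_neq0|]. apply Cmult_neq_0; [|apply HA].
           apply Cmod_neq0. rewrite Cmod_inv, Cmod_R by (intros E2; apply RtoC_inj in E2; lra).
           apply Rinv_0_lt_compat. rewrite Rabs_pos_eq; lra.
        -- apply (der_comp idC (fun z => / 2 * K z)%C Cexp); [|apply cder_Cexp].
           apply der_scal, cdiff_cderiv, HK. rewrite Cmod_0; lra.
      * intros z Hz. destruct (Rle_lt_or_eq_dec _ _ (Ws z ltac:(lra))) as [L|Eq]; auto.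
        exfalso. apply N. exists z. auto.
  - intros (eps & He & HE). apply Rle_antisym; auto.
    assert (He' : Cmod (Cconj eps) = 1) by (rewrite Cmod_conj; auto).
    set (h2 := fun z => h (eps * z)%C).
    assert (Hh2 : hol 1 h2).
    { intros z Hz. destruct (Hhh (eps * z)%C) as [l D]; [rewrite Cmod_rot; auto|].
      eexists. apply cder_rot, D. }
    assert (L2 : Lr r f = r * M2 r h2).
    { apply Lr_M2; auto. intros z Hz.
      rewrite (Cderiv_unique f z (Cexp (K (eps * z)%C))); [apply Cmod_Cexp_half|].
      apply (der_local _ (fun z => Cconj eps * kOmega phi (eps * z))%C _ _ _ (1 - Cmod z)).
      - lra.
      - intros y Hy. symmetry. apply HE. unfold inD.
        assert (T := Cmod_triangle (y - z)%C z). replace (y - z + z)%C with y in T by ring. lra.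
      - eapply der_eq.
        + apply der_scal, cder_rot, Dk. rewrite Cmod_rot; auto.
        + transitivity ((Cconj eps * eps) * Cexp (K (eps * z)))%C; [ring|].
          rewrite Cmod_1_conj by auto. ring. }
    rewrite L2, Lk. apply Rmult_le_compat_l; [lra|].
    (* Instead of a change of variable on the circle: [h] is [h2] composed with the inverse
       rotation, itself a Schwarz function, so [littlewood] gives the reverse inequality. *)
    rewrite (M2_ext r h (fun z => h2 (Cconj eps * z)%C)).
    + apply littlewood; auto.
      * intros z _. apply cdiff_scal, cdiff_id.
      * intros z _. rewrite Cmod_rot; auto. lra.
    + lra.
    + intros z _. unfold h2. rewrite Cmult_assoc, (Cmult_comm eps), Cmod_1_conj, Cmult_1_l by auto.
      reflexivity.
Qed.
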